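(* Let $n\ge 2$. The expected values of the radius of gyration $\mathrm{Gyradius}$ on the arm and polygon spaces with respect to the symmetric measure are $$E(\mathrm{Gyradius},\mathrm{Arm}_3(n))=\frac{n+2}{(n+1)(n+\frac12)},\qquad E(\mathrm{Gyradius},\mathrm{Pol}_3(n))=\frac{1}{2}\,\frac1n,$$ $$E(\mathrm{Gyradius},\mathrm{Arm}_2(n))=\frac43\,\frac{n+2}{(n+1)^2},\qquad E(\mathrm{Gyradius},\mathrm{Pol}_2(n))=\frac23\,\frac{n+1}{n(n+2)}.$$
   Context: Polygons. For $d\in\{2,3\}$, $\mathrm{Arm}_d(n)$ is the space of lists $(e_1,\dots,e_n)$ of edge vectors in $\mathbb{R}^d$ with $\sum|e_i|=2$, and $\mathrm{Pol}_d(n)\subset\mathrm{Arm}_d(n)$ is the subspace of closed polygons, $\sum e_i=0$. The vertices are $v_1$ (arbitrary) and $v_{m+1}=v_m+e_m$. The (squared) radius of gyration is half the average squared distance between vertices: on $\mathrm{Arm}_d(n)$, $\mathrm{Gyradius}=\frac1{2(n+1)^2}\sum_{i,j=1}^{n+1}|v_i-v_j|^2$; on $\mathrm{Pol}_d(n)$, where polygons are regarded as having $n$ vertices, $\mathrm{Gyradius}=\frac1{2n^2}\sum_{i,j=1}^{n}|v_i-v_j|^2$. Hopf map. Let $\mathbb{H}$ be the quaternions with units $\mathbf i,\mathbf j,\mathbf k$. Identify $\mathbb{R}^3$ with the imaginary quaternions and $\mathbb{R}^2$ with the plane $\mathbf i\mathbb{R}\oplus\mathbf k\mathbb{R}$.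 Let $\mathrm{Hopf}(q)=\bar q\,\mathbf i\,q$, extended coordinatewise to $\mathbb{H}^n$, so that $q=(q_1,\dots,q_n)$ maps to the edge list $e_m=\bar q_m\mathbf i q_m$, with $|e_m|=|q_m|^2$. Identify $\mathbb{C}^n\times\mathbb{C}^n$ with $\mathbb{H}^n$ by $(a,b)\mapsto a+b\,\mathbf j$, where $\mathbb{C}=\mathbb{R}\oplus\mathbf i\mathbb{R}$. Symmetric measure. $\mathrm{Hopf}$ maps the following model spaces onto the polygon spaces: the sphere $S^{4n-1}\subset\mathbb{H}^n$ of radius $\sqrt2$ onto $\mathrm{Arm}_3(n)$; the disjoint union $S^{2n-1}\sqcup S^{2n-1}$ of the spheres of radius $\sqrt2$ in $(\mathbb{R}\oplus\mathbf j\mathbb{R})^n$ and $(\mathbf i\mathbb{R}\oplus\mathbf k\mathbb{R})^n$ onto $\mathrm{Arm}_2(n)$; the Stiefel manifold $V_2(\mathbb{C}^n)$ of Hermitian-orthonormal pairs $(a,b)$ in $\mathbb{C}^n$ onto $\mathrm{Pol}_3(n)$; and $V_2(\mathbb{R}^n)\sqcup\mathbf i V_2(\mathbb{R}^n)$, where $V_2(\mathbb{R}^n)$ is the set of orthonormal pairs in $\mathbb{R}^n$, onto $\mathrm{Pol}_2(n)$. The symmetric measure on each polygon space is the pushforward under $\mathrm{Hopf}$ of the Riemannian volume measure (as a submanifold of $\mathbb{H}^n$) of its model space, normalized to total mass $1$. $E(f,X)$ denotes the expectation of $f$ on $X$ with respect to the symmetric measure. *)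

(* Defs.v *)
From HB Require Import structures.
From mathcomp Require Import all_boot all_order all_algebra.
From mathcomp Require Import complex ring.
From mathcomp Require Import all_classical all_reals all_analysis.

Set Implicit Arguments.
Unset Strict Implicit.
Unset Printing Implicit Defensive.

Import Order.TTheory GRing.Theory Num.Theory.
Import numFieldNormedType.Exports.

Local Open Scope classical_set_scope.
Local Open Scope ring_scope.

Section Polygons.
Context {R : realType}.

Definition eucl_dot p q (A B : 'M[R]_(p, q)) : R :=
  \sum_i \sum_j A i j * B i j.

Definition eucl_norm p q (A : 'M[R]_(p, q)) : R := Num.sqrt (eucl_dot A A).

(* An edge list (e_1, ..., e_n) in R^d is the matrix whose rows are the e_m. *)
Definition Arm d n : set 'M[R]_(n, d) :=
  [set e | \sum_m eucl_norm (row m e) = 2].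

Definition Pol d n : set 'M[R]_(n, d) :=
  [set e | Arm e /\ \sum_m row m e = 0].

(* The vertices are numbered from 0: vertex v e 0 = v is the arbitrary start. *)
Definition vertex d n (v : 'rV[R]_d) (e : 'M[R]_(n, d)) (m : nat) : 'rV[R]_d :=
  v + \sum_(k < n | (k < m)%N) row k e.

(* The first N vertices are taken into account; the starting vertex, on which
   the value does not depend (gyradius_start), is put at the origin. *)
Definition gyradius (N : nat) d n (e : 'M[R]_(n, d)) : R :=
  (2 * N%:R ^+ 2)^-1 *
  \sum_(i < N) \sum_(j < N) eucl_norm (vertex 0 e i - vertex 0 e j) ^+ 2.

Lemma gyradius_start (N : nat) d n (v : 'rV[R]_d) (e : 'M[R]_(n, d)) :
  gyradius N e = (2 * N%:R ^+ 2)^-1 *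
  \sum_(i < N) \sum_(j < N) eucl_norm (vertex v e i - vertex v e j) ^+ 2.
Proof.
congr (_ * _); apply: eq_bigr => i _; apply: eq_bigr => j _.
by congr (eucl_norm _ ^+ 2); rewrite /vertex add0r add0r opprD addrACA subrr add0r.
Qed.

Definition gyradius_arm d n (e : 'M[R]_(n, d)) : R := gyradius n.+1 e.
Definition gyradius_pol d n (e : 'M[R]_(n, d)) : R := gyradius n e.

End Polygons.

Section Quaternions.
Context {R : realType}.

(* A quaternion is the row of its coordinates in the basis 1, i, j, k. *)
Definition quat (a b c d : R) : 'rV[R]_4 := \row_l nth 0 [:: a; b; c; d] l.

Definition qi := quat 0 1 0 0.
Definition qj := quat 0 0 1 0.

Definition qcoord (q : 'rV[R]_4) (l : nat) : R := q 0 (inord l).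

Definition qmul (x y : 'rV[R]_4) : 'rV[R]_4 :=
  let a1 := qcoord x 0 in let b1 := qcoord x 1 in
  let c1 := qcoord x 2 in let d1 := qcoord x 3 in
  let a2 := qcoord y 0 in let b2 := qcoord y 1 in
  let c2 := qcoord y 2 in let d2 := qcoord y 3 in
  quat (a1 * a2 - b1 * b2 - c1 * c2 - d1 * d2)
       (a1 * b2 + b1 * a2 + c1 * d2 - d1 * c2)
       (a1 * c2 - b1 * d2 + c1 * a2 + d1 * b2)
       (a1 * d2 + b1 * c2 - c1 * b2 + d1 * a2).

Definition qconj (x : 'rV[R]_4) : 'rV[R]_4 :=
  quat (qcoord x 0) (- qcoord x 1) (- qcoord x 2) (- qcoord x 3).

Definition hopf (q : 'rV[R]_4) : 'rV[R]_4 := qmul (qmul (qconj q) qi) q.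

(* H^n is 'M[R]_(n, 4), with one quaternion in each row.  The two maps below
   read the coordinatewise Hopf map in R^3 = iR + jR + kR, respectively in
   R^2 = iR + kR; the coordinates left out vanish by hopf_re and by
   hopf_planar1, hopf_planar2. *)
Definition hopf3 n (q : 'M[R]_(n, 4)) : 'M[R]_(n, 3) :=
  \matrix_(m, c) qcoord (hopf (row m q)) (nth 0 [:: 1; 2; 3] c)%N.

Definition hopf2 n (q : 'M[R]_(n, 4)) : 'M[R]_(n, 2) :=
  \matrix_(m, c) qcoord (hopf (row m q)) (nth 0 [:: 1; 3] c)%N.

Lemma qcoord_quat a b c d l : (l < 4)%N ->
  qcoord (quat a b c d) l = nth 0 [:: a; b; c; d] l.
Proof. by move=> l4; rewrite /qcoord mxE inordK. Qed.

Lemma hopfE (q : 'rV[R]_4) :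
  let a := qcoord q 0 in let b := qcoord q 1 in
  let c := qcoord q 2 in let d := qcoord q 3 in
  hopf q = quat 0 (a ^+ 2 + b ^+ 2 - c ^+ 2 - d ^+ 2)
                  (2 * (b * c - a * d)) (2 * (a * c + b * d)).
Proof. by rewrite /hopf /qmul /qconj /qi !qcoord_quat//=; congr quat; ring. Qed.

Lemma hopf_re (q : 'rV[R]_4) : qcoord (hopf q) 0 = 0.
Proof. by rewrite hopfE qcoord_quat. Qed.

Lemma hopf_planar1 (q : 'rV[R]_4) :
  qcoord q 1 = 0 -> qcoord q 3 = 0 -> qcoord (hopf q) 2 = 0.
Proof. by rewrite hopfE qcoord_quat//= => -> ->; ring. Qed.

Lemma hopf_planar2 (q : 'rV[R]_4) :
  qcoord q 0 = 0 -> qcoord q 2 = 0 -> qcoord (hopf q) 2 = 0.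
Proof. by rewrite hopfE qcoord_quat//= => -> ->; ring. Qed.

End Quaternions.

Section ModelSpaces.
Context {R : realType}.
Local Open Scope complex_scope.

Definition sphere n : set 'M[R]_(n, 4) :=
  [set q | eucl_norm q = Num.sqrt 2].

(* (R + jR)^n and (iR + kR)^n *)
Definition plane_1j n : set 'M[R]_(n, 4) :=
  [set q | forall m, qcoord (row m q) 1 = 0 /\ qcoord (row m q) 3 = 0].
Definition plane_ik n : set 'M[R]_(n, 4) :=
  [set q | forall m, qcoord (row m q) 0 = 0 /\ qcoord (row m q) 2 = 0].

Definition quat_of_complex (z : R[i]) : 'rV[R]_4 := quat (complex.Re z) (complex.Im z) 0 0.

(* (a, b) |-> a + b j *)
Definition quat_of_pair n (a b : 'rV[R[i]]_n) : 'M[R]_(n, 4) :=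
  \matrix_m (quat_of_complex (a 0 m) + qmul (quat_of_complex (b 0 m)) qj).

Definition herm_dot n (a b : 'rV[R[i]]_n) : R[i] :=
  \sum_m a 0 m * (b 0 m)^*.

Definition stiefelC n : set ('rV[R[i]]_n * 'rV[R[i]]_n) :=
  [set ab | [/\ herm_dot ab.1 ab.1 = 1, herm_dot ab.2 ab.2 = 1
              & herm_dot ab.1 ab.2 = 0]].

Definition stiefelR n : set ('rV[R]_n * 'rV[R]_n) :=
  [set ab | [/\ eucl_dot ab.1 ab.1 = 1, eucl_dot ab.2 ab.2 = 1
              & eucl_dot ab.1 ab.2 = 0]].

Definition complexify n (a : 'rV[R]_n) : 'rV[R[i]]_n := \row_m (a 0 m)%:C.

Definition model_Arm3 n : set 'M[R]_(n, 4) := @sphere n.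

Definition model_Arm2 n : set 'M[R]_(n, 4) :=
  (@sphere n `&` @plane_1j n) `|` (@sphere n `&` @plane_ik n).

Definition model_Pol3 n : set 'M[R]_(n, 4) :=
  [set quat_of_pair ab.1 ab.2 | ab in @stiefelC n].

Definition model_Pol2 n : set 'M[R]_(n, 4) :=
  [set quat_of_pair (complexify ab.1) (complexify ab.2) | ab in @stiefelR n]
  `|` [set quat_of_pair ('i *: complexify ab.1) ('i *: complexify ab.2)
      | ab in @stiefelR n].

End ModelSpaces.

Section Lebesgue.
Context {R : realType}.
Local Open Scope ereal_scope.
Local Notation T := (measurableTypeR R).

Definition cons_prod k (x : T * k.-tuple T) : k.+1.-tuple T :=
  [the k.+1.-tuple T of x.1 :: x.2].

Lemma measurable_cons_prod k : measurable_fun setT (@cons_prod k).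
Proof. by apply: measurable_cons. Qed.

HB.instance Definition _ k :=
  isMeasurableFun.Build _ _ _ _ (@cons_prod k) (@measurable_cons_prod k).

Section step.
Variables (k : nat) (m : {sigma_finite_measure set (k.-tuple T) -> \bar R}).

Definition lebesgue_cons : set (k.+1.-tuple T) -> \bar R :=
  pushforward (@lebesgue_measure R \x m) (@cons_prod k).

Let lebesgue_cons0 : lebesgue_cons set0 = 0.
Proof. exact: measure0. Qed.

Let lebesgue_cons_ge0 A : 0 <= lebesgue_cons A.
Proof. exact: measure_ge0. Qed.

Let lebesgue_cons_sigma_additive : semi_sigma_additive lebesgue_cons.
Proof.
exact: measure_semi_sigma_additive.
Qed.

HB.instance Definition _ := isMeasure.Build _ _ _ lebesgue_cons
  lebesgue_cons0 lebesgue_cons_ge0 lebesgue_cons_sigma_additive.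

Let sigma_finite_prod : sigma_finite setT (@lebesgue_measure R \x m).
Proof.
have /sigma_finiteP[F [TF ndF Foo]] := sigma_finiteT (@lebesgue_measure R).
have /sigma_finiteP[G [TG ndG Goo]] := sigma_finiteT m.
exists (fun i => F i `*` G i).
  rewrite -setXTT TF TG predeqE => -[x y]; split.
    move=> [/= [i _ Fix] [j _ Gjy]]; exists (maxn i j) => //; split.
    - by move: x Fix; exact/subsetPset/ndF/leq_maxl.
    - by move: y Gjy; exact/subsetPset/ndG/leq_maxr.
  by move=> [i _ []/= ? ?]; split; exists i.
move=> i; have [? ?] := Foo i; have [? ?] := Goo i.
split; first exact: measurableX.
by rewrite product_measure1E// lte_mul_pinfty// ge0_fin_numE.
Qed.

Let lebesgue_cons_sigma_finite : sigma_finite setT lebesgue_cons.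
Proof.
have [F FT Fm] := sigma_finite_prod.
pose g (t : k.+1.-tuple T) : T * k.-tuple T := (thead t, [tuple of behead t]).
have mg : measurable_fun setT g.
  have mt := @measurable_tnth _ T k.+1 ord0.
  exact: (measurable_fun_pair mt (@measurable_behead _ T k)).
have gK x : g (cons_prod x) = x.
  case: x => a b; rewrite /g theadE; congr pair; exact/val_inj.
exists (fun i => g @^-1` F i).
  by rewrite -preimage_bigcup -FT preimage_setT.
move=> i; have [mFi Fioo] := Fm i; split.
  by rewrite -[X in measurable X]setTI; exact: mg.
rewrite /lebesgue_cons /pushforward -comp_preimage.
by rewrite (_ : g \o _ = id) ?preimage_id//; apply/funext => x; exact: gK.
Qed.

HB.instance Definition _ := Measure_isSigmaFinite.Build _ _ _
  lebesgue_cons lebesgue_cons_sigma_finite.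

End step.

(* Lebesgue measure on R^k, as an iterated product measure *)
Fixpoint lebesgue_tuple k : {sigma_finite_measure set (k.-tuple T) -> \bar R} :=
  match k with
  | 0 => [the {sigma_finite_measure set (0.-tuple T) -> \bar R} of
            @dirac _ (0.-tuple T) [tuple] R]
  | k'.+1 => [the {sigma_finite_measure set (k'.+1.-tuple T) -> \bar R} of
            lebesgue_cons (lebesgue_tuple k')]
  end.

Definition row_of_tuple k (t : k.-tuple R) : 'rV[R]_k := \row_i tnth t i.

End Lebesgue.

(* the space of p x q real matrices, with its Borel sets *)
Definition borel_mx (R : realType) (p q : nat) : Type := 'M[R]_(p, q).

HB.instance Definition _ R p q := Measurable.copy (borel_mx R p q)
  (g_sigma_algebraType (@open 'M[R]_(p, q))).

Section RiemannianVolume.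
Context {R : realType}.
Variables (p q k : nat).
Implicit Types (M : set 'M[R]_(p, q)) (U : set 'rV[R]_k).
Implicit Types (phi : 'rV[R]_k -> 'M[R]_(p, q)).

Definition partial phi (i : 'I_k) (x : 'rV[R]_k) : 'M[R]_(p, q) :=
  'D_(delta_mx 0 i : 'rV[R]_k) phi x.

(* A C^1 parametrization of a relatively open piece phi @` U of the
   k-dimensional submanifold M: an immersion which is a homeomorphism of U
   onto its image. *)
Definition local_parametrization M U phi : Prop :=
  [/\ open U,
      forall x, U x -> differentiable phi x /\
        forall i, {for x, continuous (partial phi i)},
      forall x, U x -> forall v, 'd phi x v = 0 -> v = 0,
      {in U &, injective phi}
    & forall V, open V -> V `<=` U ->
        exists2 W, open W & phi @` V = M `&` W].

(* the first fundamental form of phi *)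
Definition gram phi (x : 'rV[R]_k) : 'M[R]_k :=
  \matrix_(i, j) eucl_dot (partial phi i x) (partial phi j x).

(* mu is the Riemannian volume measure of the k-dimensional submanifold M of
   the Euclidean space of matrices, extended by 0 outside M: in every local
   parametrization its density is sqrt (det g). *)
Definition riemannian_volume M
    (mu : {measure set (borel_mx R p q) -> \bar R}) : Prop :=
  (mu (~` M) = 0 /\
  forall U phi, local_parametrization M U phi ->
  forall B : set (borel_mx R p q), measurable B -> B `<=` phi @` U ->
    mu B = \int[lebesgue_tuple k]_(t in [set t : k.-tuple (measurableTypeR R) |
                 U (row_of_tuple t) /\ B (phi (row_of_tuple t))])
               (Num.sqrt (\det (gram phi (row_of_tuple t))))%:E)%E.

End RiemannianVolume.
Arguments riemannian_volume {R p q} k M mu.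

Section SymmetricMeasure.
Context {R : realType}.

Lemma continuous_mx p q r s (f : 'M[R]_(p, q) -> 'M[R]_(r, s)) :
  (forall i j, continuous (fun x => f x i j)) -> continuous f.
Proof.
move=> cf x A [P Pn PA].
have Pij i j : nbhs x [set y | P i j (f y i j)] by exact: (cf i j x _ (Pn i j)).
have Pi i := filter_forall (nbhs_filter x) (Pij i).
apply: filterS (filter_forall (nbhs_filter x) Pi) => y yP; exact: PA.
Qed.

Lemma continuous_measurable_mx p q r s (f : 'M[R]_(p, q) -> 'M[R]_(r, s)) :
  continuous f -> measurable_fun setT (f : borel_mx R p q -> borel_mx R r s).
Proof.
move=> /continuousP cf.
refine (@measurability _ _ (borel_mx R p q) (borel_mx R r s) setT f
  (@open 'M[R]_(r, s)) erefl _).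
by move=> _ [B oB <-]; rewrite setTI; apply: sub_gen_smallest; exact: cf.
Qed.

Lemma continuous_hopf n (m : 'I_n) (l : nat) : (l < 4)%N ->
  continuous (fun q : 'M[R]_(n, 4) => qcoord (hopf (row m q)) l).
Proof.
move=> l4.
have c k : continuous (fun q : 'M[R]_(n, 4) => qcoord (row m q) k).
  have -> : (fun q : 'M[R]_(n, 4) => qcoord (row m q) k) =
      (fun q : 'M[R]_(n, 4) => q m (inord k)).
    by apply/funext => q; rewrite /qcoord mxE.
  exact: coord_continuous.
have -> : (fun q : 'M[R]_(n, 4) => qcoord (hopf (row m q)) l) = (fun q =>
    let a := qcoord (row m q) 0 in let b := qcoord (row m q) 1 in
    let c := qcoord (row m q) 2 in let d := qcoord (row m q) 3 in
    nth 0 [:: 0; a * a + b * b - c * c - d * d;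
              2 * (b * c - a * d); 2 * (a * c + b * d)] l).
  by apply/funext => q; rewrite hopfE qcoord_quat//= !expr2.
have cD (f g : 'M[R]_(n, 4) -> R) : continuous f -> continuous g ->
    continuous (fun q => f q + g q).
  by move=> cf cg x; exact: (continuousD (cf x) (cg x)).
have cB (f g : 'M[R]_(n, 4) -> R) : continuous f -> continuous g ->
    continuous (fun q => f q - g q).
  by move=> cf cg x; exact: (continuousB (cf x) (cg x)).
have cM (f g : 'M[R]_(n, 4) -> R) : continuous f -> continuous g ->
    continuous (fun q => f q * g q).
  by move=> cf cg x; exact: (continuousM (cf x) (cg x)).
have cc (a : R) : continuous (fun _ : 'M[R]_(n, 4) => a).
  exact: cst_continuous.
case: l l4 => [_|[_|[_|[_|//]]]] /=; first exact: cc.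
- by apply: (cB _ _ (cB _ _ (cD _ _ _ _) _) _); exact: cM.
- by apply: (cM _ _ (cc 2) (cB _ _ _ _)); exact: cM.
- by apply: (cM _ _ (cc 2) (cD _ _ _ _)); exact: cM.
Qed.

Variable n : nat.

Lemma measurable_hopf3 :
  measurable_fun setT (@hopf3 R n : borel_mx R n 4 -> borel_mx R n 3).
Proof.
apply: continuous_measurable_mx; apply: continuous_mx => m c.
have -> : (fun q : 'M[R]_(n, 4) => hopf3 q m c) =
    (fun q => qcoord (hopf (row m q)) (nth 0 [:: 1; 2; 3] c)%N); last first.
  by apply: continuous_hopf; case: c => [[|[|[|]]]].
by apply/funext => q; rewrite mxE.
Qed.

Lemma measurable_hopf2 :
  measurable_fun setT (@hopf2 R n : borel_mx R n 4 -> borel_mx R n 2).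
Proof.
apply: continuous_measurable_mx; apply: continuous_mx => m c.
have -> : (fun q : 'M[R]_(n, 4) => hopf2 q m c) =
    (fun q => qcoord (hopf (row m q)) (nth 0 [:: 1; 3] c)%N); last first.
  by apply: continuous_hopf; case: c => [[|[|]]].
by apply/funext => q; rewrite mxE.
Qed.

Definition hopf3_mfun : {mfun (borel_mx R n 4) >-> (borel_mx R n 3)} :=
  HB.pack (@hopf3 R n : borel_mx R n 4 -> borel_mx R n 3)
    (isMeasurableFun.Build _ _ _ _ _ measurable_hopf3).

Definition hopf2_mfun : {mfun (borel_mx R n 4) >-> (borel_mx R n 2)} :=
  HB.pack (@hopf2 R n : borel_mx R n 4 -> borel_mx R n 2)
    (isMeasurableFun.Build _ _ _ _ _ measurable_hopf2).

(* Pushforward of the volume vol of the model space, normalized to total mass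
   1.  The Dirac mass is the fallback which mnormalize wants for a volume whose
   total mass is 0 or +oo. *)
Definition symmetric_measure d
    (H : {mfun (borel_mx R n 4) >-> (borel_mx R n d)})
    (vol : {measure set (borel_mx R n 4) -> \bar R}) :
    probability (borel_mx R n d) R :=
  [the probability (borel_mx R n d) R of
     distribution (mnormalize vol (dirac (0 : borel_mx R n 4))) H].

End SymmetricMeasure.

(* Main.v *)
(* By uniqueness of the volume in charts, the normalized volume of each model
   space is a probability invariant under all linear isometries of H^n that
   preserve the space.  The charts are central projections: q is normalized
   after one coordinate has been frozen to 1 or -1, and for a Stiefel manifold
   the second vector is moreover projected orthogonally to the first one.
   Finiteness of the volume comes from compactness, positivity from the
   positive Gram determinant.

   The gyradius of Hopf q is a linear combination of the <e_l, e_m>, which are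
   quartic in q.  Write A = E |q_m|^4, B = E |q_l|^2 |q_m|^2 and
   S = E <q_l, q_m>^2 for l <> m.  Rotating the rows l and m by 45 degrees gives
   A = B + 2 S, and sum_m |q_m|^2 = 2 gives n A + n (n - 1) B = 4.  The third
   equation is B = 4 S on Arm_3 and B = 2 S on Arm_2 (multiply q_l on the left
   by the unit quaternions preserving the model space), and n A + n (n - 1) S = 2
   on Pol_2, n A + 2 n (n - 1) S = 2 on Pol_3 (orthonormality).  Finally
   E <e_l, e_m> vanishes on arms since Hopf (j q_l) = - e_l, and equals
   - A / (n - 1) on closed polygons by exchangeability. *)
From HB Require Import structures.
Require Import Defs.
From mathcomp Require Import all_boot all_order all_algebra.
From mathcomp Require Import perm complex.
From mathcomp Require Import all_classical all_reals all_analysis.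
From mathcomp Require Import measurable_realfun zify ring lra.

Set Implicit Arguments.
Unset Strict Implicit.
Unset Printing Implicit Defensive.

Import Order.TTheory GRing.Theory Num.Theory.
Import numFieldNormedType.Exports.

Local Open Scope classical_set_scope.
Local Open Scope ring_scope.

(** * Lebesgue measure of boxes and Borel sets *)

Section lebesgue_boxes.
Context {R : realType}.
Local Notation T := (measurableTypeR R).

(** The volume is not constructed: [vol] is any measure that obeys the chart formula, so two of its
    values can only be compared by exhibiting charts. A linear isometry that preserves the space
    carries charts to charts with the same Gram matrix, and compactness spreads the local equality
    of measures; no integral is ever computed in coordinates. What matters in a chart is therefore
    that it is easy to certify. The inverse of a central projection is a quotient of two matrix
    entries, and the one identity coordinate * denominator = numerator gives injectivity, immersion
    and continuity of the inverse. The measure is then traded for a functional [E] on continuous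
    functions. The row isometries keep all scalar products of columns, and these products define all
    four spaces, so one argument serves them all; only the left multiplications by units differ from
    space to space. The planar spaces have two components, told apart near a point by the parity of
    the column of a nonzero entry. *)

Definition open_box k (a b : nat -> R) : set (k.-tuple T) :=
  [set t | forall i : 'I_k, tnth t i \in `]a i, b i[].

Lemma measurable_open_box k (a b : nat -> R) : measurable (@open_box k a b).
Proof.
have -> : @open_box k a b =
    \bigcap_(i in [set: 'I_k]) ((fun t => tnth t i) @^-1` [set` `]a i, b i[]).
  by apply/seteqP; split => t /= h i *; [exact: h|exact: (h i I)].
apply: fin_bigcap_measurable => // i _.
rewrite -[X in measurable X]setTI.
apply: measurable_tnth => //; exact: measurable_itv.
Qed.

(** The Borel sets of row vectors come from the topology, those of tuples from the product
    sigma-algebra. The two meet because an open set is the union of the countably many rational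
    boxes that it contains. *)
Lemma open_rV_measurable k (O : set 'rV[R]_k) : open O ->
  measurable ((@row_of_tuple R k : k.-tuple T -> 'rV[R]_k) @^-1` O).
Proof.
move=> oO.
pose box (ab : k.-tuple (rat * rat)) := @open_box k
  (fun i => ratr (nth (0, 0) ab i).1) (fun i => ratr (nth (0, 0) ab i).2).
(* The union runs over all rational boxes, those not contained in [O] being replaced by the empty
   set, so that the index type stays countable. *)
have -> : (@row_of_tuple R k : k.-tuple T -> 'rV[R]_k) @^-1` O =
    \bigcup_ab (if `[< box ab `<=` (@row_of_tuple R k) @^-1` O >]
                then box ab else set0).
  apply/seteqP; split => t /=; last first.
    by move=> [ab _]; case: asboolP => // sub /sub.
  move=> Ot; have /nbhs_ballP[e /= e0 eO] := open_nbhs_nbhs (conj oO Ot).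
  have lo i : {q : rat | ratr q \in `]tnth t i - e, tnth t i[}.
    apply: cid; apply: rat_in_itvoo; lra.
  have hi i : {q : rat | ratr q \in `]tnth t i, tnth t i + e[}.
    apply: cid; apply: rat_in_itvoo; lra.
  pose ab := [tuple (sval (lo i), sval (hi i)) | i < k].
  have nab (i : 'I_k) : nth (0, 0) ab i = (sval (lo i), sval (hi i)).
    by rewrite -tnth_nth tnth_mktuple.
  exists ab => //; rewrite asboolT.
    move=> i; rewrite nab /=; move: (svalP (lo i)) (svalP (hi i)).
    by rewrite !in_itv/= => /andP[_ ->] /andP[->].
  move=> s bs; apply: eO; split => // i j.
  rewrite !mxE -ball_normE /ball_ /= ltr_norml.
  have := bs j; rewrite nab /=; move: (svalP (lo j)) (svalP (hi j)).
  rewrite !in_itv/=; lra.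
apply: countable_bigcupT_measurable => [|ab].
  exact: countableP.
by case: ifP => // _; exact: measurable_open_box.
Qed.

(** Induction along the iterated product. The endpoints are sequences indexed by [nat], so that the
    tail of a box is the box of the shifted sequences. *)
Lemma lebesgue_open_box k (a b : nat -> R) : (forall i, a i < b i) ->
  (0 < lebesgue_tuple k (@open_box k a b) < +oo)%E.
Proof.
elim: k a b => [|k IH] a b ab /=.
  rewrite /dirac indicE mem_set ?lte01 ?ltry//.
  by move=> [].
rewrite /lebesgue_cons /pushforward.
have -> : @cons_prod R k @^-1` @open_box k.+1 a b =
  [set` `]a 0%N, b 0%N[] `*` @open_box k (a \o succn) (b \o succn).
  apply/seteqP; split => [[x t]|[x t]] /=.
    move=> h; split; first exact: (h ord0).
    by move=> i; have := h (lift ord0 i); rewrite tnthS.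
  move=> [h1 h2] i; case: (unliftP ord0 i) => [j ->|->//].
  by rewrite tnthS; exact: h2.
rewrite product_measure1E//; last exact: measurable_open_box.
have /andP[h1 h2] := IH (a \o succn) (b \o succn) (fun i => ab i.+1).
have := @lebesgue_measure_itv R `]a 0%N, b 0%N[.
rewrite /= lte_fin ab -EFinB => ->.
apply/andP; split.
  by rewrite mule_gt0// lte_fin subr_gt0.
by rewrite lte_mul_pinfty// lee_fin subr_ge0 ltW.
Qed.

End lebesgue_boxes.

(** * Euclidean product and Gram determinants *)

Section eucl.
Context {R : realType}.

Lemma eucl_dot0l p q (A : 'M[R]_(p, q)) : eucl_dot 0 A = 0.
Proof. by rewrite /eucl_dot big1// => i _; rewrite big1// => j _; rewrite mxE mul0r. Qed.

Lemma eucl_dotDl p q (A B C : 'M[R]_(p, q)) :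
  eucl_dot (A + B) C = eucl_dot A C + eucl_dot B C.
Proof.
rewrite /eucl_dot -big_split; apply: eq_bigr => i _ /=.
by rewrite -big_split; apply: eq_bigr => j _; rewrite mxE mulrDl.
Qed.

Lemma eucl_dotZl p q (c : R) (A B : 'M[R]_(p, q)) :
  eucl_dot (c *: A) B = c * eucl_dot A B.
Proof.
rewrite /eucl_dot mulr_sumr; apply: eq_bigr => i _ /=.
by rewrite mulr_sumr; apply: eq_bigr => j _; rewrite mxE mulrA.
Qed.

Lemma eucl_dotC p q (A B : 'M[R]_(p, q)) : eucl_dot A B = eucl_dot B A.
Proof. by apply: eq_bigr => i _; apply: eq_bigr => j _; rewrite mulrC. Qed.

Lemma eucl_dot_suml p q (I : finType) (F : I -> 'M[R]_(p, q)) (A : 'M[R]_(p, q)) :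
  eucl_dot (\sum_i F i) A = \sum_i eucl_dot (F i) A.
Proof.
by apply: (big_morph (fun B => eucl_dot B A)) => [B C|]; rewrite ?eucl_dotDl ?eucl_dot0l.
Qed.

Lemma eucl_dot_ge0 p q (A : 'M[R]_(p, q)) : 0 <= eucl_dot A A.
Proof. by do 2!apply: sumr_ge0 => ? _; rewrite -expr2 sqr_ge0. Qed.

Lemma eucl_dot_eq0 p q (A : 'M[R]_(p, q)) : eucl_dot A A = 0 -> A = 0.
Proof.
move=> /eqP; rewrite psumr_eq0 => [/allP A0|i _]; last first.
  by apply: sumr_ge0 => j _; rewrite -expr2 sqr_ge0.
apply/matrixP => i j; rewrite mxE; have := A0 i (mem_index_enum _).
rewrite psumr_eq0 => [/allP/(_ j (mem_index_enum _))|k _]; last first.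
  by rewrite -expr2 sqr_ge0.
by rewrite -expr2 sqrf_eq0 => /eqP.
Qed.

Lemma eucl_norm_sqr p q (A : 'M[R]_(p, q)) : eucl_norm A ^+ 2 = eucl_dot A A.
Proof. by rewrite sqr_sqrtr// eucl_dot_ge0. Qed.

End eucl.

Section determinants.
Context {R : realType}.

Lemma cvg_det n (T : topologicalType) (F : set_system T) (A : T -> 'M[R]_n)
    (B : 'M[R]_n) : Filter F ->
  (forall i j, A t i j @[t --> F] --> B i j) -> \det (A t) @[t --> F] --> \det B.
Proof.
move=> FF AB; apply: cvg_big => [|s _]; first exact: add_continuous.
apply: cvgM; first exact: cvg_cst.
by apply: cvg_big => [|i _]; [exact: mul_continuous|exact: AB].
Qed.

(** Every matrix on the segment from the identity to [G] is positive on nonzero vectors, hence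
    nonsingular. The determinant is continuous on the segment and equals 1 at the identity, so by
    the intermediate value theorem it cannot become nonpositive. *)
Lemma det_posdef_gt0 n (G : 'M[R]_n) :
  (forall v : 'rV[R]_n, v != 0 -> 0 < (v *m G *m v^T) 0 0) -> 0 < \det G.
Proof.
move=> posG.
pose h (s : R) := \det (s *: G + (1 - s) *: 1%:M).
have h_neq0 s : 0 <= s <= 1 -> h s != 0.
  move=> /andP[s0 s1]; apply/det0P => -[v v0].
  move=> /(congr1 (fun w => (w *m v^T) 0 0)).
  have -> : (v *m (s *: G + (1 - s) *: 1%:M) *m v^T) 0 0 =
      s * (v *m G *m v^T) 0 0 + (1 - s) * (v *m v^T) 0 0.
    rewrite mulmxDr mulmxDl -!scalemxAr -!scalemxAl mulmx1.
    by rewrite [LHS]mxE; congr (_ + _); rewrite [LHS]mxE.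
  rewrite mul0mx [RHS]mxE.
  have vv : 0 < (v *m v^T) 0 0.
    rewrite lt_neqAle eq_sym; apply/andP; split.
      apply: contra v0 => /eqP vv0; apply/eqP/eucl_dot_eq0.
      rewrite /eucl_dot big_ord1 -[RHS]vv0 mxE.
      by apply: eq_bigr => j _; rewrite mxE.
    by rewrite mxE; apply: sumr_ge0 => j _; rewrite mxE -expr2 sqr_ge0.
  have := posG v v0.
  set a := (v *m G *m v^T) 0 0; set b := (v *m v^T) 0 0 in vv *.
  move=> a0; have : 0 < s * a + (1 - s) * b; last by move=> /[swap] ->; rewrite ltxx.
  have [->|sN0] := eqVneq s 0; first by lra.
  have : 0 < s by rewrite lt_neqAle eq_sym sN0.
  by move=> sp; rewrite ltr_wpDr ?mulr_gt0// mulr_ge0 ?subr_ge0// ltW.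
have h0 : h 0 = 1 by rewrite /h scale0r add0r subr0 scale1r det1.
have h1 : h 1 = \det G by rewrite /h subrr scale0r addr0 scale1r.
rewrite -h1 ltNge; apply/negP => h1le.
have ch : {within `[0, 1], continuous h}.
  apply: continuous_subspaceT => s; apply: cvg_det => i j.
  rewrite !mxE.
  under eq_fun do rewrite !mxE.
  by apply: cvgD; apply: cvgM => //; [exact: cvg_cst|apply: cvgB => //; exact: cvg_cst|exact: cvg_cst].
have [|c] := @IVT R h 0 1 0 ler01 ch.
  by rewrite h0 ge_min h1le orbT le_max ler01.
by rewrite in_itv/= => /h_neq0 /eqP.
Qed.

End determinants.

(** * Riemannian volume in charts *)

Section local_volume.
Context {R : realType}.
Local Notation T := (measurableTypeR R).

Definition volume_density p q k (phi : 'rV[R]_k -> 'M[R]_(p, q)) x : R :=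
  Num.sqrt (\det (gram phi x)).

Variables (p q k : nat) (M : set 'M[R]_(p, q)).
Implicit Types (U V : set 'rV[R]_k) (phi : 'rV[R]_k -> 'M[R]_(p, q)).

Lemma continuous_volume_density phi x :
  (forall i, {for x, continuous (partial phi i)}) ->
  {for x, continuous (volume_density phi)}.
Proof.
move=> cphi; apply: (@continuous_comp _ _ _ (fun y => \det (gram phi y))); last first.
  exact: sqrt_continuous.
have FF : Filter (nbhs x) by exact: nbhs_filter.
apply: (@cvg_det _ _ _ (nbhs x) (gram phi)) => i j.
have cc i' a b : partial phi i' y a b @[y --> x] --> partial phi i' x a b.
  apply: (@cvg_comp _ _ _ (partial phi i') (fun A : 'M[R]_(p, q) => A a b)).
    exact: cphi.
  exact: coord_continuous.
rewrite mxE; under eq_fun do rewrite mxE.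
apply: cvg_big => [|a _]; first exact: add_continuous.
apply: cvg_big => [|b _]; first exact: add_continuous.
by apply: cvgM; exact: cc.
Qed.

Lemma diff_partial phi x v : differentiable phi x ->
  'd phi x v = \sum_i v 0 i *: partial phi i x.
Proof.
move=> dphi; rewrite {1}(row_sum_delta v) linear_sum; apply: eq_bigr => i _.
by rewrite linearZ /partial deriveE.
Qed.

(** The quadratic form of the Gram matrix at [v] is the squared length of the differential at [v],
    which is positive for an immersion. *)
Lemma volume_density_gt0 phi x : differentiable phi x ->
  (forall v, 'd phi x v = 0 -> v = 0) -> 0 < volume_density phi x.
Proof.
move=> dphi inj; rewrite sqrtr_gt0; apply: det_posdef_gt0 => v v0.
have -> : (v *m gram phi x *m v^T) 0 0 = eucl_dot ('d phi x v) ('d phi x v).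
  rewrite diff_partial// eucl_dot_suml mxE; apply: eq_bigr => j _.
  rewrite eucl_dotZl [v^T j 0]mxE mulrC; congr (_ * _).
  rewrite eucl_dotC eucl_dot_suml mxE; apply: eq_bigr => i _.
  by rewrite eucl_dotZl mxE.
rewrite lt_neqAle eucl_dot_ge0 andbT eq_sym; apply: contra v0 => /eqP.
by move=> /eucl_dot_eq0 /inj ->.
Qed.

Lemma measurable_row_of_tuple_comp V (f : 'rV[R]_k -> R) : open V ->
  (forall x, V x -> {for x, continuous f}) ->
  measurable_fun ((@row_of_tuple R k : k.-tuple T -> 'rV[R]_k) @^-1` V)
    (fun t => f (row_of_tuple t) : T).
Proof.
move=> oV cf; apply: (measurability _ (RGenOpens.measurableE R)).
move=> _ [_ [a [b ->]] <-].
rewrite -[X in measurable X]/((@row_of_tuple R k : k.-tuple T -> 'rV[R]_k) @^-1`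
  (V `&` f @^-1` `]a, b[%classic)).
apply: open_rV_measurable; rewrite openE => x [Vx fx].
apply: filterI; first exact: open_nbhs_nbhs.
apply: (cf x Vx); apply: open_nbhs_nbhs; split => //.
Qed.

Lemma local_parametrization_sub U V phi : open V -> V `<=` U ->
  local_parametrization M U phi -> local_parametrization M V phi.
Proof.
move=> oV VU [oU dU iU injU hU]; split => //.
- by move=> x /VU /dU.
- by move=> x /VU /iU.
- by move=> x y /[!inE] /VU Ux /VU Uy; apply: injU; rewrite inE.
- by move=> W oW WV; apply: hU => //; exact: subset_trans VU.
Qed.

Lemma measurable_open_mx (W : set 'M[R]_(p, q)) :
  open W -> measurable (W : set (borel_mx R p q)).
Proof. by move=> oW; exact: sub_sigma_algebra. Qed.

Lemma measurable_closed_mx (W : set 'M[R]_(p, q)) :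
  closed W -> measurable (W : set (borel_mx R p q)).
Proof.
move=> cW; rewrite -[W]setCK; apply: measurableC.
by apply: measurable_open_mx; exact: closed_openC.
Qed.

(** The density is continuous with a value [c > 0] at [x], so on a small ball it lies between
    [c / 2] and [2 * c]. A ball of the sup norm is an open box, of positive finite Lebesgue measure,
    and its image is cut out of [M] by an open set. *)
Lemma riemannian_volume_nbhs (mu : {measure set (borel_mx R p q) -> \bar R})
    U phi x : closed M -> riemannian_volume k M mu ->
  local_parametrization M U phi -> U x ->
  exists W : set 'M[R]_(p, q),
    [/\ open W, W (phi x) & (0 < mu (M `&` W) < +oo)%E].
Proof.
move=> cM [_ muM] chartU Ux.
have [oU dU iU injU hU] := chartU.
have cdens y : U y -> {for y, continuous (volume_density phi)}.
  by move=> /dU[_]; exact: continuous_volume_density.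
set c := volume_density phi x.
have c0 : 0 < c by apply: volume_density_gt0; [have [] := dU x Ux|exact: iU].
have : nbhs x (U `&` (volume_density phi) @^-1` `]c / 2, 2 * c[%classic).
  apply: filterI; first exact: open_nbhs_nbhs.
  apply: (cdens x Ux); apply: open_nbhs_nbhs; split; first exact: interval_open.
  by rewrite /= in_itv/= -/c; lra.
move=> /nbhs_ballP[e /= e0 eU].
pose V := ball x e.
have oV : open V by exact: ball_open.
have VU : V `<=` U by move=> y /eU[].
have chartV := local_parametrization_sub oV VU chartU.
have [W oW WV] := hU V oV VU.
have Vx : V x by exact: ballxx.
have WM : (M `&` W) (phi x) by rewrite -WV; exists x.
exists W; split => //; first by case: WM.
have mMW : measurable ((M `&` W) : set (borel_mx R p q)).
  by apply: measurableI; [exact: measurable_closed_mx|exact: measurable_open_mx].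
rewrite (muM V phi chartV _ mMW) ?WV//.
set D := [set t | _].
(* The coordinates of the centre as a sequence, the form that [open_box] expects; the default 0
   fills the places from [k] on. *)
pose xs j := nth 0 [seq x 0 i | i <- enum 'I_k] j.
have xsE (i : 'I_k) : xs i = x 0 i.
  by rewrite /xs (nth_map i) ?size_enum_ord// nth_ord_enum.
have rV : (@row_of_tuple R k : k.-tuple T -> 'rV[R]_k) @^-1` V =
    @open_box R k (fun j => xs j - e) (fun j => xs j + e).
  apply/seteqP; split => t /=.
    move=> [_ Vt] i; have := Vt 0 i.
    rewrite -ball_normE /ball_ /= !mxE xsE ltr_norml in_itv /=; lra.
  move=> h; split => // i j; have := h j.
  rewrite -ball_normE /ball_ /= (ord1 i) !mxE xsE ltr_norml in_itv /=; lra.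
have DE : D = (@row_of_tuple R k : k.-tuple T -> 'rV[R]_k) @^-1` V.
  apply/seteqP; split => t /=; first by case.
  by move=> Vt; split => //; rewrite -WV; exists (row_of_tuple t).
have mD : measurable D by rewrite DE; exact: open_rV_measurable.
have /andP[D0 Doo] : (0 < lebesgue_tuple k D < +oo)%E.
  by rewrite DE rV; apply: lebesgue_open_box => i; lra.
have mf : measurable_fun D (EFin \o (fun t : k.-tuple T =>
    volume_density phi (row_of_tuple t))).
  apply/measurable_EFinP; rewrite DE; apply: measurable_row_of_tuple_comp => //.
  by move=> y /VU; exact: cdens.
have bnd t : D t -> c / 2 < volume_density phi (row_of_tuple t) < 2 * c.
  by rewrite DE => /eU[_]; rewrite /= in_itv.
have cst_mfun (r : R) : measurable_fun D (cst r%:E : k.-tuple T -> \bar R).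
  exact: measurable_cst.
have f_ge0 t : D t -> (0 <= (volume_density phi (row_of_tuple t))%:E)%E.
  by move=> _; rewrite lee_fin sqrtr_ge0.
apply/andP; split.
  apply: (@lt_le_trans _ _ ((c / 2)%:E * lebesgue_tuple k D)%E).
    by rewrite mule_gt0// lte_fin; lra.
  rewrite -(integral_cst _ mD).
  apply: ge0_le_integral; [exact: mD| |exact: cst_mfun|exact: mf|].
    by move=> t _; rewrite lee_fin; lra.
  by move=> t /bnd; rewrite lee_fin => /andP[/ltW].
apply: (@le_lt_trans _ _ ((2 * c)%:E * lebesgue_tuple k D)%E).
  rewrite -(integral_cst _ mD).
  apply: ge0_le_integral; [exact: mD|exact: f_ge0|exact: mf|exact: cst_mfun|].
  by move=> t /bnd; rewrite lee_fin => /andP[_ /ltW].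
by rewrite lte_mul_pinfty// lee_fin; lra.
Qed.

End local_volume.

(** * Compact submanifolds: finite volume and invariance under isometries *)

Section compact_submanifold.
Context {R : realType}.
Variables (p q k : nat) (M : set 'M[R]_(p, q)).

Lemma linear_mx_continuous (T : {linear 'M[R]_(p, q) -> 'M[R]_(p, q)}) :
  continuous T.
Proof.
apply: continuous_mx => i j.
have -> : (fun x => T x i j) =
    (fun x => \sum_a \sum_b x a b * T (delta_mx a b) i j).
  apply/funext => x; rewrite {1}[x]matrix_sum_delta linear_sum summxE.
  apply: eq_bigr => a _; rewrite linear_sum summxE; apply: eq_bigr => b _.
  by rewrite linearZ mxE.
apply: continuous_big => [|a _]; first exact: add_continuous.
apply: continuous_big => [|b _]; first exact: add_continuous.
move=> x; apply: (@cvgM _ _ (nbhs x) _ (fun y : 'M[R]_(p, q) => y a b)).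
  exact: (@coord_continuous _ _ _ a b x).
exact: cvg_cst.
Qed.

(** A local-to-global principle: a finite subcover cuts [B] into disjoint measurable pieces, each
    inside one of the neighbourhoods on which [K] is known. It serves for finiteness of the volume
    and for its invariance. *)
Lemma compact_measurable_ind (K : set (borel_mx R p q) -> Prop) :
  compact M -> K set0 ->
  (forall A B : set (borel_mx R p q), measurable A -> measurable B ->
    A `&` B = set0 ->
    K A -> K B -> K (A `|` B)) ->
  (forall x, M x -> exists W : set 'M[R]_(p, q), [/\ open W, W x &
    forall B : set (borel_mx R p q), measurable B -> B `<=` M `&` W -> K B]) ->
  forall B : set (borel_mx R p q), measurable B -> B `<=` M -> K B.
Proof.
rewrite compact_cover => cM K0 KU Kloc B mB BM.
pose W x : set 'M[R]_(p, q) :=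
  if pselect (M x) is left Mx then sval (cid (Kloc x Mx)) else set0.
have WP x : M x -> [/\ open (W x), W x x &
    forall B : set (borel_mx R p q), measurable B -> B `<=` M `&` W x -> K B].
  by move=> Mx; rewrite /W; case: pselect => // Mx'; exact: (svalP (cid (Kloc x Mx'))).
have [|x Mx|s sM Ms] := cM _ M W.
- by move=> x /WP[].
- by exists x => //; have [] := WP x Mx.
have {Ms} : B `<=` \bigcup_(x in [set` finmap.enum_fset s]) W x by apply: subset_trans BM _.
have {sM} : {subset finmap.enum_fset s <= M} by [].
elim: (finmap.enum_fset s) B mB BM => [|x r IH] B mB BM rM Br.
  suff -> : B = set0 by [].
  by rewrite -subset0 => y /Br[].
have Mx : M x by apply/set_mem/rM; rewrite mem_head.
have [oW Wx KW] := WP x Mx.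
have mW := measurable_open_mx oW.
(* The part of [B] inside [W x] is handled by the local hypothesis; the remainder is covered by one
   open set fewer. *)
rewrite -(setUIDK B (W x)); apply: KU.
- exact: measurableI.
- exact: measurableD.
- by rewrite setDE setIACA setICr setI0.
- apply: KW; first exact: measurableI.
  by move=> y [/BM].
- apply: IH; first exact: measurableD.
  + by move=> y [/BM].
  + by move=> y yr; apply: rM; rewrite inE yr orbT.
  + move=> y [/Br[z /=]]; rewrite inE => /orP[/eqP ->//|zr Wy _].
    by exists z.
Qed.

Variable mu : {measure set (borel_mx R p q) -> \bar R}.
Hypotheses (cM : compact M) (muM : riemannian_volume k M mu).
Hypothesis atlas : forall x, M x ->
  exists U (phi : 'rV[R]_k -> _), local_parametrization M U phi /\ (phi @` U) x.

Let clM : closed M.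
Proof. by apply: compact_closed => //; exact: norm_hausdorff. Qed.

Let mM : measurable (M : set (borel_mx R p q)).
Proof. exact: measurable_closed_mx. Qed.

Lemma riemannian_volume_fin : (mu setT < +oo)%E.
Proof.
rewrite -(setvU M) measureU//; [|exact: measurableC|by rewrite setICl].
apply: lte_add_pinfty; first by have [E0 _] := muM; rewrite -[X in (X < _)%E]/(mu (~` M)) E0.
apply: (@compact_measurable_ind (fun B : set (borel_mx R p q) => (mu B < +oo)%E)) => //.
- by rewrite measure0.
- move=> A B mA mB AB Aoo Boo.
  by rewrite measureU ?lte_add_pinfty.
move=> x /atlas[U [phi [chart [y Uy <-]]]].
have [W [oW Wy /andP[_ Woo]]] := riemannian_volume_nbhs clM muM chart Uy.
exists W; split => // B mB BMW; apply: le_lt_trans Woo.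
apply: le_measure; rewrite ?inE//.
by apply: measurableI => //; exact: measurable_open_mx.
Qed.

Lemma riemannian_volume_gt0 : M !=set0 -> (0 < mu setT)%E.
Proof.
move=> [x /atlas[U [phi [chart [y Uy _]]]]].
have [W [oW Wy /andP[W0 _]]] := riemannian_volume_nbhs clM muM chart Uy.
apply: lt_le_trans W0 _; apply: le_measure; rewrite ?inE//.
by apply: measurableI => //; exact: measurable_open_mx.
Qed.

Variables T T' : {linear 'M[R]_(p, q) -> 'M[R]_(p, q)}.
Hypotheses (TK : cancel T T') (T'K : cancel T' T).
Hypothesis T'iso : forall A B, eucl_dot (T' A) (T' B) = eucl_dot A B.
Hypotheses (MT : forall x, M x -> M (T x)) (MT' : forall x, M x -> M (T' x)).

Lemma diff_linear_comp (phi : 'rV[R]_k -> 'M[R]_(p, q)) y v :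
  differentiable phi y -> 'd (T' \o phi) y v = T' ('d phi y v).
Proof.
have cT' := @linear_mx_continuous T'.
move=> dphi; have dT' := linear_differentiable (phi y) cT'.
apply: (etrans (congr1 (fun f => f v) (diff_comp dphi dT'))).
exact: (congr1 (fun f => f ('d phi y v)) (diff_lin (phi y) cT')).
Qed.

Lemma partial_linear (phi : 'rV[R]_k -> 'M[R]_(p, q)) i y :
  differentiable phi y -> partial (T' \o phi) i y = T' (partial phi i y).
Proof.
move=> dphi; rewrite /partial.
have cT' := @linear_mx_continuous T'.
have dT' := linear_differentiable (phi y) cT'.
have dT'phi := differentiable_comp dphi dT'.
have -> := deriveE (delta_mx 0 i) dT'phi.
by have -> := deriveE (delta_mx 0 i) dphi; exact: diff_linear_comp.
Qed.

(** [T'] commutes with differentiation and maps [M] to itself, so each clause for [phi] passes to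
    the composite; the relatively open image is now cut out by the preimage under [T] of the old
    open set. *)
Lemma local_parametrization_isometry (U : set 'rV[R]_k)
    (phi : 'rV[R]_k -> 'M[R]_(p, q)) :
  local_parametrization M U phi -> local_parametrization M U (T' \o phi).
Proof.
move=> [oU dU iU injU hU].
have dT' x : differentiable T' x.
  by apply: linear_differentiable; exact: linear_mx_continuous.
split; first exact: oU.
- move=> x Ux; have [dphi cphi] := dU x Ux; split.
    exact: (differentiable_comp dphi (dT' _)).
  move=> i; suff : partial (T' \o phi) i y @[y --> x] --> T' (partial phi i x).
    by rewrite -(partial_linear i dphi).
  apply: cvg_trans; last first.
    apply: (@cvg_comp _ _ _ (partial phi i) T' _ _ _ (cphi i)).
    exact: linear_mx_continuous.
  apply: (@near_eq_cvg _ _ (nbhs x)).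
  apply: filterS (open_nbhs_nbhs (conj oU Ux)) => y Uy.
  exact: esym (partial_linear i (proj1 (dU y Uy))).
- move=> x Ux v; have [dphi cphi] := dU x Ux.
  rewrite (diff_linear_comp v dphi) => /(congr1 T); rewrite T'K linear0; exact: iU.
- move=> x y xU yU /= /(can_inj T'K); exact: injU.
- move=> V oV VU; have [W oW WV] := hU V oV VU.
  exists (T @^-1` W).
    by apply: open_comp => // x _; exact: linear_mx_continuous.
  apply/seteqP; split => [_ [x Vx <-]|z [Mz Wz]].
    have : (M `&` W) (phi x) by rewrite -WV; exists x.
    by move=> [Mx Wx]; split; [exact: MT'|rewrite /= T'K].
  have : (M `&` W) (T z) by split => //; exact: MT.
  by rewrite -WV => -[x Vx xz]; exists x => //=; rewrite xz TK.
Qed.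

Lemma riemannian_volume_isometry (B : set (borel_mx R p q)) :
  measurable B -> mu (T @^-1` B) = mu B.
Proof.
have mT : measurable_fun setT (T : borel_mx R p q -> borel_mx R p q).
  by apply: continuous_measurable_mx; exact: linear_mx_continuous.
have mpre (A : set (borel_mx R p q)) : measurable A -> measurable (T @^-1` A : set (borel_mx R p q)).
  by move=> mA; rewrite -[X in measurable X]setTI; exact: mT.
have MTi x : M (T x) -> M x by move=> /MT'; rewrite TK.
suff KM : forall B : set (borel_mx R p q), measurable B -> B `<=` M -> mu (T @^-1` B) = mu B.
  (* Charts only see subsets of [M], so [B] is first cut down to [M], whose complement is null. *)
  move=> mB; have split_mu (A : set (borel_mx R p q)) : measurable A -> mu A = mu (A `&` M).
    move=> mA; have mAD := measurableD mA mM.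
    have AM0 : mu (A `\` M) = 0%E.
      apply: (@subset_measure0 _ _ _ mu _ (~` M)) => //.
      - exact: measurableC.
      - exact: (proj1 muM).
    rewrite -{1}(setUIDK A M) measureU//; [|exact: measurableI|].
      by rewrite -[RHS]adde0; congr (_ + _)%E.
    by rewrite setDE setIACA setICr setI0.
  rewrite (split_mu _ (mpre _ mB)) (split_mu _ mB) -(KM _ (measurableI _ _ mB mM)).
    rewrite preimage_setI; congr (mu (_ `&` _)).
    by apply/seteqP; split => x; [exact: MT|exact: MTi].
  by move=> x [].
apply: (@compact_measurable_ind (fun B : set (borel_mx R p q) => mu (T @^-1` B) = mu B)) => //.
- move=> A A' mA mA' AA' hA hA'.
  have TAA' : T @^-1` A `&` T @^-1` A' = set0 by rewrite -preimage_setI AA' preimage_set0.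
  rewrite preimage_setU.
  have -> := measureU mu (mpre _ mA) (mpre _ mA') TAA'.
  have -> := measureU mu mA mA' AA'.
  by congr (_ + _)%E.
move=> x /atlas[U [phi [chart [y Uy <-]]]].
have [oU dU iU injU hU] := chart.
have [W oW WU] := hU U oU (@subset_refl _ _).
have Wy : (M `&` W) (phi y) by rewrite -WU; exists y.
exists W; split => //; first by case: Wy.
move=> A mA AMW.
have [_ muE] := muM.
have AU : A `<=` phi @` U by rewrite WU.
have TAU : T @^-1` A `<=` (T' \o phi) @` U.
  move=> z /AMW; rewrite -WU => -[x' Ux' x'z]; exists x' => //=.
  by rewrite x'z TK.
rewrite (muE _ _ chart _ mA AU).
rewrite (muE _ _ (local_parametrization_isometry chart) _ (mpre _ mA) TAU).
have -> : [set t : k.-tuple (measurableTypeR R) | U (row_of_tuple t) /\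
      (T @^-1` A) ((T' \o phi) (row_of_tuple t))] =
    [set t | U (row_of_tuple t) /\ A (phi (row_of_tuple t))].
  by apply/seteqP; split => t /=; rewrite T'K.
apply: eq_integral => t; rewrite inE => -[/dU[dphi _] _].
suff -> : gram (T' \o phi) (row_of_tuple t) = gram phi (row_of_tuple t) by [].
by apply/matrixP => i j; rewrite !mxE !(partial_linear _ dphi) T'iso.
Qed.

End compact_submanifold.

(** * Continuously differentiable charts *)

Section continuously_differentiable.
Context {R : realType} {k : nat}.
Implicit Types f g : 'rV[R]_k -> R.

(** The domain is all of R^k because the charts below are defined everywhere. The notion is kept
    scalar, to be applied to each matrix entry of a chart. *)
Definition C1 f : Prop :=
  (forall x, differentiable f x) /\ forall v, continuous (fun x => 'D_v f x).

Lemma continuous_mul f g : continuous f -> continuous g ->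
  continuous (fun x => f x * g x).
Proof. by move=> cf cg x; exact: (continuousM (cf x) (cg x)). Qed.

Lemma C1_continuous f : C1 f -> continuous f.
Proof. by move=> [df _] x; exact: differentiable_continuous (df x). Qed.

Lemma C1_cst (c : R) : C1 (fun=> c).
Proof.
split=> [x|v]; first exact: differentiable_cst.
have -> : (fun x => 'D_v (fun=> c) x) = (fun _ : 'rV[R]_k => 0).
  by apply/funext => x; exact: derive_cst.
exact: cst_continuous.
Qed.

Lemma C1_coord (i : 'I_k) : C1 (fun x => x 0 i).
Proof.
split=> [x|v]; first exact: differentiable_coord.
have -> : (fun x => 'D_v (fun x : 'rV[R]_k => x 0 i) x) = (fun _ => v 0 i).
  apply/funext => x; have /derive_mx : derivable (@id 'rV[R]_k) x v by exact: derivable_id.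
  by move=> /(congr1 (fun A : 'rV[R]_k => A 0 i)); rewrite mxE derive_id => ->.
exact: cst_continuous.
Qed.

Lemma C1D f g : C1 f -> C1 g -> C1 (fun x => f x + g x).
Proof.
move=> [df cf] [dg cg]; split=> [x|v]; first exact: (differentiableD (df x) (dg x)).
have -> : (fun x => 'D_v (fun y => f y + g y) x) = (fun x => 'D_v f x + 'D_v g x).
  apply/funext => x.
  exact: (deriveD (diff_derivable (df x)) (diff_derivable (dg x))).
by move=> x; exact: (cvgD (cf v x) (cg v x)).
Qed.

Lemma C1M f g : C1 f -> C1 g -> C1 (fun x => f x * g x).
Proof.
move=> [df cf] [dg cg]; split=> [x|v]; first exact: (differentiableM (df x) (dg x)).
have -> : (fun x => 'D_v (fun y => f y * g y) x) =
    (fun x => f x * 'D_v g x + g x * 'D_v f x).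
  apply/funext => x.
  exact: (deriveM (diff_derivable (df x)) (diff_derivable (dg x))).
have fc := C1_continuous (conj df cf); have gc := C1_continuous (conj dg cg).
have h1 := continuous_mul fc (cg v); have h2 := continuous_mul gc (cf v).
by move=> x; exact: (cvgD (h1 x) (h2 x)).
Qed.

Lemma C1V f : (forall x, f x != 0) -> C1 f -> C1 (fun x => (f x)^-1).
Proof.
move=> f0 [df cf]; split=> [x|v]; first exact: (differentiableV (df x) (f0 x)).
have -> : (fun x => 'D_v (fun y => (f y)^-1) x) =
    (fun x => - (f x)^-1 * (f x)^-1 * 'D_v f x).
  apply/funext => x; have E := deriveV (f0 x) (diff_derivable (df x)).
  by apply: (etrans (E v)); rewrite -exprVn expr2 mulNr.
have fV : continuous (fun x => (f x)^-1).
  by move=> x; exact: (cvgV (f0 x) (differentiable_continuous (df x))).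
apply: continuous_mul; last exact: cf.
apply: continuous_mul => //.
by move=> x; exact: (cvgN (fV x)).
Qed.

Lemma C1_sqrt f : (forall x, 0 < f x) -> C1 f -> C1 (fun x => Num.sqrt (f x)).
Proof.
move=> f0 [df cf].
have ds x : differentiable (@Num.sqrt R) (f x).
  by apply/derivable1_diffP; have [] := is_derive1_sqrt (f0 x).
have dsf x := differentiable_comp (df x) (ds x).
split=> [x|v]; first exact: dsf.
have -> : (fun x => 'D_v (fun y => Num.sqrt (f y)) x) =
    (fun x => 'D_v f x * (2 * Num.sqrt (f x))^-1).
  apply/funext => x; have E := deriveE v (dsf x).
  apply: (etrans E); apply: (etrans (congr1 (fun h => h v) (diff_comp (df x) (ds x)))).
  have dsx : derivable (@Num.sqrt R) (f x) 1 by exact/derivable1_diffP.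
  apply: (etrans (congr1 (fun h => h ('d f x v)) (deriv1E dsx))).
  rewrite (deriveE v (df x)); congr (_ * _).
  by rewrite derive1E; have [_ ->] := is_derive1_sqrt (f0 x).
apply: continuous_mul; first exact: cf.
have h0 x : 2 * Num.sqrt (f x) != 0 by rewrite mulf_neq0// gt_eqF// sqrtr_gt0.
have hc : continuous (fun x => 2 * Num.sqrt (f x)).
  apply: (@continuous_mul (fun=> 2)); first exact: cst_continuous.
  move=> y; apply: (@cvg_comp _ _ _ f (@Num.sqrt R)); last exact: sqrt_continuous.
  exact: (differentiable_continuous (df y)).
by move=> x; exact: (cvgV (h0 x) (hc x)).
Qed.

Lemma C1_sum (I : Type) (r : seq I) (P : pred I) (F : I -> 'rV[R]_k -> R) :
  (forall i, P i -> C1 (F i)) -> C1 (fun x => \sum_(i <- r | P i) F i x).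
Proof.
move=> C1F; elim: r => [|i r IH].
  by under eq_fun do rewrite big_nil; exact: C1_cst.
under eq_fun do rewrite big_cons.
by case Pi : (P i); [exact: (C1D (C1F i Pi) IH)|exact: IH].
Qed.

End continuously_differentiable.

Lemma cvg_mx (R : realType) (T : Type) (F : set_system T) p q
    (f : T -> 'M[R]_(p, q)) (A : 'M[R]_(p, q)) : Filter F ->
  (forall i j, f x i j @[x --> F] --> A i j) -> f @ F --> A.
Proof.
move=> FF fA V [P Pn PV].
have Pi i := filter_forall FF (fun j => fA i j _ (Pn i j)).
by apply: filterS (filter_forall FF Pi) => y yP; exact: PV.
Qed.

(** * Charts whose inverse is a quotient of coordinates *)

Section charts.
Context {R : realType} {p q k : nat}.
Variables (M D : set 'M[R]_(p, q)) (phi : 'rV[R]_k -> 'M[R]_(p, q)).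
Variables (num den : 'I_k -> 'I_p * 'I_q) (sg : 'I_k -> R).
Hypothesis oD : open D.
Hypothesis phi_C1 : forall a b, C1 (fun x => phi x a b).
Hypothesis phi_MD : forall x, (M `&` D) (phi x).
Hypothesis D_den : forall e i, D e -> 0 < sg i * e (den i).1 (den i).2.
Hypothesis phi_coord : forall (x : 'rV[R]_k) i,
  x 0 i * (sg i * phi x (den i).1 (den i).2) = phi x (num i).1 (num i).2.
Hypothesis phi_onto : forall e : 'M[R]_(p, q), (M `&` D) e ->
  phi (\row_i (e (num i).1 (num i).2 / (sg i * e (den i).1 (den i).2))) = e.

Let ratio (e : 'M[R]_(p, q)) : 'rV[R]_k :=
  \row_i (e (num i).1 (num i).2 / (sg i * e (den i).1 (den i).2)).

Let phiK x : ratio (phi x) = x.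
Proof.
apply/rowP => i; rewrite mxE -phi_coord mulfK// gt_eqF// D_den//.
by have [] := phi_MD x.
Qed.

Lemma C1_mx_differentiable x : differentiable phi x.
Proof.
have -> : phi = \sum_a \sum_b (fun x => phi x a b *: delta_mx a b).
  apply/funext => y; rewrite fct_sumE [LHS]matrix_sum_delta.
  by apply: eq_bigr => a _; rewrite fct_sumE.
apply: differentiable_sum => a; apply: differentiable_sum => b.
exact: (differentiableZl _ (proj1 (phi_C1 a b) x)).
Qed.

Lemma partial_mxE i x a b :
  partial phi i x a b = 'D_(delta_mx 0 i) (fun y => phi y a b) x.
Proof.
rewrite /partial.
have /derive_mx -> := diff_derivable (v := delta_mx 0 i) (C1_mx_differentiable x).
by rewrite mxE.
Qed.

(** The inverse of [phi] is [ratio], continuous on the open set [D] where the denominators are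
    positive. This gives injectivity, and it shows that the image of an open [V] is the trace on [M]
    of [D] intersected with the preimage of [V] under [ratio]. *)
Lemma ratio_local_parametrization U : open U -> local_parametrization M U phi.
Proof.
move=> oU; split; first exact: oU.
- move=> x _; split; first exact: C1_mx_differentiable.
  move=> i; apply: (@cvg_mx _ _ (nbhs x) _ _ (partial phi i)) => a b.
  have -> : (fun y => partial phi i y a b) =
      (fun y => 'D_(delta_mx 0 i) (fun y => phi y a b) y).
    by apply/funext => y; exact: partial_mxE.
  have h := proj2 (phi_C1 a b) (delta_mx 0 i).
  by rewrite partial_mxE; exact: (h x).
- move=> x _ v dphi0; apply/rowP => i; rewrite [RHS]mxE.
  have dphi := C1_mx_differentiable x.
  have Dphi a b : 'D_v (fun y => phi y a b) x = 0.
    have /derive_mx/(congr1 (fun A : 'M[R]_(p, q) => A a b)) := diff_derivable (v := v) dphi.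
    rewrite [RHS]mxE => <-; rewrite (deriveE v dphi).
    by rewrite dphi0 mxE.
  have C1g := C1M (C1_cst (sg i)) (phi_C1 (den i).1 (den i).2).
  have dg : derivable (fun y => sg i * phi y (den i).1 (den i).2) x v.
    exact: diff_derivable (proj1 C1g x).
  have dcoord : derivable (fun y : 'rV[R]_k => y 0 i) x v.
    exact: diff_derivable (differentiable_coord _ _ _).
  have ddencoord : derivable (fun y => phi y (den i).1 (den i).2) x v.
    exact: diff_derivable (proj1 (phi_C1 _ _) x).
  have Dcoord : 'D_v (fun y : 'rV[R]_k => y 0 i) x = v 0 i.
    have /derive_mx/(congr1 (fun A : 'rV[R]_k => A 0 i)) : derivable (@id 'rV[R]_k) x v.
      exact: derivable_id.
    by rewrite mxE derive_id => ->.
  have Dg : 'D_v (fun y => sg i * phi y (den i).1 (den i).2) x = 0.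
    apply: (etrans (deriveM (derivable_cst (sg i) x v) ddencoord)).
    by rewrite Dphi derive_cst !scaler0 addr0.
  (* Immersion: the derivative of [phi_coord] along a [v] killed by the differential loses all terms
     except [v 0 i] times a positive denominator, so [v 0 i = 0]. *)
  have := deriveM dcoord dg.
  have -> : (fun y : 'rV[R]_k => y 0 i) *
      (fun y => sg i * phi y (den i).1 (den i).2) =
      (fun y => phi y (num i).1 (num i).2).
    by apply/funext => y; exact: phi_coord.
  rewrite Dphi Dg Dcoord scaler0 add0r => /esym/eqP.
  rewrite scaler_eq0 => /orP[|/eqP//].
  by rewrite gt_eqF// D_den//; have [] := phi_MD x.
- by move=> x y _ _ /(congr1 ratio); rewrite !phiK.
move=> V oV VU; exists (D `&` ratio @^-1` V).
  rewrite openE => e [De Ve]; apply: filterI; first exact: (open_nbhs_nbhs (conj oD De)).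
  suff cr : ratio e' @[e' --> e] --> ratio e by exact: (cr _ (open_nbhs_nbhs (conj oV Ve))).
  have FF : Filter (nbhs e) by exact: nbhs_filter.
  apply: (@cvg_mx _ _ (nbhs e) _ _ ratio) => a i.
  have -> : ratio e a i = e (num i).1 (num i).2 / (sg i * e (den i).1 (den i).2).
    by rewrite mxE.
  have -> : (fun e' => ratio e' a i) =
      (fun e' : 'M[R]_(p, q) => e' (num i).1 (num i).2 / (sg i * e' (den i).1 (den i).2)).
    by apply/funext => e'; rewrite mxE.
  have coord u v : e' u v @[e' --> e] --> e u v by exact: coord_continuous.
  apply: cvgM; first exact: coord.
  apply: cvgV; first by rewrite gt_eqF// D_den.
  by apply: cvgM; [exact: cvg_cst|exact: coord].
apply/seteqP; split => [_ [x Vx <-]|e [Me [De Ve]]].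
  by have [Mx Dx] := phi_MD x; split => //; split => //; rewrite /preimage /= phiK.
exists (ratio e) => //; exact: phi_onto.
Qed.

End charts.

(** * The model spaces in coordinates *)

Section coordinates.
Context {R : realType} {n : nat}.
Implicit Types q : 'M[R]_(n, 4).

Lemma sum_ord4 (V : nmodType) (F : 'I_4 -> V) :
  \sum_c F c = F (inord 0) + F (inord 1) + F (inord 2) + F (inord 3).
Proof.
rewrite !big_ord_recl big_ord0 addr0 !addrA.
by do !congr (_ + _); congr F; apply/val_inj; rewrite /= inordK.
Qed.

Lemma forall_ord4 (P : 'I_4 -> Prop) :
  P (inord 0) -> P (inord 1) -> P (inord 2) -> P (inord 3) -> forall c, P c.
Proof.
move=> P0 P1 P2 P3 c; have -> : c = inord c by rewrite inord_val.
by case: c => [[|[|[|[|]]]]].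
Qed.

(** The Gram matrix of the columns, a complete invariant of the orthogonal group O(n) that mixes the
    rows. *)
Definition col_dot q (c d : 'I_4) : R := \sum_m q m c * q m d.

Definition planar q : Prop :=
  (forall m, q m (inord 1) = 0 /\ q m (inord 3) = 0) \/
  (forall m, q m (inord 0) = 0 /\ q m (inord 2) = 0).

(** Real form of the Hermitian relations for a = q_0 + i q_1 and b = q_2 + i q_3: the last two
    clauses are the real and the imaginary part of <a, b> = 0. *)
Definition stiefel q : Prop :=
  [/\ col_dot q (inord 0) (inord 0) + col_dot q (inord 1) (inord 1) = 1,
      col_dot q (inord 2) (inord 2) + col_dot q (inord 3) (inord 3) = 1,
      col_dot q (inord 0) (inord 2) + col_dot q (inord 1) (inord 3) = 0
    & col_dot q (inord 1) (inord 2) = col_dot q (inord 0) (inord 3)].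

Lemma eucl_dot_col q : eucl_dot q q =
  col_dot q (inord 0) (inord 0) + col_dot q (inord 1) (inord 1) +
  col_dot q (inord 2) (inord 2) + col_dot q (inord 3) (inord 3).
Proof. by rewrite /eucl_dot exchange_big /= sum_ord4. Qed.

Lemma stiefel_eucl_dot q : stiefel q -> eucl_dot q q = 2.
Proof. by move=> [q1 q2 _ _]; rewrite eucl_dot_col q1 -addrA q2. Qed.

Lemma sphereE q : sphere q <-> eucl_dot q q = 2.
Proof.
rewrite /sphere /eucl_norm /=; split=> [|-> //].
move=> /(congr1 (fun x => x ^+ 2)).
by rewrite !sqr_sqrtr// eucl_dot_ge0.
Qed.

Lemma model_Arm3E q : model_Arm3 q <-> eucl_dot q q = 2.
Proof. exact: sphereE. Qed.

Lemma plane_1jE q : plane_1j q <-> forall m, q m (inord 1) = 0 /\ q m (inord 3) = 0.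
Proof. by split=> h m; have := h m; rewrite /qcoord !mxE. Qed.

Lemma plane_ikE q : plane_ik q <-> forall m, q m (inord 0) = 0 /\ q m (inord 2) = 0.
Proof. by split=> h m; have := h m; rewrite /qcoord !mxE. Qed.

Lemma model_Arm2E q : model_Arm2 q <-> eucl_dot q q = 2 /\ planar q.
Proof.
split.
  by move=> [[/sphereE ? /plane_1jE ?]|[/sphereE ? /plane_ikE ?]]; split=> //;
    [left|right].
by move=> [/sphereE ? [/plane_1jE|/plane_ikE] ?]; [left|right].
Qed.

Lemma quat_of_pairE (a b : 'rV[R[i]]_n) m c : quat_of_pair a b m c =
  nth 0 [:: complex.Re (a 0 m); complex.Im (a 0 m); complex.Re (b 0 m);
            complex.Im (b 0 m)] c.
Proof.
rewrite !mxE /qmul /qj /quat_of_complex !qcoord_quat//=.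
rewrite !(mulr0, mul0r, mulr1, subr0, addr0, add0r, oppr0, subrr).
by case: c => [[|[|[|[|]]]]] //= _; rewrite ?addr0 ?add0r.
Qed.

Lemma herm_dotE (a b : 'rV[R[i]]_n) : herm_dot a b =
  Complex (\sum_m (complex.Re (a 0 m) * complex.Re (b 0 m) +
                   complex.Im (a 0 m) * complex.Im (b 0 m)))
          (\sum_m (complex.Im (a 0 m) * complex.Re (b 0 m) -
                   complex.Re (a 0 m) * complex.Im (b 0 m))).
Proof.
rewrite /herm_dot.
elim/big_ind3: _ => // [x x' x'' y y' y'' -> ->//|m _].
case: (a 0 m) (b 0 m) => [a0 a1] [b0 b1] /=.
by congr Complex; ring.
Qed.

Lemma model_Pol3E q : model_Pol3 q <-> stiefel q.
Proof.
have HD (f g : 'I_n -> R) : \sum_m (f m + g m) = \sum_m f m + \sum_m g m.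
  by rewrite big_split.
have HB (f g : 'I_n -> R) : \sum_m (f m - g m) = \sum_m f m - \sum_m g m.
  by rewrite big_split /= sumrN.
split.
  move=> [[a b] [/=]]; rewrite !herm_dotE !HD !sumrN => -[a1 _] [b1 _] [ab1 ab2] <-.
  have E (c d : 'I_4) : col_dot (quat_of_pair a b) c d = \sum_m
      nth 0 [:: complex.Re (a 0 m); complex.Im (a 0 m); complex.Re (b 0 m);
            complex.Im (b 0 m)] c *
      nth 0 [:: complex.Re (a 0 m); complex.Im (a 0 m); complex.Re (b 0 m);
            complex.Im (b 0 m)] d.
    by apply: eq_bigr => m _; rewrite !quat_of_pairE.
  split; rewrite !E !inordK//=.
  by apply/eqP; rewrite -subr_eq0 ab2.
move=> [q1 q2 q3 q4].
exists (\row_m Complex (q m (inord 0)) (q m (inord 1)),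
        \row_m Complex (q m (inord 2)) (q m (inord 3))); last first.
  apply/matrixP => m c; rewrite quat_of_pairE !mxE /=.
  by elim/forall_ord4: c; rewrite inordK.
split => /=; rewrite herm_dotE /=.
- congr Complex.
    by rewrite -q1 HD; congr (_ + _); apply: eq_bigr => m _; rewrite mxE.
  by rewrite big1// => m _; rewrite mxE /= mulrC subrr.
- congr Complex.
    by rewrite -q2 HD; congr (_ + _); apply: eq_bigr => m _; rewrite mxE.
  by rewrite big1// => m _; rewrite mxE /= mulrC subrr.
- congr Complex.
    by rewrite -[RHS]q3 HD; congr (_ + _); apply: eq_bigr => m _; rewrite !mxE.
  rewrite HB; apply/eqP; rewrite subr_eq0; apply/eqP.
  apply: etrans (etrans q4 _); apply: eq_bigr => m _; rewrite !mxE//.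
Qed.

Lemma model_Pol2E q : model_Pol2 q <-> stiefel q /\ planar q.
Proof.
split.
  move=> [[[a b] [/= a1 b1 ab] <-]|[[a b] [/= a1 b1 ab] <-]].
    split.
      have E (c d : 'I_4) : col_dot (quat_of_pair (complexify a) (complexify b)) c d =
          \sum_m nth 0 [:: a 0 m; 0; b 0 m; 0] c * nth 0 [:: a 0 m; 0; b 0 m; 0] d.
        by apply: eq_bigr => m _; rewrite !quat_of_pairE !mxE /=.
      rewrite /eucl_dot !big_ord1 in a1 b1 ab.
      have Z (f : 'I_n -> R) : (forall m, f m = 0) -> \sum_m f m = 0.
        by move=> f0; rewrite big1.
      by split; rewrite !E !inordK//= ?(Z (fun m => _ * 0)) ?(Z (fun m => 0 * _));
        rewrite ?addr0// => m; rewrite ?mulr0 ?mul0r.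
    by left=> m; rewrite !quat_of_pairE !inordK// !mxE.
  split.
    have E (c d : 'I_4) : col_dot (quat_of_pair ('i%C *: complexify a) ('i%C *: complexify b)) c d =
        \sum_m nth 0 [:: 0; a 0 m; 0; b 0 m] c * nth 0 [:: 0; a 0 m; 0; b 0 m] d.
      apply: eq_bigr => m _; rewrite !quat_of_pairE !mxE /=.
      by rewrite !(mulr0, mul0r, mul1r, subr0, addr0, add0r, oppr0, subrr).
    rewrite /eucl_dot !big_ord1 in a1 b1 ab.
    have Z (f : 'I_n -> R) : (forall m, f m = 0) -> \sum_m f m = 0.
      by move=> f0; rewrite big1.
    by split; rewrite !E !inordK//= ?(Z (fun m => _ * 0)) ?(Z (fun m => 0 * _));
      rewrite ?add0r// => m; rewrite ?mulr0 ?mul0r.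
  right=> m; rewrite !quat_of_pairE !inordK// !mxE /=.
  by rewrite !(mulr0, mul0r, mul1r, subr0, addr0, add0r, oppr0, subrr).
move=> [[q1 q2 q3 q4] [pl|pl]].
  have Z c d : (c == inord 1) || (c == inord 3) || (d == inord 1) || (d == inord 3) -> col_dot q c d = 0.
    move=> cd; rewrite /col_dot big1// => m _; have [p1 p3] := pl m.
    by case/orP: cd => [/orP[/orP[]|]|] /eqP ->; rewrite ?p1 ?p3 ?mulr0 ?mul0r.
  left; exists (\row_m q m (inord 0), \row_m q m (inord 2)) => /=.
    split=> /=; rewrite /eucl_dot big_ord1.
    - rewrite -[RHS]q1 [X in _ + X]Z ?eqxx ?orbT// addr0.
      by apply: eq_bigr => m _; rewrite !mxE.
    - rewrite -[RHS]q2 [X in _ + X]Z ?eqxx ?orbT// addr0.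
      by apply: eq_bigr => m _; rewrite !mxE.
    - rewrite -[RHS]q3 [X in _ + X]Z ?eqxx ?orbT// addr0.
      by apply: eq_bigr => m _; rewrite !mxE.
  apply/matrixP => m c; rewrite quat_of_pairE !mxE /=; have [p1 p3] := pl m.
  by elim/forall_ord4: c; rewrite inordK.
have Z c d : (c == inord 0) || (c == inord 2) || (d == inord 0) || (d == inord 2) -> col_dot q c d = 0.
  move=> cd; rewrite /col_dot big1// => m _; have [p1 p3] := pl m.
  by case/orP: cd => [/orP[/orP[]|]|] /eqP ->; rewrite ?p1 ?p3 ?mulr0 ?mul0r.
right; exists (\row_m q m (inord 1), \row_m q m (inord 3)) => /=.
  split=> /=; rewrite /eucl_dot big_ord1.
  - rewrite -[RHS]q1 [X in X + _]Z ?eqxx ?orbT// add0r.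
    by apply: eq_bigr => m _; rewrite !mxE.
  - rewrite -[RHS]q2 [X in X + _]Z ?eqxx ?orbT// add0r.
    by apply: eq_bigr => m _; rewrite !mxE.
  - rewrite -[RHS]q3 [X in X + _]Z ?eqxx ?orbT// add0r.
    by apply: eq_bigr => m _; rewrite !mxE.
apply/matrixP => m c; rewrite quat_of_pairE !mxE /=; have [p1 p3] := pl m.
rewrite !(mulr0, mul0r, mul1r, subr0, addr0, add0r, oppr0, subrr).
by elim/forall_ord4: c; rewrite inordK.
Qed.

End coordinates.

(** * Compactness of closed subsets of the sphere *)

Section compactness.
Context {R : realType}.

(** Heine-Borel for row vectors, transported to matrices by the continuous bijection [vec_mx]. *)
Lemma closed_bounded_compact_mx p q (A : 'M[R]_(p, q) -> Prop) (c : R) :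
  closed (A : set 'M[R]_(p, q)) -> (forall e, A e -> forall i j, `|e i j| <= c) ->
  compact (A : set 'M[R]_(p, q)).
Proof.
move=> cA bA.
have vec_cont : continuous (@vec_mx R p q).
  apply: continuous_mx => i j.
  have -> : (fun x => vec_mx x i j) = (fun x : 'rV[R]_(p * q) => x 0 (mxvec_index i j)).
    by apply/funext => x; rewrite mxE.
  exact: coord_continuous.
have -> : A = @vec_mx R p q @` (@vec_mx R p q @^-1` A).
  apply/seteqP; split => [e Ae|_ [x Ax <-]//].
  by exists (mxvec e) => //=; rewrite ?mxvecK.
apply: continuous_compact; first exact: continuous_subspaceT.
apply: bounded_closed_compact; last first.
  by apply: closed_comp => // x _; exact: vec_cont.
exists (Num.max c 0); split; first exact: num_real.
move=> x xc e Ae; rewrite /Num.norm /= mx_normrE.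
apply: bigmax_le => [|[i j] _].
  by rewrite (le_trans _ (ltW xc))// le_max lexx orbT.
rewrite (le_trans _ (ltW xc))// le_max; apply/orP; left.
rewrite /= (ord1 i); case/mxvec_indexP: j => a b.
by have := bA _ Ae a b; rewrite mxE.
Qed.

Lemma eucl_dot_coord_le p q (e : 'M[R]_(p, q)) i j : e i j ^+ 2 <= eucl_dot e e.
Proof.
rewrite /eucl_dot (bigD1 i)//= (bigD1 j)//= -expr2 -addrA lerDl addr_ge0//.
  by apply: sumr_ge0 => b _; rewrite -expr2 sqr_ge0.
by do 2!apply: sumr_ge0 => ? _; rewrite -expr2 sqr_ge0.
Qed.

Lemma eucl_dot_gt0 p q (e : 'M[R]_(p, q)) i j : e i j != 0 -> 0 < eucl_dot e e.
Proof.
move=> eij; apply: lt_le_trans (eucl_dot_coord_le e i j).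
by rewrite lt_neqAle sqr_ge0 eq_sym sqrf_eq0 eij.
Qed.

Lemma compact_sphere_sub n (A : set 'M[R]_(n, 4)) : closed A ->
  (forall e, A e -> eucl_dot e e = 2) -> compact A.
Proof.
move=> cA A2; apply: (@closed_bounded_compact_mx _ _ _ 2) => // e /A2 e2 i j.
have := eucl_dot_coord_le e i j; rewrite e2 -real_normK ?num_real//.
have := normr_ge0 (e i j); nra.
Qed.

End compactness.

(** * Charts of the arm spaces by central projection *)

Section embedding.
Context {R : realType} {p q k : nat}.
Variables (base : 'M[R]_(p, q)) (num : 'I_k -> 'I_p * 'I_q).
Hypothesis num_inj : injective num.

Definition embed (x : 'rV[R]_k) : 'M[R]_(p, q) :=
  base + \sum_i x 0 i *: delta_mx (num i).1 (num i).2.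

Lemma embedE x a b :
  embed x a b = base a b + \sum_i x 0 i * (num i == (a, b))%:R.
Proof.
rewrite mxE summxE; congr (_ + _); apply: eq_bigr => i _.
by rewrite !mxE -pair_eqE /= ![_ == (num i).1]eq_sym ![_ == (num i).2]eq_sym.
Qed.

Lemma embed_num x i : base (num i).1 (num i).2 = 0 ->
  embed x (num i).1 (num i).2 = x 0 i.
Proof.
move=> b0; rewrite embedE b0 add0r (bigD1 i)//= -surjective_pairing eqxx mulr1.
rewrite big1 ?addr0// => j ji.
by rewrite (inj_eq num_inj) (negbTE ji) mulr0.
Qed.

Lemma embed_out x a b : (forall i, num i != (a, b)) -> embed x a b = base a b.
Proof.
by move=> ab; rewrite embedE big1 ?addr0// => i _; rewrite (negbTE (ab i)) mulr0.
Qed.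

Lemma C1_embed a b : C1 (fun x => embed x a b).
Proof.
under eq_fun do rewrite embedE.
apply: C1D; first exact: C1_cst.
apply: C1_sum => i _; apply: C1M; [exact: C1_coord|exact: C1_cst].
Qed.

End embedding.

(** The number [d] is kept apart from the cardinal so that the domain of a chart has its dimension
    in the closed form that the volume hypothesis mentions. *)
Lemma enum_set_bij (T : finType) (F : {set T}) d : #|F| = d ->
  exists num : 'I_d -> T, [/\ injective num, forall i, num i \in F
    & forall t, t \in F -> exists i, num i = t].
Proof.
move=> <-; exists (@enum_val T (mem F)); split.
- exact: enum_val_inj.
- by move=> i; exact: enum_valP.
- by move=> t tF; exists (enum_rank_in tF t); rewrite enum_rankK_in.
Qed.

Definition arm_free n (S : {set 'I_4}) (k : 'I_n) (c : 'I_4) : {set 'I_n * 'I_4} :=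
  [set mc | (mc.2 \in S) && (mc != (k, c))]%SET.

Lemma in_arm_free n (S : {set 'I_4}) (k : 'I_n) c mc :
  (mc \in arm_free S k c) = (mc.2 \in S) && (mc != (k, c)).
Proof. by rewrite finset.in_set. Qed.

Section arm_chart.
Context {R : realType} {n : nat}.
Variables (M : set 'M[R]_(n, 4)) (S : {set 'I_4}) (k : 'I_n) (c : 'I_4) (eps : R).
Variable d : nat.

Definition supported (e : 'M[R]_(n, 4)) : Prop :=
  forall m b, b \notin S -> e m b = 0.

Hypothesis cS : c \in S.
Hypothesis eps2 : eps * eps = 1.
Hypothesis Mkc : forall e : 'M[R]_(n, 4),
  e k c != 0 -> (M e <-> eucl_dot e e = 2 /\ supported e).
Hypothesis cardF : #|arm_free S k c| = d.

(** The affine space where the entry [(k, c)] is frozen to [eps] is projected from the origin onto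
    the open half of the sphere where that entry has the sign of [eps]. By [Mkc], a nonzero entry in
    column [c] confines [M] to the columns of [S]. *)
Lemma arm_chart : exists phi : 'rV[R]_d -> 'M[R]_(n, 4),
  [/\ forall U, open U -> local_parametrization M U phi,
      forall x, M (phi x)
    & forall e, M e -> 0 < eps * e k c -> exists x, phi x = e].
Proof.
have [num [num_inj numF Fnum]] := enum_set_bij cardF.
have eps0 : eps != 0 by apply: contra_eqN eps2 => /eqP ->; rewrite mul0r eq_sym oner_eq0.
pose base : 'M[R]_(n, 4) := eps *: delta_mx k c.
pose Q := embed base num.
have Qnum x i : Q x (num i).1 (num i).2 = x 0 i.
  apply: embed_num => //; rewrite !mxE -mulnb.
  have := numF i; rewrite in_arm_free => /andP[_].
  by case: (num i) => a b; rewrite xpair_eqE /= mulnb => /negbTE ->; rewrite mulr0.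
have Qkc x : Q x k c = eps.
  rewrite /Q embed_out; first by rewrite !mxE !eqxx mulr1.
  by move=> i; have := numF i; rewrite in_arm_free => /andP[].
have QS x m b : b \notin S -> Q x m b = 0.
  move=> bS; rewrite /Q embed_out.
    rewrite !mxE; case: (b =P c) => [bc|_]; last by rewrite andbF mulr0.
    by rewrite bc cS in bS.
  move=> i; have := numF i; rewrite in_arm_free => /andP[iS _].
  by apply: contraNneq bS => ib; rewrite ib in iS.
have QQ x : 0 < eucl_dot (Q x) (Q x).
  by apply: (@eucl_dot_gt0 _ _ _ _ k c); rewrite Qkc.
pose r x := Num.sqrt 2 * (Num.sqrt (eucl_dot (Q x) (Q x)))^-1.
have r0 x : 0 < r x by rewrite mulr_gt0// ?invr_gt0 sqrtr_gt0.
pose phi x := r x *: Q x.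
have phiE x a b : phi x a b = r x * Q x a b by rewrite mxE.
have eucl_phi x : eucl_dot (phi x) (phi x) = 2.
  rewrite /phi eucl_dotZl eucl_dotC eucl_dotZl /r.
  have sQ := sqr_sqrtr (ltW (QQ x)); have s2 := @sqr_sqrtr R 2 (ler0n _ _).
  have : Num.sqrt (eucl_dot (Q x) (Q x)) != 0 by rewrite gt_eqF// sqrtr_gt0.
  move: (Num.sqrt (eucl_dot (Q x) (Q x))) sQ => t <- t0.
  by rewrite -[RHS]s2; field.
have phi_kc x : 0 < eps * phi x k c by rewrite phiE Qkc mulrCA eps2 mulr1.
have phi_M x : M (phi x).
  apply/Mkc; first by have := phi_kc x; apply: contraTneq => ->; rewrite mulr0 ltxx.
  by split; [exact: eucl_phi|move=> m b bS; rewrite phiE QS// mulr0].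
pose D := [set e : 'M[R]_(n, 4) | 0 < eps * e k c].
have phi_onto e : (M `&` D) e ->
    phi (\row_i (e (num i).1 (num i).2 / (eps * e k c))) = e.
  move=> [Me De]; set x := \row__ _; set s := eps * e k c.
  have s0 : 0 < s by [].
  have ekc : e k c != 0 by apply: contraTneq De; rewrite /D /= => ->; rewrite mulr0 ltxx.
  have [e2 eS] := (Mkc ekc).1 Me.
  have Qx : Q x = s^-1 *: e.
    apply/matrixP => a b; rewrite [RHS]mxE.
    have [|abF] := boolP ((a, b) \in arm_free S k c).
      by move=> /Fnum[i iab]; have := Qnum x i; rewrite iab /= => ->;
        rewrite mxE iab mulrC.
    move: abF; rewrite in_arm_free negb_and negbK /=.
    move=> /orP[bS|/eqP[-> ->]]; first by rewrite QS// eS// mulr0.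
    by rewrite Qkc -[e k c]mul1r -eps2 -mulrA -/s mulrCA mulVf ?mulr1// gt_eqF.
  rewrite /phi /r Qx eucl_dotZl eucl_dotC eucl_dotZl e2 mulrA sqrtrM; last first.
    by rewrite -expr2 sqr_ge0.
  rewrite -expr2 sqrtr_sqr gtr0_norm ?invr_gt0// scalerA.
  rewrite [X in X *: _](_ : _ = 1) ?scale1r//.
  have : Num.sqrt 2 != 0 :> R by rewrite gt_eqF// sqrtr_gt0.
  by move=> ?; field; rewrite gt_eqF.
exists phi; split => //; last first.
  by move=> e Me De; exists (\row_i (e (num i).1 (num i).2 / (eps * e k c))); exact: phi_onto.
move=> U oU.
apply: (@ratio_local_parametrization _ _ _ _ M D phi num (fun=> (k, c)) (fun=> eps)) => //.
- rewrite /D; apply: (@open_comp _ _ (fun e : 'M[R]_(n, 4) => eps * e k c) [set t | 0 < t]).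
    move=> e _; apply: (@cvgM _ _ (nbhs e) _ (fun=> eps)); first exact: cvg_cst.
    exact: coord_continuous.
  exact: open_gt.
- move=> a b; under eq_fun do rewrite phiE.
  apply: C1M; last exact: C1_embed.
  apply: C1M; first exact: C1_cst.
  apply: C1V; first by move=> x; rewrite gt_eqF// sqrtr_gt0.
  apply: C1_sqrt => //; apply: C1_sum => a' _; apply: C1_sum => b' _.
  by apply: C1M; exact: C1_embed.
- by move=> x; split; [exact: phi_M|exact: phi_kc].
- by move=> x i; rewrite !phiE Qnum Qkc [eps * _]mulrCA eps2 mulr1 mulrC.
Qed.

End arm_chart.

Lemma C1B (R : realType) k (f g : 'rV[R]_k -> R) :
  C1 f -> C1 g -> C1 (fun x => f x - g x).
Proof.
move=> C1f C1g; under eq_fun do rewrite -mulN1r.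
exact: (C1D C1f (C1M (C1_cst (-1)) C1g)).
Qed.

(** * Charts of the Stiefel spaces *)

Section normalization.
Context {R : realType} {n : nat}.
Implicit Types W e : 'M[R]_(n, 4).

(** The squared norm of whichever of the two complex vectors contains column [c]: columns 0 and 1
    form the first vector, columns 2 and 3 the second. *)
Definition half_dot W (c : nat) : R :=
  if (c < 2)%N then col_dot W (inord 0) (inord 0) + col_dot W (inord 1) (inord 1)
  else col_dot W (inord 2) (inord 2) + col_dot W (inord 3) (inord 3).

Definition normalize W : 'M[R]_(n, 4) :=
  \matrix_(m, c) ((Num.sqrt (half_dot W c))^-1 * W m c).

Lemma col_dot_scale W e (f : 'I_4 -> R) c d :
  (forall m b, W m b = f b * e m b) -> col_dot W c d = f c * f d * col_dot e c d.
Proof.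
move=> We; rewrite /col_dot mulr_sumr; apply: eq_bigr => m _.
by rewrite !We mulrACA.
Qed.

Lemma stiefel_normalize W : 0 < half_dot W 0 -> 0 < half_dot W 2 ->
  col_dot W (inord 0) (inord 2) + col_dot W (inord 1) (inord 3) = 0 ->
  col_dot W (inord 1) (inord 2) = col_dot W (inord 0) (inord 3) ->
  stiefel (normalize W).
Proof.
move=> h0 h2 W02 W12.
have E c d := @col_dot_scale (normalize W) W
  (fun c => (Num.sqrt (half_dot W c))^-1) c d (fun m b => mxE _ _ _ _).
have sq (x : R) : 0 < x -> (Num.sqrt x)^-1 * (Num.sqrt x)^-1 * x = 1.
  move=> x0; rewrite -invfM -expr2 sqr_sqrtr ?(ltW x0)// mulVf// gt_eqF//.
have hd (c : nat) : (c < 4)%N -> half_dot W (inord c : 'I_4) = half_dot W c.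
  by move=> c4; rewrite inordK.
split; rewrite !E !hd//.
- by rewrite -mulrDr sq.
- by rewrite -mulrDr sq.
- by rewrite -mulrDr W02 mulr0.
- by rewrite W12.
Qed.

Lemma normalize_scale W e (al be : R) : stiefel e -> 0 < al -> 0 < be ->
  (forall m (c : 'I_4), W m c = (if (c < 2)%N then al else be) * e m c) ->
  normalize W = e.
Proof.
move=> [e1 e2 _ _] a0 b0 We.
have E c d := @col_dot_scale W e (fun c => if (c < 2)%N then al else be) c d We.
apply/matrixP => m c; rewrite mxE We /half_dot !E !inordK//= -!mulrDr e1 e2 !mulr1.
rewrite -!expr2.
by case: ifP => _; rewrite sqrtr_sqr gtr0_norm// mulKf// gt_eqF.
Qed.

End normalization.

Section pol_chart.
Context {R : realType} {n : nat}.
Variables (M : set 'M[R]_(n, 4)) (S : {set 'I_4}) (k l : 'I_n) (ca cb : 'I_4).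
Variables (eps del : R) (d : nat).

(** One real entry of each vector is frozen to fix its scale. The whole entry of the second vector
    in row [k] is removed as well: where the first vector is nonzero in that row, orthogonality
    determines it. *)
Definition pol_free : {set 'I_n * 'I_4} :=
  [set mc | [&& mc.2 \in S, mc != (k, ca), mc != (l, cb) &
    ~~ ((mc.1 == k) && (1 < mc.2)%N)]]%SET.

Lemma in_pol_free mc : (mc \in pol_free) = [&& mc.2 \in S, mc != (k, ca),
  mc != (l, cb) & ~~ ((mc.1 == k) && (1 < mc.2)%N)].
Proof. by rewrite finset.in_set. Qed.

Hypotheses (caS : ca \in S) (cbS : cb \in S) (ca2 : (ca < 2)%N) (cb2 : (1 < cb)%N).
Hypothesis lk : l != k.
Hypotheses (eps2 : eps * eps = 1) (del2 : del * del = 1).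
Hypothesis Sparity : [\/ forall c, c \in S, forall c : 'I_4, (c \in S) = ~~ odd c
  | forall c : 'I_4, (c \in S) = odd c].
Hypothesis Mkl : forall e : 'M[R]_(n, 4),
  e k ca != 0 -> e l cb != 0 -> (M e <-> stiefel e /\ supported S e).
Hypothesis cardF : #|pol_free| = d.

(** [N] is |u_k|^2, while [P] and [I] are the real and imaginary parts of <w, u>, for the complex
    vectors u in columns 0, 1 and w in columns 2, 3. Scaling the projection by [N] avoids a
    division. *)
Let N (Q : 'M[R]_(n, 4)) := Q k (inord 0) ^+ 2 + Q k (inord 1) ^+ 2.
Let P (Q : 'M[R]_(n, 4)) := \sum_m (Q m (inord 2) * Q m (inord 0) +
                                    Q m (inord 3) * Q m (inord 1)).
Let I (Q : 'M[R]_(n, 4)) := \sum_m (Q m (inord 3) * Q m (inord 0) -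
                                    Q m (inord 2) * Q m (inord 1)).

(* With u = Q_0 + i Q_1 and w = Q_2 + i Q_3, the second vector is
   |u_k|^2 w - u_k <w, u> delta_k, which is orthogonal to u. *)
Let W (Q : 'M[R]_(n, 4)) : 'M[R]_(n, 4) := \matrix_(m, c) nth 0
  [:: Q m (inord 0); Q m (inord 1);
      N Q * Q m (inord 2) - (m == k)%:R * (Q k (inord 0) * P Q - Q k (inord 1) * I Q);
      N Q * Q m (inord 3) - (m == k)%:R * (Q k (inord 0) * I Q + Q k (inord 1) * P Q)] c.

Let sum_delta (f : 'I_n -> R) (t : R) : \sum_m f m * ((m == k)%:R * t) = f k * t.
Proof.
rewrite (bigD1 k)//= eqxx mul1r big1 ?addr0// => m /negbTE ->.
by rewrite mul0r mulr0.
Qed.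

Let W02 Q : col_dot (W Q) (inord 0) (inord 2) + col_dot (W Q) (inord 1) (inord 3) = 0.
Proof.
rewrite /col_dot; under eq_bigr do rewrite !mxE !inordK//= mulrBr mulrCA.
rewrite sumrB sum_delta -mulr_sumr.
under [X in _ + X]eq_bigr do rewrite !mxE !inordK//= mulrBr mulrCA.
rewrite sumrB sum_delta -mulr_sumr.
have -> : P Q = \sum_m Q m (inord 0) * Q m (inord 2) + \sum_m Q m (inord 1) * Q m (inord 3).
  rewrite /P big_split /=; congr (_ + _); apply: eq_bigr => m _; exact: mulrC.
by rewrite /N; ring.
Qed.

Let W12 Q : col_dot (W Q) (inord 1) (inord 2) = col_dot (W Q) (inord 0) (inord 3).
Proof.
rewrite /col_dot; under eq_bigr do rewrite !mxE !inordK//= mulrBr mulrCA.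
rewrite sumrB sum_delta -mulr_sumr.
under [RHS]eq_bigr do rewrite !mxE !inordK//= mulrBr mulrCA.
rewrite sumrB sum_delta -mulr_sumr.
have -> : I Q = \sum_m Q m (inord 0) * Q m (inord 3) - \sum_m Q m (inord 1) * Q m (inord 2).
  rewrite /I sumrB; congr (_ - _); apply: eq_bigr => m _; exact: mulrC.
by rewrite /N; ring.
Qed.

(** In the planar cases every product in [I] pairs an even column with an odd one, so [I] vanishes
    and the projection stays within the columns of [S]. *)
Let Wsupp Q : supported S Q -> supported S (W Q).
Proof.
move=> QS m c cS; rewrite mxE.
have [Sall|Seven|Sodd] := Sparity.
- by rewrite Sall in cS.
- have Q1 a : Q a (inord 1) = 0 by apply: QS; rewrite Seven inordK.
  have Q3 a : Q a (inord 3) = 0 by apply: QS; rewrite Seven inordK.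
  have I0 : I Q = 0 by rewrite /I big1// => a _; rewrite Q1 Q3 mulr0 mul0r subr0.
  move: cS; rewrite Seven; elim/forall_ord4: c; rewrite inordK//= => _.
  by rewrite I0 Q1 Q3; ring.
- have Q0 a : Q a (inord 0) = 0 by apply: QS; rewrite Sodd inordK.
  have Q2 a : Q a (inord 2) = 0 by apply: QS; rewrite Sodd inordK.
  have I0 : I Q = 0 by rewrite /I big1// => a _; rewrite Q0 Q2 mulr0 mul0r subr0.
  move: cS; rewrite Sodd; elim/forall_ord4: c; rewrite inordK//= => _.
  by rewrite I0 Q0 Q2; ring.
Qed.

Let W_lt2 Q m (c : 'I_4) : (c < 2)%N -> W Q m c = Q m c.
Proof. by rewrite mxE; elim/forall_ord4: c; rewrite !inordK. Qed.

Let W_gt1 Q m (c : 'I_4) : (1 < c)%N -> m != k -> W Q m c = N Q * Q m c.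
Proof.
move=> c2 mk; rewrite mxE (negbTE mk).
by elim/forall_ord4: c c2; rewrite !inordK//= mul0r subr0.
Qed.

(** Here [Q] comes from [e] by rescaling both vectors and erasing row [k] of the second one. Since
    <w, u> = 0 for [e], the truncated product is minus its missing term, and subtracting u_k times
    it restores |u_k|^2 w_k. *)
Let W_onto (e Q : 'M[R]_(n, 4)) (s t : R) : stiefel e -> s != 0 -> t != 0 ->
  (forall m (c : 'I_4), Q m c = if (c < 2)%N then e m c / s
    else if m == k then 0 else e m c / t) ->
  forall m (c : 'I_4), W Q m c = (if (c < 2)%N then s^-1 else N Q / t) * e m c.
Proof.
move=> [_ _ e02 e12] s0 t0 QE m c.
(* A family of sum zero, scaled and deprived of its term [k], sums to minus the scaled term [k];
   this is used for the real and the imaginary part. *)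
have sum_k (G g : 'I_n -> R) : \sum_m g m = 0 -> G k = 0 ->
    (forall m, m != k -> G m = g m / (s * t)) -> \sum_m G m = - g k / (s * t).
  move=> g0 Gk Gg; rewrite (bigD1 k)//= Gk add0r (eq_bigr _ Gg) -mulr_suml.
  by move: g0; rewrite (bigD1 k)//= => /eqP; rewrite addr_eq0 => /eqP ->; rewrite opprK.
have PE : P Q = - (e k (inord 2) * e k (inord 0) + e k (inord 3) * e k (inord 1)) / (s * t).
  apply: (sum_k _ (fun m => e m (inord 2) * e m (inord 0) + e m (inord 3) * e m (inord 1))).
  - rewrite big_split /= -[RHS]e02.
    by congr (_ + _); apply: eq_bigr => a _; rewrite mulrC.
  - by rewrite !QE !inordK//= eqxx !mul0r addr0.
  - by move=> a /negbTE ak; rewrite !QE !inordK//= ak; field; rewrite ?s0 ?t0.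
have IE : I Q = - (e k (inord 3) * e k (inord 0) - e k (inord 2) * e k (inord 1)) / (s * t).
  apply: (sum_k _ (fun m => e m (inord 3) * e m (inord 0) - e m (inord 2) * e m (inord 1))).
  - rewrite sumrB; apply/eqP; rewrite subr_eq0; apply/eqP/esym.
    under eq_bigr do rewrite mulrC.
    by apply: (etrans e12); apply: eq_bigr => a _; rewrite mulrC.
  - by rewrite !QE !inordK//= eqxx !mul0r subr0.
  - by move=> a /negbTE ak; rewrite !QE !inordK//= ak; field; rewrite ?s0 ?t0.
case: ltnP => c2; first by rewrite W_lt2// QE c2 mulrC.
have [->|mk] := eqVneq m k; last first.
  by rewrite W_gt1// QE ltnNge c2 /= (negbTE mk) mulrAC mulrA.
rewrite mxE PE IE /N.
by elim/forall_ord4: c c2; rewrite !inordK//= !QE !inordK//= !eqxx => _; rewrite -[true%:R]/(1 : R); field; rewrite ?s0 ?t0.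
Qed.

Lemma pol_chart : exists phi : 'rV[R]_d -> 'M[R]_(n, 4),
  [/\ forall U, open U -> local_parametrization M U phi,
      forall x, M (phi x)
    & forall e, M e -> 0 < eps * e k ca -> 0 < del * e l cb -> exists x, phi x = e].
Proof.
have [num [num_inj numF Fnum]] := enum_set_bij cardF.
pose base : 'M[R]_(n, 4) := eps *: delta_mx k ca + del *: delta_mx l cb.
have cab : ca != cb by apply: contraTneq ca2 => ->; rewrite -leqNgt.
have baseE a b : base a b = eps * ((a, b) == (k, ca))%:R + del * ((a, b) == (l, cb))%:R.
  by rewrite !mxE !xpair_eqE.
pose Q := embed base num.
have Qnum x i : Q x (num i).1 (num i).2 = x 0 i.
  apply: embed_num => //; rewrite baseE -surjective_pairing.
  have := numF i; rewrite in_pol_free => /and4P[_ /negbTE -> /negbTE -> _].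
  by rewrite !mulr0 addr0.
have Qout x a b : (a, b) \notin pol_free -> Q x a b = base a b.
  move=> ab; rewrite /Q embed_out// => i; apply: contraNneq ab => <-; exact: numF.
have Qkca x : Q x k ca = eps.
  rewrite Qout; last by rewrite in_pol_free eqxx andbF.
  by rewrite baseE eqxx xpair_eqE (negbTE cab) andbF mulr1 mulr0 addr0.
have Qlcb x : Q x l cb = del.
  rewrite Qout; last by rewrite in_pol_free eqxx !andbF.
  by rewrite baseE eqxx xpair_eqE (negbTE lk) mulr1 mulr0 add0r.
have Qk x (b : 'I_4) : (1 < b)%N -> Q x k b = 0.
  move=> b2; rewrite Qout; last by rewrite in_pol_free eqxx b2 !andbF.
  rewrite baseE !xpair_eqE eqxx /= [k == l]eq_sym (negbTE lk) mulr0 addr0.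
  by case: eqP => [bca|]; rewrite ?mulr0//; rewrite bca ltnNge -ltnS ca2 in b2.
have QS x : supported S (Q x).
  move=> m b bS; rewrite Qout; last by rewrite in_pol_free (negbTE bS).
  rewrite baseE !xpair_eqE.
  have /negbTE -> : b != ca by apply: contraNneq bS => ->.
  have /negbTE -> : b != cb by apply: contraNneq bS => ->.
  by rewrite !andbF !mulr0 addr0.
have sqr_unit (t : R) : t * t = 1 -> 0 < t ^+ 2 by rewrite expr2 => ->.
(* The first vector is nonzero in row [k], since its entry in column [ca] is frozen to [eps], of
   square 1. *)
have N0 x : 0 < N (Q x).
  have := sqr_unit _ eps2; rewrite -(Qkca x) /N => ca0.
  have : (ca == inord 0) || (ca == inord 1).
    by move: ca2; elim/forall_ord4: (ca); rewrite !inordK//= ?eqxx ?orbT.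
  move=> /orP[]/eqP caE; rewrite caE in ca0.
  - by rewrite ltr_pwDl// sqr_ge0.
  - by rewrite ltr_pwDr// sqr_ge0.
have half_gt0 (e : 'M[R]_(n, 4)) m (c : 'I_4) : e m c != 0 -> 0 < half_dot e c.
  move=> emc; have cd0 a : 0 <= col_dot e a a by apply: sumr_ge0 => ? _; rewrite -expr2 sqr_ge0.
  have cdc : 0 < col_dot e c c.
    rewrite /col_dot (bigD1 m)//= ltr_pwDl//.
      by rewrite -expr2 lt_neqAle sqr_ge0 eq_sym sqrf_eq0 emc.
    by apply: sumr_ge0 => ? _; rewrite -expr2 sqr_ge0.
  by rewrite /half_dot; elim/forall_ord4: c emc cdc => _ cdc; rewrite inordK//=;
    rewrite ?(ltr_pwDl cdc (cd0 _)) ?(ltr_pwDr cdc (cd0 _)).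
have h0 x : 0 < half_dot (W (Q x)) 0.
  have := @half_gt0 (W (Q x)) k ca; rewrite W_lt2// Qkca /half_dot ca2; apply.
  by apply: contra_eqN eps2 => /eqP ->; rewrite mul0r eq_sym oner_eq0.
have del0 : del != 0.
  by apply: contra_eqN del2 => /eqP ->; rewrite mul0r eq_sym oner_eq0.
have h2 x : 0 < half_dot (W (Q x)) 2.
  have := @half_gt0 (W (Q x)) l cb; rewrite W_gt1// Qlcb /half_dot.
  by rewrite ltnNge cb2 /=; apply; rewrite ?mulf_neq0// gt_eqF.
pose phi x := normalize (W (Q x)).
pose r (c : nat) x := (Num.sqrt (half_dot (W (Q x)) c))^-1.
have hc (c : nat) x : 0 < half_dot (W (Q x)) c.
  by have := h0 x; have := h2 x; rewrite /half_dot; case: ifP.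
have r0 c x : 0 < r c x by rewrite invr_gt0 sqrtr_gt0.
have phi_lt2 x m (c : 'I_4) : (c < 2)%N -> phi x m c = r ca x * Q x m c.
  by move=> c2; rewrite mxE W_lt2// /r /half_dot c2 ca2.
have phi_gt1 x m (c : 'I_4) : (1 < c)%N -> m != k -> phi x m c = r cb x * (N (Q x) * Q x m c).
  by move=> c2 mk; rewrite mxE W_gt1// /r /half_dot [(c < 2)%N]ltnNge [(cb < 2)%N]ltnNge c2 cb2.
have phi_ca x : 0 < eps * phi x k ca by rewrite phi_lt2// Qkca mulrCA eps2 mulr1.
have phi_cb x : 0 < del * phi x l cb.
  by rewrite phi_gt1// Qlcb !mulrA mulrC !mulrA del2 mul1r mulr_gt0.
have posN0 (a b : R) : 0 < a * b -> b != 0.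
  by apply: contraTneq => ->; rewrite mulr0 ltxx.
have phi_M x : M (phi x).
  apply/Mkl; [exact: posN0 (phi_ca x)|exact: posN0 (phi_cb x)|split].
    exact: stiefel_normalize.
  by move=> m b bS; rewrite mxE (@Wsupp (Q x))// mulr0.
pose D := [set e : 'M[R]_(n, 4) | 0 < eps * e k ca /\ 0 < del * e l cb].
pose den (i : 'I_d) := if ((num i).2 < 2)%N then (k, ca) else (l, cb).
pose sg (i : 'I_d) := if ((num i).2 < 2)%N then eps else del.
have numk i : (1 < (num i).2)%N -> (num i).1 != k.
  move=> i2; have := numF i; rewrite in_pol_free => /and4P[_ _ _].
  by rewrite i2 andbT.
have unit_div (a b : R) : a * a = 1 -> 0 < a * b -> (a * b)^-1 * b = a.
  move=> a2 ab0; rewrite -[X in _ * X]mul1r -a2 -mulrA mulrCA mulVf ?mulr1// gt_eqF//.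
have phi_onto e : (M `&` D) e ->
    phi (\row_i (e (num i).1 (num i).2 / (sg i * e (den i).1 (den i).2))) = e.
  move=> [Me [Da Db]]; set x := \row__ _.
  have [e2 eS] := (Mkl (posN0 _ _ Da) (posN0 _ _ Db)).1 Me.
  have s0 : eps * e k ca != 0 by rewrite gt_eqF.
  have t0 : del * e l cb != 0 by rewrite gt_eqF.
  have QE m (c : 'I_4) : Q x m c = if (c < 2)%N then e m c / (eps * e k ca)
      else if m == k then 0 else e m c / (del * e l cb).
    have [/Fnum[i imc]|mcF] := boolP ((m, c) \in pol_free).
      have := Qnum x i; rewrite imc /= => ->; rewrite mxE /sg /den imc /=.
      case: ltnP => //= c2; have := numk i; rewrite imc /= => /(_ c2) /negbTE -> //.
    have [cS|cS] := boolP (c \in S); last by rewrite QS// eS// !mul0r if_same; case: ifP.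
    move: mcF; rewrite in_pol_free cS.
    have [[-> ->] _|n1] := eqVneq (m, c) (k, ca).
      by rewrite Qkca ca2 mulrC unit_div.
    have [[-> ->] _|n2] := eqVneq (m, c) (l, cb).
      by rewrite Qlcb ltnNge cb2 /= (negbTE lk) mulrC unit_div.
    rewrite !andTb negbK /= => /andP[/eqP -> c2].
    by rewrite Qk// ltnNge c2 /= eqxx.
  apply: (normalize_scale e2 _ _ (W_onto e2 s0 t0 QE)).
    by rewrite invr_gt0.
  by rewrite divr_gt0.
exists phi; split; [|exact: phi_M|].
  move=> U oU.
  apply: (@ratio_local_parametrization _ _ _ _ M D phi num den sg) => //.
  - have oD1 (a : R) m c : open [set e : 'M[R]_(n, 4) | 0 < a * e m c].
      apply: (@open_comp _ _ (fun e : 'M[R]_(n, 4) => a * e m c) [set t | 0 < t]).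
        move=> e _; apply: (@cvgM _ _ (nbhs e) _ (fun=> a)); first exact: cvg_cst.
        exact: coord_continuous.
      exact: open_gt.
    exact: (openI (oD1 eps k ca) (oD1 del l cb)).
  - have C1Q a b : C1 (fun x => Q x a b) by exact: C1_embed.
    have C1N : C1 (fun x => N (Q x)).
      rewrite /N; under eq_fun do rewrite !expr2.
      by apply: C1D; apply: C1M; exact: C1Q.
    have C1P : C1 (fun x => P (Q x)).
      by apply: C1_sum => m _; apply: C1D; apply: C1M; exact: C1Q.
    have C1I : C1 (fun x => I (Q x)).
      by apply: C1_sum => m _; apply: C1B; apply: C1M; exact: C1Q.
    have C1W a b : C1 (fun x => W (Q x) a b).
      under eq_fun do rewrite mxE.
      elim/forall_ord4: b;
        rewrite ?(@inordK 3 0 isT) ?(@inordK 3 1 isT) ?(@inordK 3 2 isT) ?(@inordK 3 3 isT) /=.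
      + exact: C1Q.
      + exact: C1Q.
      + exact: (C1B (C1M C1N (C1Q a _)) (C1M (C1_cst _)
          (C1B (C1M (C1Q _ _) C1P) (C1M (C1Q _ _) C1I)))).
      + exact: (C1B (C1M C1N (C1Q a _)) (C1M (C1_cst _)
          (C1D (C1M (C1Q _ _) C1I) (C1M (C1Q _ _) C1P)))).
    have C1col c : C1 (fun x => col_dot (W (Q x)) c c).
      by apply: C1_sum => m _; exact: (C1M (C1W m c) (C1W m c)).
    have C1half c : C1 (fun x => half_dot (W (Q x)) c).
      by rewrite /half_dot; case: (c < 2)%N; exact: (C1D (C1col _) (C1col _)).
    move=> a b; under eq_fun do rewrite mxE.
    apply: (C1M _ (C1W a b)); apply: C1V.
      by move=> x; rewrite gt_eqF// sqrtr_gt0.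
    by apply: C1_sqrt; [exact: hc|exact: C1half].
  - by move=> e i [Da Db]; rewrite /sg /den; case: ifP.
  - move=> x i; rewrite /sg /den; case: ltnP => i2 /=.
      by rewrite !phi_lt2// Qkca Qnum [eps * _]mulrCA eps2 mulr1 mulrC.
    rewrite !phi_gt1// ?numk// Qlcb Qnum.
    have -> : del * (r cb x * (N (Q x) * del)) = r cb x * N (Q x) * (del * del) by ring.
    by rewrite del2; ring.
move=> e Me Da Db.
by exists (\row_i (e (num i).1 (num i).2 / (sg i * e (den i).1 (den i).2))); exact: phi_onto.
Qed.

End pol_chart.

(** * Atlases, dimensions and topology of the model spaces *)

(** The columns of the component that contains a matrix with a nonzero entry in column [c]: even
    columns span R + jR, odd ones iR + kR. *)
Definition column_class (planar : bool) (c : 'I_4) : {set 'I_4} :=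
  [set d : 'I_4 | planar ==> (odd d == odd c)]%SET.

Lemma in_column_class b (c d : 'I_4) :
  (d \in column_class b c) = (b ==> (odd d == odd c)).
Proof. by rewrite finset.in_set. Qed.

Lemma card_column_class b c : #|column_class b c| = (if b then 2 else 4)%N.
Proof.
rewrite -sum1dep_card big_mkcond /= sum_ord4 !inordK//.
by case: b => //=; case: (odd c).
Qed.

Lemma card_arm_free n b (k : 'I_n) c :
  #|arm_free (column_class b c) k c| = ((if b then 2 else 4) * n - 1)%N.
Proof.
have -> : arm_free (column_class b c) k c =
    (finset.setX [set: 'I_n]%SET (column_class b c) :\ (k, c))%SET.
  by apply/finset.setP => -[m d]; rewrite !finset.inE /= andbC.
have := cardsD1 (k, c) (finset.setX [set: 'I_n]%SET (column_class b c)).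
rewrite finset.in_setX finset.in_setT in_column_class /= eqxx implybT cardsX.
by rewrite cardsT card_ord card_column_class mulnC => ->; rewrite addKn.
Qed.

Lemma card_pol_free n b (k l : 'I_n) (ca cb : 'I_4) : l != k ->
  (ca < 2)%N -> (1 < cb)%N -> cb \in column_class b ca ->
  #|pol_free (column_class b ca) k l ca cb| = (if b then 2 * n - 3 else 4 * n - 4)%N.
Proof.
move=> lk ca2 cb2 cbS; set S := column_class b ca.
pose A := finset.setX [set: 'I_n]%SET S.
(* Four removals in the spatial case. In the planar case exactly one of the columns 2 and 3 belongs
   to [S], so only three removals count, whence [2 * n - 3]. *)
have -> : pol_free S k l ca cb =
    (A :\ (k, ca) :\ (l, cb) :\ (k, inord 2) :\ (k, inord 3))%SET.
  apply/finset.setP => -[m d].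
  rewrite in_pol_free !finset.in_setD1 /A finset.in_setX finset.in_setT.
  rewrite [(m, d).1]/= [(m, d).2]/=.
  have -> : (m == k) && (1 < d)%N = ((m, d) == (k, inord 2)) || ((m, d) == (k, inord 3)).
    rewrite !xpair_eqE -andb_orr; congr (_ && _).
    rewrite -!val_eqE /= !inordK//.
    by case: d => [[|[|[|[|]]]]].
  rewrite negb_or.
  by case: (d \in S); case: ((m, d) == (k, ca)); case: ((m, d) == (l, cb));
    case: ((m, d) == (k, inord 2)); case: ((m, d) == (k, inord 3)).
have cA : #|A| = ((if b then 2 else 4) * n)%N.
  by rewrite cardsX cardsT card_ord card_column_class mulnC.
have k2a : (inord 2 : 'I_4) != ca by rewrite -val_eqE /= inordK// gtn_eqF.
have k3a : (inord 3 : 'I_4) != ca by rewrite -val_eqE /= inordK// gtn_eqF// ltnW.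
have k23 : (inord 3 : 'I_4) != inord 2 by rewrite -val_eqE /= !inordK.
have cba : cb != ca by rewrite -val_eqE gtn_eqF// (leq_trans ca2).
have inA m d : ((m, d) \in A) = (d \in S) by rewrite finset.in_setX finset.in_setT.
have caS : ca \in S by rewrite in_column_class eqxx implybT.
have m2 : (l, cb) \in (A :\ (k, ca))%SET.
  by rewrite finset.in_setD1 inA cbS xpair_eqE (negbTE lk).
have m3 : ((k, inord 2) \in (A :\ (k, ca) :\ (l, cb))%SET) = (inord 2 \in S).
  rewrite !finset.in_setD1 inA !xpair_eqE [k == l]eq_sym (negbTE lk) eqxx.
  by rewrite (negbTE k2a).
have m4 : ((k, inord 3) \in (A :\ (k, ca) :\ (l, cb) :\ (k, inord 2))%SET) = (inord 3 \in S).
  rewrite !finset.in_setD1 inA !xpair_eqE [k == l]eq_sym (negbTE lk) eqxx.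
  by rewrite (negbTE k3a) (negbTE k23).
have h1 := cardsD1 (k, ca) A.
have h2 := cardsD1 (l, cb) (A :\ (k, ca))%SET.
have h3 := cardsD1 (k, inord 2) (A :\ (k, ca) :\ (l, cb))%SET.
have h4 := cardsD1 (k, inord 3) (A :\ (k, ca) :\ (l, cb) :\ (k, inord 2))%SET.
rewrite inA caS cA in h1; rewrite m2 in h2.
rewrite m3 in_column_class inordK// in h3; rewrite m4 in_column_class inordK// in h4.
move: (#|_|) h1 h2 h3 h4 => t.
move: (#|_|) => t1; move: (#|_|) => t2; move: (#|_|) => t3.
by case: b {S A cA cbS inA caS m2 m3 m4} => /=; case: (odd ca) => /=; lia.
Qed.

Section model_spaces.
Context {R : realType} {n : nat}.
Implicit Types e : 'M[R]_(n, 4).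

(** The boolean selects the dimension: [true] for planar polygons, [false] for polygons in space. *)
Definition arm_space (b : bool) : set 'M[R]_(n, 4) :=
  [set e | eucl_dot e e = 2 /\ (b -> planar e)].

Definition pol_space (b : bool) : set 'M[R]_(n, 4) :=
  [set e | stiefel e /\ (b -> planar e)].

Lemma pol_arm_space b e : pol_space b e -> arm_space b e.
Proof. by move=> [st pl]; split => //; exact: stiefel_eucl_dot. Qed.

Lemma planar_supported (b : bool) e m c : e m c != 0 ->
  ((b -> planar e) <-> supported (column_class b c) e).
Proof.
move=> emc; case: b; last first.
  by split=> // _ a d; rewrite in_column_class.
split=> [/(_ isT) [] pl a d|supp _].
- have [p1 p3] := pl a; have [q1 q3] := pl m.
  rewrite in_column_class /=.
  elim/forall_ord4: c emc; rewrite inordK// ?q1 ?q3 ?eqxx// => _;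
  by elim/forall_ord4: d; rewrite inordK.
- have [p1 p3] := pl a; have [q1 q3] := pl m.
  rewrite in_column_class /=.
  elim/forall_ord4: c emc; rewrite inordK// ?q1 ?q3 ?eqxx// => _;
  by elim/forall_ord4: d; rewrite inordK.
- have S a (d : 'I_4) : odd d != odd c -> e a d = 0.
    by move=> dc; apply: supp; rewrite in_column_class /= (negbTE dc).
  case oc : (odd c); [right|left] => a; split; apply: S; by rewrite inordK// oc.
Qed.

Lemma sg_unit (x : R) : x != 0 -> Num.sg x * Num.sg x = 1 /\ 0 < Num.sg x * x.
Proof.
by move=> x0; rewrite -expr2 sqr_sg x0 -normrEsg normr_gt0.
Qed.

Lemma arm_space_chart b (k : 'I_n) (c : 'I_4) (eps : R) : eps * eps = 1 ->
  exists phi : 'rV[R]_((if b then 2 else 4) * n - 1) -> 'M[R]_(n, 4),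
  [/\ forall U, open U -> local_parametrization (arm_space b) U phi,
      forall x, arm_space b (phi x)
    & forall e, arm_space b e -> 0 < eps * e k c -> exists x, phi x = e].
Proof.
move=> eps2; apply: (@arm_chart _ _ _ (column_class b c)) => //.
- by rewrite in_column_class eqxx implybT.
- by move=> e ekc; rewrite /arm_space /=; rewrite -(planar_supported b ekc).
- exact: card_arm_free.
Qed.

Lemma arm_space_atlas b e : arm_space b e ->
  exists U (phi : 'rV[R]_((if b then 2 else 4) * n - 1) -> _),
    local_parametrization (arm_space b) U phi /\ (phi @` U) e.
Proof.
move=> eM; have [e2 _] := eM.
have [k [c ekc]] : exists k c, e k c != 0.
  apply: contrapT => h; have e0 : e = 0.
    apply/matrixP => k c; rewrite [RHS]mxE; apply/eqP; apply: contrapT => /negP ekc.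
    by apply: h; exists k, c.
  by move: e2; rewrite e0 eucl_dot0l => /eqP; rewrite eq_sym pnatr_eq0.
have [eps2 eps_gt0] := sg_unit ekc.
have [phi [chart _ onto]] := @arm_space_chart b k c _ eps2.
have [x xe] := onto e eM eps_gt0.
by exists setT, phi; split; [exact/chart/openT|exists x].
Qed.

Lemma pol_space_chart b (k l : 'I_n) (ca cb : 'I_4) (eps del : R) :
  l != k -> (ca < 2)%N -> (1 < cb)%N -> (b ==> (odd cb == odd ca)) ->
  eps * eps = 1 -> del * del = 1 ->
  exists phi : 'rV[R]_(if b then 2 * n - 3 else 4 * n - 4)%N -> 'M[R]_(n, 4),
  [/\ forall U, open U -> local_parametrization (pol_space b) U phi,
      forall x, pol_space b (phi x)
    & forall e, pol_space b e -> 0 < eps * e k ca -> 0 < del * e l cb ->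
        exists x, phi x = e].
Proof.
move=> lk ca2 cb2 cab eps2 del2.
apply: (@pol_chart _ _ _ (column_class b ca) k l ca cb) => //.
- by rewrite in_column_class eqxx implybT.
- by rewrite in_column_class.
- case: b cab => /= [_|_].
    case oca : (odd ca); [apply: Or33|apply: Or32] => c; rewrite in_column_class /= oca.
      by case: (odd c).
    by case: (odd c).
  by apply: Or31 => c; rewrite in_column_class.
- by move=> e eka _; rewrite /pol_space /=; rewrite -(planar_supported b eka).
- by apply: card_pol_free => //; rewrite in_column_class.
Qed.

Lemma pol_space_atlas b e : pol_space b e ->
  exists U (phi : 'rV[R]_(if b then 2 * n - 3 else 4 * n - 4)%N -> _),
    local_parametrization (pol_space b) U phi /\ (phi @` U) e.
Proof.
move=> eM; have [[e1 e2 e3 e4] epl] := eM.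
have [k [ca [ca2 eka]]] : exists k (ca : 'I_4), (ca < 2)%N /\ e k ca != 0.
  apply: contrapT => h.
  have e0 k (c : 'I_4) : (c < 2)%N -> e k c = 0.
    by move=> c2; apply/eqP; apply: contrapT => /negP ekc; apply: h; exists k, c.
  have cd (c : 'I_4) : (c < 2)%N -> col_dot e c c = 0.
    by move=> c2; rewrite /col_dot big1// => m _; rewrite e0// mulr0.
  by move: e1; rewrite !cd ?inordK// addr0 => /eqP; rewrite eq_sym oner_eq0.
(* If the second vector w lived in row [k] alone, then <u, w> = 0 would give |u_k|^2 |w_k|^2 = 0
   with |w_k| = 1, against u_k being nonzero. *)
have [l [cb [lk cb2 elb]]] : exists l (cb : 'I_4), [/\ l != k, (1 < cb)%N & e l cb != 0].
  apply: contrapT => h.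
  have e0 l (c : 'I_4) : l != k -> (1 < c)%N -> e l c = 0.
    by move=> lk c2; apply/eqP; apply: contrapT => /negP ekc; apply: h; exists l, c.
  have cd (a c : 'I_4) : (1 < c)%N -> col_dot e a c = e k a * e k c.
    move=> c2; rewrite /col_dot (bigD1 k)//= big1 ?addr0// => m mk.
    by rewrite (e0 m c mk c2) mulr0.
  move: e2 e3 e4; rewrite !cd ?inordK// => e2 e3 e4.
  have : e k (inord 0) ^+ 2 + e k (inord 1) ^+ 2 = 0.
    rewrite -[LHS]mulr1 -e2.
    transitivity ((e k (inord 0) * e k (inord 2) + e k (inord 1) * e k (inord 3)) ^+ 2 +
      (e k (inord 1) * e k (inord 2) - e k (inord 0) * e k (inord 3)) ^+ 2); first by ring.
    by rewrite e3 e4 subrr expr0n addr0.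
  move/eqP; rewrite paddr_eq0 ?sqr_ge0// !sqrf_eq0 => /andP[k0 k1].
  by move: ca2 eka; elim/forall_ord4: ca; rewrite inordK// ?k0 ?k1.
have cab : b ==> (odd cb == odd ca).
  apply/implyP => bt; have /(planar_supported b eka) supp := epl.
  apply: contraNT elb => ocb; rewrite supp// in_column_class bt /= ocb//.
have [eps2 eps_gt0] := sg_unit eka.
have [del2 del_gt0] := sg_unit elb.
have [phi [chart _ onto]] := @pol_space_chart b k l ca cb _ _ lk ca2 cb2 cab eps2 del2.
have [x xe] := onto e eM eps_gt0 del_gt0.
by exists setT, phi; split; [exact/chart/openT|exists x].
Qed.

(** The charts are defined on the whole of R^k, so the image of 0 is a point of the space. *)
Lemma arm_space_nonempty b : (0 < n)%N -> arm_space b !=set0.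
Proof.
move=> n0; have [phi [_ phiM _]] := @arm_space_chart b (Ordinal n0) ord0 1 (mulr1 1).
by exists (phi 0).
Qed.

Lemma pol_space_nonempty b : (1 < n)%N -> pol_space b !=set0.
Proof.
move=> n1; have n0 := ltnW n1.
have [| | | |phi [_ phiM _]] := @pol_space_chart b (Ordinal n0) (Ordinal n1)
   (inord 0) (inord 2) 1 1 _ _ _ _ (mulr1 1) (mulr1 1); rewrite ?inordK//.
  by rewrite implybT.
by exists (phi 0).
Qed.

Lemma continuous_col_dot (c d : 'I_4) : continuous (fun e => col_dot e c d).
Proof.
apply: continuous_big => [|m _ e]; first exact: add_continuous.
exact: (cvgM (@coord_continuous _ _ _ m c e) (@coord_continuous _ _ _ m d e)).
Qed.

Lemma closed_eq_fun (f g : 'M[R]_(n, 4) -> R) : continuous f -> continuous g ->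
  closed [set e | f e = g e].
Proof.
move=> cf cg; have -> : [set e | f e = g e] = (fun e => f e - g e) @^-1` [set 0].
  apply/seteqP; split => e /=; first by move=> ->; rewrite subrr.
  by move=> /eqP; rewrite subr_eq0 => /eqP.
apply: closed_comp => [e _|]; last exact: closed_eq.
exact: (cvgB (cf e) (cg e)).
Qed.

Lemma closed_planar : closed (@planar R n).
Proof.
have c0 m c : closed [set e : 'M[R]_(n, 4) | e m c = 0].
  by apply: closed_eq_fun; [exact: coord_continuous|exact: cst_continuous].
have -> : @planar R n =
  (\bigcap_m ([set e | e m (inord 1) = 0] `&` [set e | e m (inord 3) = 0])) `|`
  (\bigcap_m ([set e | e m (inord 0) = 0] `&` [set e | e m (inord 2) = 0])).
  apply/seteqP; split => e.
    by move=> [] h; [left|right] => m _ /=; exact: h.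
  by move=> [] h; [left|right] => m; exact: (h m I).
by apply: closedU; apply: closed_bigI => m _; apply: closedI; exact: c0.
Qed.

Lemma closed_stiefel : closed (@stiefel R n).
Proof.
have -> : @stiefel R n =
  [set e | col_dot e (inord 0) (inord 0) + col_dot e (inord 1) (inord 1) = 1] `&`
  [set e | col_dot e (inord 2) (inord 2) + col_dot e (inord 3) (inord 3) = 1] `&`
  [set e | col_dot e (inord 0) (inord 2) + col_dot e (inord 1) (inord 3) = 0] `&`
  [set e | col_dot e (inord 1) (inord 2) = col_dot e (inord 0) (inord 3)].
  by apply/seteqP; split => e; [move=> []|move=> [[[]]]].
have cD a b c d : continuous (fun e => col_dot e a b + col_dot e c d).
  by move=> e; exact: (cvgD (@continuous_col_dot a b e) (@continuous_col_dot c d e)).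
do 3?apply: closedI; apply: closed_eq_fun; do ?[exact: cD|exact: cst_continuous|exact: continuous_col_dot].
Qed.

Lemma compact_arm_space b : compact (arm_space b).
Proof.
apply: compact_sphere_sub; last by move=> e [].
have cl2 : closed [set e : 'M[R]_(n, 4) | eucl_dot e e = 2].
  apply: closed_eq_fun; last exact: cst_continuous.
  under eq_fun do rewrite eucl_dot_col.
  pose cd c := @continuous_col_dot c c.
  by move=> e; exact: (cvgD (cvgD (cvgD (cd _ e) (cd _ e)) (cd _ e)) (cd _ e)).
case: b.
  have -> : arm_space true = [set e | eucl_dot e e = 2] `&` @planar R n.
    by apply/seteqP; split => e [h1 h2]; split => //; exact: h2.
  by apply: closedI => //; exact: closed_planar.
suff -> : arm_space false = [set e | eucl_dot e e = 2] by exact: cl2.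
by apply/seteqP; split => e /=; [case|move=> ?; split].
Qed.

Lemma compact_pol_space b : compact (pol_space b).
Proof.
apply: compact_sphere_sub; last by move=> e [/stiefel_eucl_dot].
case: b.
  have -> : pol_space true = @stiefel R n `&` @planar R n.
    by apply/seteqP; split => e [h1 h2]; split => //; exact: h2.
  by apply: closedI; [exact: closed_stiefel|exact: closed_planar].
suff -> : pol_space false = @stiefel R n by exact: closed_stiefel.
by apply/seteqP; split => e /=; [case|move=> ?; split].
Qed.

Lemma model_Arm3_space : @model_Arm3 R n = arm_space false.
Proof.
apply/seteqP; split => e; first by move=> /model_Arm3E.
by move=> [? _]; apply/model_Arm3E.
Qed.

Lemma model_Arm2_space : @model_Arm2 R n = arm_space true.
Proof.
apply/seteqP; split => e; first by move=> /model_Arm2E[].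
by move=> [? pl]; apply/model_Arm2E; split => //; exact: pl.
Qed.

Lemma model_Pol3_space : @model_Pol3 R n = pol_space false.
Proof.
apply/seteqP; split => e; first by move=> /model_Pol3E.
by move=> [? _]; apply/model_Pol3E.
Qed.

Lemma model_Pol2_space : @model_Pol2 R n = pol_space true.
Proof.
apply/seteqP; split => e; first by move=> /model_Pol2E[].
by move=> [? pl]; apply/model_Pol2E; split => //; exact: pl.
Qed.

End model_spaces.

(** * Expectation with respect to the normalized volume *)

Section expectation.
Context {R : realType} {p q : nat}.
Implicit Types (M : set 'M[R]_(p, q)) (f g : 'M[R]_(p, q) -> R).

Definition preserves_isometries M (E : ('M[R]_(p, q) -> R) -> R) : Prop :=
  forall T T' : {linear 'M[R]_(p, q) -> 'M[R]_(p, q)},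
  cancel T T' -> cancel T' T ->
  (forall A B, eucl_dot (T' A) (T' B) = eucl_dot A B) ->
  (forall x, M x -> M (T x)) -> (forall x, M x -> M (T' x)) ->
  forall f, continuous f -> E (f \o T) = E f.

(** All that the moment computation asks of the measure. Continuous functions are integrable here
    because [M] is compact, and the third clause allows the equations of [M] under the
    expectation. *)
Definition is_expectation M (E : ('M[R]_(p, q) -> R) -> R) : Prop :=
  [/\ forall c f g, continuous f -> continuous g ->
        E (fun x => c * f x + g x) = c * E f + E g,
      E (fun=> 1) = 1,
      forall f g, (forall x, M x -> f x = g x) -> E f = E g
    & preserves_isometries M E].

Lemma continuous_measurable_mxR f : continuous f ->
  measurable_fun setT (f : borel_mx R p q -> R).
Proof.
move=> cf; apply: (measurability _ (RGenOpens.measurableE R)).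
move=> _ [_ [a [b ->]] <-]; rewrite setTI.
apply: measurable_open_mx; apply: open_comp => [x _|]; first exact: cf.
exact: interval_open.
Qed.

Variables (k : nat) (M : set 'M[R]_(p, q)).
Variable mu : {measure set (borel_mx R p q) -> \bar R}.
Hypotheses (cM : compact M) (M0 : M !=set0) (muM : riemannian_volume k M mu).
Hypothesis atlas : forall x, M x ->
  exists U (phi : 'rV[R]_k -> _), local_parametrization M U phi /\ (phi @` U) x.

Let P : probability (borel_mx R p q) R := mnormalize mu (dirac (0 : borel_mx R p q)).

Let mM : measurable (M : set (borel_mx R p q)).
Proof.
by apply: measurable_closed_mx; apply: compact_closed => //; exact: norm_hausdorff.
Qed.

(** The total mass is positive and finite, so the normalization never falls back on the Dirac
    mass. *)
Let PE B : P B = (mu B * (fine (mu setT))^-1%:E)%E.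
Proof.
rewrite /P /= /mnormalize ifF//; apply/negbTE; rewrite negb_or.
rewrite gt_eqF ?(riemannian_volume_gt0 cM muM atlas M0)//=.
by rewrite lt_eqF// (riemannian_volume_fin cM muM atlas).
Qed.

Let PMC : P (~` M) = 0%E.
Proof. by rewrite PE; have [-> _] := muM; rewrite mul0e. Qed.

Let PM : P M = 1%E.
Proof.
have := probability_setT P; rewrite -(setvU M) measureU ?setICl//; last exact: measurableC.
by rewrite [X in (X + _)%E]PMC add0e.
Qed.

Let Efun f := Rintegral P (M : set (borel_mx R p q)) f.

Let integrable_continuous f : continuous f ->
  P.-integrable (M : set (borel_mx R p q)) (EFin \o f).
Proof.
move=> cf; apply: measurable_bounded_integrable => //.
- by rewrite [ltLHS]PM ltry.
- by apply: measurable_funTS; exact: continuous_measurable_mxR.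
have : compact (f @` M) by apply: continuous_compact => //; exact: continuous_subspaceT.
move=> /compact_bounded[c [cr cP]]; exists c; split => // x cx e Me.
by apply: cP => //; exists e.
Qed.

Let Efun_expectation : is_expectation M Efun.
Proof.
split.
- move=> c f g cf cg; rewrite /Efun RintegralD//; last 2 first.
  + apply: (@integrable_continuous (fun x => c * f x)) => x.
    exact: (cvgM (cvg_cst c) (cf x)).
  + exact: integrable_continuous.
  by rewrite RintegralZl//; exact: integrable_continuous.
- by rewrite /Efun Rintegral_cst// [X in fine X]PM mul1r.
- by move=> f g fg; apply: eq_Rintegral => x; rewrite inE => /fg.
move=> T T' TK T'K T'iso MT MT' f cf; rewrite /Efun /Rintegral; congr fine.
have cT : continuous T by exact: linear_mx_continuous.
have mT : measurable_fun setT (T : borel_mx R p q -> borel_mx R p q).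
  exact: continuous_measurable_mx.
have TM : T @^-1` M = M.
  apply/seteqP; split => x; last exact: MT.
  by move=> /MT'; rewrite TK.
pose Tm : {mfun (borel_mx R p q) >-> (borel_mx R p q)} :=
  HB.pack (T : borel_mx R p q -> borel_mx R p q) (isMeasurableFun.Build _ _ _ _ _ mT).
have PT : (\int[pushforward P Tm]_(x in M) (f x)%:E = \int[P]_(x in M) (f x)%:E)%E.
  apply: eq_measure_integral => B mB _.
  rewrite /pushforward; apply: (etrans (PE _)); apply: esym; apply: (etrans (PE _)).
  congr (_ * _)%E; apply/esym.
  exact: (riemannian_volume_isometry cM muM atlas TK T'K T'iso MT MT').
rewrite -PT; apply: esym.
have mf : measurable_fun [set: borel_mx R p q] (EFin \o (f : borel_mx R p q -> R)).
  by apply/measurable_EFinP; exact: continuous_measurable_mxR.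
have fT : continuous (f \o T).
  by move=> x; apply: (@continuous_comp _ _ _ T f); [exact: cT|exact: cf].
have intf : P.-integrable (T @^-1` M : set (borel_mx R p q)) ((EFin \o f) \o T).
  by rewrite TM; exact: (integrable_continuous fT).
by have := integral_pushforward mT mf intf mM; rewrite TM.
Qed.

(** The bridge from the integral over a polygon space to [E]. Nonnegativity of [g] permits the
    change of variables before integrability is known; finiteness then comes from continuity on the
    compact [M]. *)
Lemma mnormalize_expectation : exists2 E, is_expectation M E &
  forall (r s : nat) (H : {mfun (borel_mx R p q) >-> (borel_mx R r s)})
    (A : set (borel_mx R r s)) (g : 'M[R]_(r, s) -> R),
  measurable A -> M `<=` H @^-1` A -> continuous (H : 'M[R]_(p, q) -> 'M[R]_(r, s)) ->
  continuous g -> (forall e, 0 <= g e) ->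
  (\int[distribution P H]_(e in A) (g e)%:E = (E (g \o H))%:E)%E.
Proof.
exists Efun; first exact: Efun_expectation.
move=> r s H A g mA MA cH cg g0.
have mg : measurable_fun setT (g : borel_mx R r s -> R).
  apply: (measurability _ (RGenOpens.measurableE R)).
  move=> _ [_ [a [b ->]] <-]; rewrite setTI.
  apply: measurable_open_mx; apply: open_comp => [x _|]; first exact: cg.
  exact: interval_open.
have mgH : measurable_fun setT ((g : borel_mx R r s -> R) \o H).
  by apply: measurableT_comp => //.
rewrite /distribution ge0_integral_pushforward//; last 2 first.
- by apply: measurable_funTS; exact/measurable_EFinP.
- by move=> y _; rewrite lee_fin.
have mHA : measurable (H @^-1` A) by rewrite -[X in measurable X]setTI; exact: measurable_funP.
have mNM : measurable (~` M : set (borel_mx R p q)) by exact: measurableC.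
have mfg : measurable_fun (H @^-1` A) (EFin \o ((g : borel_mx R r s -> R) \o H)).
  by apply: measurable_funTS; exact/measurable_EFinP.
have gH0 x : (H @^-1` A) x -> (0 <= (EFin \o ((g : borel_mx R r s -> R) \o H)) x)%E.
  by move=> _; have := g0 (H x); rewrite -lee_fin.
(* The preimage of [A] contains [M], and the rest of it is null, so the domain of integration
   shrinks to [M]. *)
have := ge0_negligible_integral mNM mHA mfg gH0 PMC.
rewrite setDE setCK (_ : H @^-1` A `&` M = M); last exact/setIidr.
move=> E1; apply: (etrans E1).
rewrite /Efun /Rintegral fineK//.
apply: integrable_fin_num => //.
apply: (@integrable_continuous (g \o H)) => x.
by apply: (@continuous_comp _ _ _ H g); [exact: cH|exact: cg].
Qed.

End expectation.

(** * Symmetries acting on rows and fourth moments *)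

Section row_symmetries.
Context {R : realType} {n : nat}.
Implicit Types q : 'M[R]_(n, 4).

Definition row_dot q (l m : 'I_n) : R := \sum_c q l c * q m c.

Definition row_map (g : ('I_4 -> R) -> 'I_4 -> R) (l : 'I_n) q : 'M[R]_(n, 4) :=
  \matrix_(i, c) (if i == l then g (q l) c else q i c).

(** With the next two definitions, the left multiplications by the quaternions i, j and k in
    coordinates. *)
Definition unit_i (v : 'I_4 -> R) (c : 'I_4) : R :=
  nth 0 [:: - v (inord 1); v (inord 0); - v (inord 3); v (inord 2)] c.
Definition unit_j (v : 'I_4 -> R) (c : 'I_4) : R :=
  nth 0 [:: - v (inord 2); v (inord 3); v (inord 0); - v (inord 1)] c.
Definition unit_k (v : 'I_4 -> R) (c : 'I_4) : R :=
  nth 0 [:: - v (inord 3); - v (inord 2); v (inord 1); v (inord 0)] c.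

Definition row_flip (l : 'I_n) : 'M[R]_(n, 4) -> 'M[R]_(n, 4) :=
  row_map (fun v c => - v c) l.

(** A 45 degree rotation of the two rows followed by a change of sign in row [m], which makes the
    map its own inverse. *)
Definition row_rotate (l m : 'I_n) q : 'M[R]_(n, 4) :=
  \matrix_(i, c) (if i == l then (Num.sqrt 2)^-1 * (q l c + q m c)
                  else if i == m then (Num.sqrt 2)^-1 * (q l c - q m c) else q i c).

Definition row_swap (l m : 'I_n) q : 'M[R]_(n, 4) :=
  \matrix_(i, c) q (tperm l m i) c.

(** Being determined by the Gram matrix of the columns amounts to invariance under orthogonal mixing
    of the rows; flips, swaps and rotations of rows then preserve [M] at once. *)
Definition saturated (M : set 'M[R]_(n, 4)) : Prop := forall q q',
  (forall c d, col_dot q' c d = col_dot q c d) -> M q -> M q'.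

Lemma col_dot_eq0 q c : col_dot q c c = 0 <-> forall m, q m c = 0.
Proof.
split=> [|q0]; last by rewrite /col_dot big1// => m _; rewrite q0 mul0r.
move=> /eqP; rewrite psumr_eq0 => [/allP h m|m _]; last by rewrite -expr2 sqr_ge0.
by have := h m (mem_index_enum _); rewrite -expr2 sqrf_eq0 => /eqP.
Qed.

Lemma planar_col_dot q : planar q <->
  (col_dot q (inord 1) (inord 1) = 0 /\ col_dot q (inord 3) (inord 3) = 0) \/
  (col_dot q (inord 0) (inord 0) = 0 /\ col_dot q (inord 2) (inord 2) = 0).
Proof.
rewrite !col_dot_eq0; split.
  by move=> [] h; [left|right]; split => m; have [] := h m.
by move=> [] [h h']; [left|right].
Qed.

Lemma saturated_arm_space b : saturated (arm_space b).
Proof.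
move=> q q' qq' [q2 pl]; split; first by rewrite eucl_dot_col !qq' -eucl_dot_col.
by move=> /pl; rewrite !planar_col_dot !qq'.
Qed.

Lemma saturated_pol_space b : saturated (pol_space b).
Proof.
move=> q q' qq' [[q1 q2 q3 q4] pl]; split; first by split; rewrite !qq'.
by move=> /pl; rewrite !planar_col_dot !qq'.
Qed.

Lemma eucl_dot_polar p r (A B : 'M[R]_(p, r)) :
  eucl_dot A B = (eucl_dot (A + B) (A + B) - eucl_dot A A - eucl_dot B B) / 2.
Proof.
rewrite eucl_dotDl [eucl_dot A (A + B)]eucl_dotC [eucl_dot B (A + B)]eucl_dotC.
by rewrite !eucl_dotDl [eucl_dot B A]eucl_dotC; field.
Qed.

Lemma linear_isometry p r (T : 'M[R]_(p, r) -> 'M[R]_(p, r)) : linear T ->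
  (forall A, eucl_dot (T A) (T A) = eucl_dot A A) ->
  forall A B, eucl_dot (T A) (T B) = eucl_dot A B.
Proof.
move=> linT isoT A B; rewrite eucl_dot_polar [RHS]eucl_dot_polar !isoT.
by have := linT 1 A B; rewrite !scale1r => <-; rewrite isoT.
Qed.

Variables (M : set 'M[R]_(n, 4)) (E : ('M[R]_(n, 4) -> R) -> R).
Hypothesis ME : is_expectation M E.

Lemma expectation_linear_iso (T T' : 'M[R]_(n, 4) -> 'M[R]_(n, 4)) :
  linear T -> linear T' -> cancel T T' -> cancel T' T ->
  (forall A, eucl_dot (T' A) (T' A) = eucl_dot A A) ->
  (forall x, M x -> M (T x)) -> (forall x, M x -> M (T' x)) ->
  forall f, continuous f -> E (f \o T) = E f.
Proof.
move=> linT linT' TK T'K iso MT MT' f cf; have [_ _ _ inv] := ME.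
pose aT := GRing.isLinear.Build _ _ _ _ _ linT.
pose aT' := GRing.isLinear.Build _ _ _ _ _ linT'.
pose lT : {linear 'M[R]_(n, 4) -> 'M[R]_(n, 4)} := HB.pack T aT.
pose lT' : {linear 'M[R]_(n, 4) -> 'M[R]_(n, 4)} := HB.pack T' aT'.
apply: (inv lT lT') => //; exact: (linear_isometry linT').
Qed.

Lemma expectation_involution (T : 'M[R]_(n, 4) -> 'M[R]_(n, 4)) : saturated M ->
  linear T -> involutive T -> (forall q c d, col_dot (T q) c d = col_dot q c d) ->
  forall f, continuous f -> E (f \o T) = E f.
Proof.
move=> satM linT TK Tcol; apply: (expectation_linear_iso linT linT TK TK).
- by move=> A; rewrite !eucl_dot_col !Tcol.
- by move=> x; apply: satM.
- by move=> x; apply: satM.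
Qed.

Lemma row_map_linear g l : (forall a u v c, g (fun d => a * u d + v d) c = a * g u c + g v c) ->
  linear (row_map g l).
Proof.
move=> lin_g a u v; apply/matrixP => i c; rewrite !mxE; case: eqP => // _.
rewrite -lin_g; congr (g _ c); apply/funext => d; by rewrite !mxE.
Qed.

Lemma expectation_flip l f : saturated M -> continuous f -> E (f \o row_flip l) = E f.
Proof.
move=> satM; apply: expectation_involution => //.
- by apply: row_map_linear => a u v c; ring.
- move=> q; apply/matrixP => i c; rewrite !mxE eqxx.
  by case: eqP => // ->; rewrite opprK.
- move=> q c d; apply: eq_bigr => i _; rewrite !mxE.
  by case: eqP => // ->; rewrite mulrNN.
Qed.

Lemma expectation_swap l m f : saturated M -> continuous f -> E (f \o row_swap l m) = E f.
Proof.
move=> satM; apply: expectation_involution => //.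
- by move=> a u v; apply/matrixP => i c; rewrite !mxE.
- by move=> q; apply/matrixP => i c; rewrite !mxE tpermK.
- move=> q c d; rewrite /col_dot [RHS](reindex_inj (@perm_inj _ (tperm l m))).
  by apply: eq_bigr => i _; rewrite !mxE.
Qed.

Lemma sqrt2V : (Num.sqrt 2)^-1 * (Num.sqrt 2)^-1 = 2^-1 :> R.
Proof. by rewrite -invfM -expr2 sqr_sqrtr. Qed.

Lemma expectation_rotate l m f : l != m -> saturated M -> continuous f ->
  E (f \o row_rotate l m) = E f.
Proof.
move=> lm satM; have ml : m != l by rewrite eq_sym.
have s2 := sqrt2V; set s := (Num.sqrt 2)^-1 in s2.
apply: expectation_involution => //.
- move=> a u v; apply/matrixP => i c; rewrite !mxE -/s.
  by case: eqP => // _; [ring|case: eqP => // _; ring].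
- move=> q; apply/matrixP => i c; rewrite !mxE -/s !eqxx (negbTE ml).
  case: eqP => [->|_].
    by rewrite -mulrDr mulrA s2; field.
  by case: eqP => [->|//]; rewrite -mulrBr mulrA s2; field.
- move=> q c d; rewrite /col_dot (bigD1 l)//= [RHS](bigD1 l)//=.
  rewrite (bigD1 m)//= [in RHS](bigD1 m)//= !mxE -/s !eqxx (negbTE ml) !addrA.
  congr (_ + _); last first.
    by apply: eq_bigr => i /andP[il im]; rewrite !mxE (negbTE il) (negbTE im).
  transitivity (s * s * ((q l c + q m c) * (q l d + q m d) + (q l c - q m c) * (q l d - q m d))).
    by ring.
  by rewrite s2; field.
Qed.

(** As [g] squares to -1, the inverse of its action on row [l] is the same action followed by a flip
    of that row, and saturation covers the flip. *)
Lemma expectation_unit g l f :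
  (forall a u v c, g (fun d => a * u d + v d) c = a * g u c + g v c) ->
  (forall u c, g (g u) c = - u c) ->
  (forall u, \sum_c g u c * g u c = \sum_c u c * u c) ->
  saturated M -> (forall q, M q -> M (row_map g l q)) -> continuous f ->
  E (f \o row_map g l) = E f.
Proof.
move=> lin_g gg gnorm satM Mg.
have linT := row_map_linear l lin_g.
pose g' (u : 'I_4 -> R) c := g (fun d => - u d) c.
have gN u c : g (fun d => - u d) c = - g u c.
  have g0 : g (fun=> 0) c = 0.
    by rewrite -[LHS](addrK (g (fun=> 0) c)) -{3}[g (fun=> 0) c]mul1r;
      have := lin_g 1 (fun=> 0) (fun=> 0) c; rewrite (_ : (fun _ => 1 * 0 + 0) = (fun=> 0));
      [lra|by apply/funext => ?; rewrite mulr0 addr0].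
  have := lin_g (-1) u (fun=> 0) c; rewrite g0 addr0 mulN1r => <-.
  by congr (g _ c); apply/funext => d; rewrite mulN1r addr0.
have g'E : row_map g' l = row_flip l \o row_map g l.
  apply/funext => q; apply/matrixP => i c; rewrite /= !mxE.
  by have [_|_] := eqVneq i l; rewrite ?eqxx /g' ?gN.
have linT' : linear (row_map g' l).
  apply: row_map_linear => a u v c; rewrite /g' !gN lin_g; ring.
apply: (expectation_linear_iso linT linT').
- move=> q; apply/matrixP => i c; rewrite mxE /g' gN.
  case: eqP => [->|/eqP/negbTE il]; last by rewrite mxE il.
  rewrite (_ : row_map g l q l = g (q l)) ?gg ?opprK//.
  by apply/funext => d; rewrite mxE eqxx.
- move=> q; apply/matrixP => i c; rewrite mxE.
  case: eqP => [->|/eqP/negbTE il]; last by rewrite mxE il.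
  rewrite (_ : row_map g' l q l = (fun d => - g (q l) d)) ?gN ?gg ?opprK//.
  by apply/funext => d; rewrite mxE eqxx /g' gN.
- move=> A; rewrite /eucl_dot; apply: eq_bigr => i _.
  have [->|il] := eqVneq i l.
    rewrite -[RHS]gnorm; apply: eq_bigr => c _; rewrite mxE eqxx /g' gN mulrNN//.
  by apply: eq_bigr => c _; rewrite mxE (negbTE il).
- exact: Mg.
- move=> q /Mg Mq; rewrite g'E; apply: satM Mq => c d.
  apply: eq_bigr => i _; rewrite !mxE eqxx.
  by have [_|_] := eqVneq i l; rewrite ?mulrNN.
Qed.

End row_symmetries.

Section continuous_functions.
Context {R : realType} {p r : nat}.
Implicit Types f g : 'M[R]_(p, r) -> R.

Lemma continuous_funD f g : continuous f -> continuous g -> continuous (fun q => f q + g q).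
Proof. by move=> cf cg x; exact: (cvgD (cf x) (cg x)). Qed.

Lemma continuous_funM f g : continuous f -> continuous g -> continuous (fun q => f q * g q).
Proof. by move=> cf cg x; exact: (cvgM (cf x) (cg x)). Qed.

Lemma continuous_funZ (c : R) f : continuous f -> continuous (fun q => c * f q).
Proof. by apply: continuous_funM; exact: cst_continuous. Qed.

Lemma continuous_fun_sum (I : finType) (F : I -> 'M[R]_(p, r) -> R) :
  (forall i, continuous (F i)) -> continuous (fun q => \sum_i F i q).
Proof. by move=> cF; apply: continuous_big => [|i _]; [exact: add_continuous|exact: cF]. Qed.

End continuous_functions.

(** * Fourth moments of the rows and scalar products of the edges *)

Section moments.
Context {R : realType} {n : nat}.
Implicit Types q : 'M[R]_(n, 4).
Implicit Types f g : 'M[R]_(n, 4) -> R.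

Lemma continuous_row_dot l m : continuous (fun q => row_dot q l m).
Proof.
by apply: continuous_fun_sum => c; apply: continuous_funM; exact: coord_continuous.
Qed.

Definition hopf_dot q (l m : 'I_n) : R := \sum_c hopf3 q l c * hopf3 q m c.

Lemma continuous_hopf3 : continuous (@hopf3 R n).
Proof.
apply: continuous_mx => m c.
have -> : (fun q => hopf3 q m c) =
    (fun q : 'M[R]_(n, 4) => qcoord (hopf (row m q)) (nth 0 [:: 1; 2; 3] c)%N).
  by apply/funext => q; rewrite mxE.
by apply: continuous_hopf; case: c => [[|[|[|]]]].
Qed.

Lemma continuous_hopf2 : continuous (@hopf2 R n).
Proof.
apply: continuous_mx => m c.
have -> : (fun q => hopf2 q m c) =
    (fun q : 'M[R]_(n, 4) => qcoord (hopf (row m q)) (nth 0 [:: 1; 3] c)%N).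
  by apply/funext => q; rewrite mxE.
by apply: continuous_hopf; case: c => [[|[|]]].
Qed.

Lemma continuous_hopf_dot l m : continuous (fun q => hopf_dot q l m).
Proof.
apply: continuous_fun_sum => c.
have ch i : continuous (fun q : 'M[R]_(n, 4) => hopf3 q i c).
  move=> q; apply: (@continuous_comp _ _ _ (@hopf3 R n) (fun e : 'M[R]_(n, 3) => e i c)).
    exact: continuous_hopf3.
  exact: coord_continuous.
by apply: continuous_funM; exact: ch.
Qed.

Definition hopf_coord (v : 'I_4 -> R) (c : nat) : R := nth 0
  [:: v (inord 0) ^+ 2 + v (inord 1) ^+ 2 - v (inord 2) ^+ 2 - v (inord 3) ^+ 2;
      2 * (v (inord 1) * v (inord 2) - v (inord 0) * v (inord 3));
      2 * (v (inord 0) * v (inord 2) + v (inord 1) * v (inord 3))] c.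

Lemma hopf3E q m c : hopf3 q m c = hopf_coord (q m) c.
Proof.
rewrite mxE hopfE /hopf_coord /qcoord !mxE.
by case: c => [[|[|[|]]]]//= _; rewrite inordK.
Qed.

Lemma hopf_dotE q l m : hopf_dot q l m =
  hopf_coord (q l) 0 * hopf_coord (q m) 0 + hopf_coord (q l) 1 * hopf_coord (q m) 1 +
  hopf_coord (q l) 2 * hopf_coord (q m) 2.
Proof. by rewrite /hopf_dot !big_ord_recl big_ord0 addr0 !hopf3E addrA. Qed.

Lemma hopf_dot_diag q m : hopf_dot q m m = row_dot q m m * row_dot q m m.
Proof. by rewrite hopf_dotE /hopf_coord /row_dot sum_ord4 /=; ring. Qed.

Lemma hopf_dot_unit_j q l m : l != m ->
  hopf_dot (row_map (@unit_j R) l q) l m = - hopf_dot q l m.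
Proof.
move=> lm; have ml : m != l by rewrite eq_sym.
have El c : row_map (@unit_j R) l q l c = unit_j (q l) c by rewrite mxE eqxx.
have Em c : row_map (@unit_j R) l q m c = q m c by rewrite mxE (negbTE ml).
by rewrite !hopf_dotE /hopf_coord /= !El !Em /unit_j !inordK//=; ring.
Qed.

(** The three coordinates of the sum of the edges are |a|^2 - |b|^2 and twice the imaginary and real
    parts of <a, b>. *)
Lemma stiefel_hopf_closed q c : stiefel q -> \sum_m hopf3 q m c = 0.
Proof.
move=> [q1 q2 q3 q4]; under eq_bigr do rewrite hopf3E.
case: c => [[|[|[|//]]]] /= _; rewrite /hopf_coord /=.
- under eq_bigr do rewrite !expr2.
  rewrite !big_split /= !sumrN -/(col_dot q _ _).
  have := etrans q1 (esym q2); rewrite /col_dot; lra.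
- rewrite -mulr_sumr sumrB -!/(col_dot q _ _); apply/eqP.
  by rewrite mulf_eq0 subr_eq0 [X in _ || X](introT eqP q4) orbT.
- by rewrite -mulr_sumr big_split /= -!/(col_dot q _ _) q3 mulr0.
Qed.

Lemma stiefel_hopf_dot_sum q l : stiefel q -> \sum_m hopf_dot q l m = 0.
Proof.
move=> st; rewrite /hopf_dot exchange_big big1//= => c _.
by rewrite -mulr_sumr stiefel_hopf_closed// mulr0.
Qed.

(** An orthogonal complex structure on R^4, with continuity in the form needed under [E]. *)
Definition unit_like (u : ('I_4 -> R) -> 'I_4 -> R) : Prop :=
  [/\ forall c x y i, u (fun d => c * x d + y d) i = c * u x i + u y i,
      forall x i, u (u x) i = - x i,
      forall x, \sum_i u x i * u x i = \sum_i x i * x i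
    & forall l i, continuous (fun q : 'M[R]_(n, 4) => u (q l) i)].

Let ord4K := (@inordK 3 0 isT, @inordK 3 1 isT, @inordK 3 2 isT, @inordK 3 3 isT).

Let continuous_coord l (c : 'I_4) : continuous (fun q : 'M[R]_(n, 4) => q l c).
Proof. exact: coord_continuous. Qed.

Let continuous_coordN l (c : 'I_4) : continuous (fun q : 'M[R]_(n, 4) => - q l c).
Proof. by move=> q; exact: (cvgN (@coord_continuous _ _ _ l c q)). Qed.

Lemma unit_i_like : unit_like (@unit_i R).
Proof.
rewrite /unit_i; split.
- by move=> c x y i; elim/forall_ord4: i; rewrite !ord4K /=; ring.
- by move=> x i; elim/forall_ord4: i; rewrite !ord4K /=; ring.
- by move=> x; rewrite !sum_ord4 !ord4K /=; ring.
- by move=> l i; elim/forall_ord4: i; rewrite !ord4K /=;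
    do ?[exact: continuous_coord|exact: continuous_coordN].
Qed.

Lemma unit_j_like : unit_like (@unit_j R).
Proof.
rewrite /unit_j; split.
- by move=> c x y i; elim/forall_ord4: i; rewrite !ord4K /=; ring.
- by move=> x i; elim/forall_ord4: i; rewrite !ord4K /=; ring.
- by move=> x; rewrite !sum_ord4 !ord4K /=; ring.
- by move=> l i; elim/forall_ord4: i; rewrite !ord4K /=;
    do ?[exact: continuous_coord|exact: continuous_coordN].
Qed.

Lemma unit_k_like : unit_like (@unit_k R).
Proof.
rewrite /unit_k; split.
- by move=> c x y i; elim/forall_ord4: i; rewrite !ord4K /=; ring.
- by move=> x i; elim/forall_ord4: i; rewrite !ord4K /=; ring.
- by move=> x; rewrite !sum_ord4 !ord4K /=; ring.
- by move=> l i; elim/forall_ord4: i; rewrite !ord4K /=;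
    do ?[exact: continuous_coord|exact: continuous_coordN].
Qed.

(** For a quaternion unit [u] this is the real part of u q_l conj(q_m), that is, up to sign, one
    coordinate of q_l conj(q_m). *)
Definition unit_dot (u : ('I_4 -> R) -> 'I_4 -> R) q l m := \sum_c u (q l) c * q m c.

(** The summand is the squared modulus of an entry of a a^* + b b^*, the orthogonal projection onto
    the complex plane spanned by a and b. Its squared Frobenius norm is its rank, 2. *)
Lemma stiefel_dot_sum q : stiefel q ->
  \sum_l \sum_m (row_dot q l m * row_dot q l m +
    unit_dot (@unit_i R) q l m * unit_dot (@unit_i R) q l m) = 2.
Proof.
move=> [q1 q2 q3 q4].
pose fa l := q l (inord 0) * q l (inord 0) + q l (inord 1) * q l (inord 1).
pose fb l := q l (inord 2) * q l (inord 2) + q l (inord 3) * q l (inord 3).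
pose fP l := q l (inord 0) * q l (inord 2) + q l (inord 1) * q l (inord 3).
pose fQ l := q l (inord 1) * q l (inord 2) - q l (inord 0) * q l (inord 3).
have sq (f : 'I_n -> R) : \sum_l \sum_m f l * f m = (\sum_l f l) * (\sum_l f l).
  by rewrite big_distrlr.
have sa : \sum_l fa l = 1 by rewrite /fa big_split.
have sb : \sum_l fb l = 1 by rewrite /fb big_split.
have sP : \sum_l fP l = 0 by rewrite /fP big_split.
have sQ : \sum_l fQ l = 0.
  by rewrite /fQ sumrB; apply/eqP; rewrite subr_eq0; apply/eqP.
transitivity (\sum_l \sum_m (fa l * fa m + fb l * fb m + 2 * (fP l * fP m) + 2 * (fQ l * fQ m))).
  apply: eq_bigr => l _; apply: eq_bigr => m _.
  by rewrite /row_dot /unit_dot /unit_i !sum_ord4 !ord4K /= /fa /fb /fP /fQ; ring.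
transitivity (\sum_l \sum_m fa l * fa m + \sum_l \sum_m fb l * fb m +
    2 * (\sum_l \sum_m fP l * fP m) + 2 * (\sum_l \sum_m fQ l * fQ m)).
  rewrite !mulr_sumr -!big_split; apply: eq_bigr => l _ /=.
  by rewrite !mulr_sumr -!big_split.
by rewrite !sq sa sb sP sQ; ring.
Qed.

(** Multiplication by i exchanges the orthogonal planes R + jR and iR + kR. *)
Lemma planar_unit_i q l m : planar q -> unit_dot (@unit_i R) q l m = 0.
Proof.
rewrite /unit_dot /unit_i sum_ord4 !ord4K /=.
move=> [] pl; have [l1 l2] := pl l; have [m1 m2] := pl m; rewrite l1 l2 m1 m2; ring.
Qed.

Lemma planar_dot_mul q l m : planar q ->
  row_dot q l m * row_dot q l m + unit_dot (@unit_j R) q l m * unit_dot (@unit_j R) q l m =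
  row_dot q l l * row_dot q m m.
Proof.
rewrite /row_dot /unit_dot /unit_j !sum_ord4 !ord4K /=.
move=> [] pl; have [l1 l2] := pl l; have [m1 m2] := pl m; rewrite l1 l2 m1 m2; ring.
Qed.

(** Multiplicativity of the quaternion norm, applied to q_l conj(q_m); the planar version has only
    the terms 1 and j. *)
Lemma quaternion_dot_mul q l m :
  row_dot q l m * row_dot q l m +
  (unit_dot (@unit_i R) q l m * unit_dot (@unit_i R) q l m +
  (unit_dot (@unit_j R) q l m * unit_dot (@unit_j R) q l m +
  unit_dot (@unit_k R) q l m * unit_dot (@unit_k R) q l m)) =
  row_dot q l l * row_dot q m m.
Proof. by rewrite /row_dot /unit_dot /unit_i /unit_j /unit_k !sum_ord4 !ord4K /=; ring. Qed.

Lemma unit_dot_map u q l m : l != m -> row_dot (row_map u l q) l m = unit_dot u q l m.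
Proof.
by rewrite eq_sym => /negbTE ml; apply: eq_bigr => c _; rewrite !mxE eqxx ml.
Qed.

Lemma continuous_unit_dot u l m : unit_like u -> continuous (fun q => unit_dot u q l m).
Proof.
move=> [_ _ _ cu]; apply: continuous_fun_sum => c.
by apply: continuous_funM; [exact: cu|exact: continuous_coord].
Qed.

Variables (M : set 'M[R]_(n, 4)) (E : ('M[R]_(n, 4) -> R) -> R).
Hypotheses (ME : is_expectation M E) (satM : saturated M).
Hypothesis M2 : forall q, M q -> eucl_dot q q = 2.

Lemma expectation_ext f g : (forall q, M q -> f q = g q) -> E f = E g.
Proof. by have [_ _ h _] := ME; exact: h. Qed.

Lemma expectation_eq f g : f =1 g -> E f = E g.
Proof. by move=> fg; apply: expectation_ext => q _. Qed.

Lemma expectationD f g : continuous f -> continuous g ->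
  E (fun q => f q + g q) = E f + E g.
Proof.
move=> cf cg; have [h _ _ _] := ME; rewrite -[E f]mul1r -h//.
by apply: expectation_eq => q; rewrite mul1r.
Qed.

Lemma expectation0 : E (fun=> 0) = 0.
Proof.
have [h _ _ _] := ME; have c0 : continuous (fun _ : 'M[R]_(n, 4) => 0 : R).
  exact: cst_continuous.
apply: etrans (etrans (h (-1) _ _ c0 c0) _); last by rewrite mulN1r addNr.
by apply: expectation_eq => q; rewrite mulr0 addr0.
Qed.

Lemma expectationZ c f : continuous f -> E (fun q => c * f q) = c * E f.
Proof.
move=> cf; have [h _ _ _] := ME; have c0 : continuous (fun _ : 'M[R]_(n, 4) => 0 : R) by exact: cst_continuous.
rewrite -[RHS]addr0 -expectation0 -(h c _ _ cf c0).
by apply: expectation_eq => q; rewrite addr0.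
Qed.

Lemma expectation_cst c : E (fun=> c) = c.
Proof.
have [_ h1 _ _] := ME; rewrite -[RHS]mulr1 -h1 -expectationZ; last exact: cst_continuous.
by apply: expectation_eq => q; rewrite mulr1.
Qed.

Lemma expectation_sum (I : finType) (F : I -> 'M[R]_(n, 4) -> R) :
  (forall i, continuous (F i)) -> E (fun q => \sum_i F i q) = \sum_i E (F i).
Proof.
move=> cF; elim: (index_enum I) => [|i r IH].
  by rewrite big_nil -[RHS]expectation0; apply: expectation_eq => q; rewrite big_nil.
rewrite big_cons -IH -expectationD//; last first.
  by apply: continuous_big => [|j _]; [exact: add_continuous|exact: cF].
by apply: expectation_eq => q; rewrite big_cons.
Qed.

Let Amom m := E (fun q => row_dot q m m * row_dot q m m).
Let Bmom l m := E (fun q => row_dot q l l * row_dot q m m).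
Let Smom l m := E (fun q => row_dot q l m * row_dot q l m).

Let cdd l m i j : continuous (fun q => row_dot q l m * row_dot q i j).
Proof. by apply: continuous_funM; exact: continuous_row_dot. Qed.

Lemma row_moment_exchange l m : E (fun q => row_dot q l l * row_dot q l l) =
  E (fun q => row_dot q m m * row_dot q m m).
Proof.
rewrite -(expectation_swap ME l m satM (@cdd m m m m)).
apply: expectation_eq => q; rewrite /= /row_dot.
by congr (_ * _); apply: eq_bigr => c _; rewrite !mxE tpermR.
Qed.

Let Bmom_rotate l m : l != m -> Amom l = Bmom l m + 2 * Smom l m.
Proof.
move=> lm; have ml : m != l by rewrite eq_sym.
pose L q := row_dot q l l; pose N q := row_dot q m m; pose I q := row_dot q l m.
have cL : continuous L by exact: continuous_row_dot.
have cN : continuous N by exact: continuous_row_dot.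
have cI : continuous I by exact: continuous_row_dot.
have cILN : continuous (fun q => I q * (L q + N q)).
  by apply: continuous_funM => //; exact: continuous_funD.
(* The cross term changes sign when row [m] is flipped. *)
have odd0 : E (fun q => I q * (L q + N q)) = 0.
  have := expectation_flip ME m satM cILN.
  have -> : E ((fun q => I q * (L q + N q)) \o row_flip m) =
      -1 * E (fun q => I q * (L q + N q)).
    rewrite -expectationZ//; apply: expectation_eq => q /=; rewrite /I /L /N /row_dot.
    rewrite !sum_ord4 !mxE !eqxx (negbTE lm); ring.
  lra.
(* The rotated row has squared norm (L + N) / 2 + I, whose square is L^2/4 + N^2/4 + LN/2 + I^2 +
   I(L + N). *)
have : Amom l = 4^-1 * Amom l + (4^-1 * Amom m + (2^-1 * Bmom l m +
    (Smom l m + E (fun q => I q * (L q + N q))))).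
  rewrite {1}/Amom -(expectation_rotate ME lm satM (@cdd l l l l)).
  have cLL : continuous (fun q => 4^-1 * (L q * L q)).
    by apply: continuous_funZ; exact: cdd.
  have cNN : continuous (fun q => 4^-1 * (N q * N q)).
    by apply: continuous_funZ; exact: cdd.
  have cLN : continuous (fun q => 2^-1 * (L q * N q)).
    by apply: continuous_funZ; exact: cdd.
  have cII : continuous (fun q => I q * I q) by exact: cdd.
  have c1 := continuous_funD cII cILN.
  have c2 := continuous_funD cLN c1.
  have c3 := continuous_funD cNN c2.
  rewrite -[Smom l m + _](expectationD cII cILN).
  rewrite -[2^-1 * _](expectationZ _ (@cdd l l m m)) -[X in _ + (_ + X)](expectationD cLN c1).
  rewrite -[4^-1 * Amom m](expectationZ _ (@cdd m m m m)) -[X in _ + X](expectationD cNN c2).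
  rewrite -[4^-1 * Amom l](expectationZ _ (@cdd l l l l)) -[RHS](expectationD cLL c3).
  apply: expectation_eq => q /=.
  have -> : row_dot (row_rotate l m q) l l = 2^-1 * (L q + N q + 2 * I q).
    transitivity ((Num.sqrt 2)^-1 * (Num.sqrt 2)^-1 * (L q + N q + 2 * I q)).
      by rewrite /L /N /I /row_dot !sum_ord4 !mxE !eqxx; ring.
    by rewrite sqrt2V.
  by rewrite -/(L q) -/(N q) -/(I q); field.
rewrite odd0 /Amom (row_moment_exchange m l); lra.
Qed.

Let sum_delta_cst (c : R) : \sum_(l < n) \sum_(m < n) (l == m)%:R * c = n%:R * c.
Proof.
rewrite -[in RHS](card_ord n) -sum1_card natr_sum mulr_suml; apply: eq_bigr => l _.
rewrite (bigD1 l)//= eqxx mul1r big1 ?addr0// => m /negbTE.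
by rewrite eq_sym => ->; rewrite mul0r.
Qed.

Let sum_cst (c : R) : \sum_(l < n) \sum_(m < n) c = n%:R ^+ 2 * c.
Proof. by rewrite !sumr_const card_ord -[LHS]mulr_natl -[c *+ n]mulr_natl mulrA expr2. Qed.

Let sum_Bmom : \sum_l \sum_m Bmom l m = 4.
Proof.
have -> : 4 = E (fun=> 4) by rewrite expectation_cst.
have cB l : continuous (fun q => \sum_m row_dot q l l * row_dot q m m).
  by apply: continuous_fun_sum => m; exact: cdd.
rewrite -(eq_bigr _ (fun l _ => expectation_sum (fun m => @cdd l l m m))).
rewrite -(expectation_sum cB); apply: expectation_ext => q /M2 q2.
under eq_bigr do rewrite -mulr_sumr.
rewrite -mulr_suml (_ : \sum_i row_dot q i i = 2)//; ring.
Qed.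

Variable a : R.
Hypothesis aE : forall m, Amom m = a.

(** Off the diagonal [Bmom + 2 * Smom] is [a]. On it both moments are [a], so the value is [3 * a]
    and the [n] diagonal terms bring an excess of [2 * a] each. *)
Let sum_Smom : 4 + 2 * (\sum_l \sum_m Smom l m) = n%:R * (n%:R + 2) * a.
Proof.
rewrite -sum_Bmom mulr_sumr -big_split /=.
transitivity (\sum_(l < n) \sum_(m < n) (a + (l == m)%:R * (2 * a))).
  apply: eq_bigr => l _; rewrite mulr_sumr -big_split /=; apply: eq_bigr => m _.
  have [<-|lm] := eqVneq l m; last by rewrite mul0r addr0 -Bmom_rotate.
  by rewrite -[Bmom l l]/(Amom l) -[Smom l l]/(Amom l) aE -[true%:R]/(1 : R); ring.
under eq_bigr do rewrite big_split /=.
by rewrite big_split /= sum_cst sum_delta_cst; ring.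
Qed.

(** Multiplying row [l] alone by [u] preserves the law and turns the real product of the rows into
    [unit_dot]. *)
Lemma unit_moment u l m : unit_like u -> (forall q, M q -> M (row_map u l q)) ->
  l != m -> E (fun q => unit_dot u q l m * unit_dot u q l m) = Smom l m.
Proof.
move=> [lin uu unorm _] Mu lm.
rewrite /Smom -(expectation_unit ME lin uu unorm satM Mu (@cdd l m l m)).
by apply: expectation_eq => q; rewrite /= unit_dot_map.
Qed.

Let continuous_unit_sqr u l m : unit_like u ->
  continuous (fun q => unit_dot u q l m * unit_dot u q l m).
Proof. by move=> ul; apply: continuous_funM; exact: continuous_unit_dot. Qed.

Lemma moment_pol2 : (forall q, M q -> stiefel q /\ planar q) ->
  n%:R * (n%:R + 2) * a = 8.
Proof.
move=> Mpol; rewrite -sum_Smom.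
suff -> : \sum_l \sum_m Smom l m = 2 by ring.
rewrite -[RHS]expectation_cst.
have cS l : continuous (fun q => \sum_m row_dot q l m * row_dot q l m).
  by apply: continuous_fun_sum => m; exact: cdd.
rewrite -(eq_bigr _ (fun l _ => expectation_sum (fun m => @cdd l m l m))).
rewrite -(expectation_sum cS); apply: expectation_ext => q /Mpol[st pl].
rewrite -[RHS](stiefel_dot_sum st); apply: eq_bigr => l _; apply: eq_bigr => m _.
by rewrite planar_unit_i// mulr0 addr0.
Qed.

Lemma moment_pol3 : (forall q, M q -> stiefel q) ->
  (forall q l, M q -> M (row_map (@unit_i R) l q)) ->
  n%:R * (n%:R + 1) * a = 6.
Proof.
move=> Mpol Mi.
have cF l m : continuous (fun q => row_dot q l m * row_dot q l m +
    unit_dot (@unit_i R) q l m * unit_dot (@unit_i R) q l m).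
  by apply: continuous_funD; [exact: cdd|exact: continuous_unit_sqr unit_i_like].
have cS l := continuous_fun_sum (cF l).
(* On the diagonal i q_l is orthogonal to q_l, so the term is [a] instead of [2 * a]; hence the
   correction [- a]. *)
have : \sum_l \sum_m (2 * Smom l m + (l == m)%:R * (- a)) = 2.
  rewrite -[RHS]expectation_cst.
  rewrite (eq_bigr (fun l => \sum_m E (fun q => row_dot q l m * row_dot q l m +
      unit_dot (@unit_i R) q l m * unit_dot (@unit_i R) q l m))); last first.
    move=> l _; apply: eq_bigr => m _; rewrite expectationD; last 2 first.
    - exact: cdd.
    - exact: continuous_unit_sqr unit_i_like.
    have [<-|lm] := eqVneq l m; last first.
      rewrite (unit_moment unit_i_like _ lm)//; last by move=> q; exact: Mi.
      by rewrite mul0r addr0 -/(Smom l m); ring.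
    have -> : E (fun q => unit_dot (@unit_i R) q l l * unit_dot (@unit_i R) q l l) = 0.
      rewrite -[RHS]expectation0; apply: expectation_eq => q.
      rewrite (_ : unit_dot _ _ _ _ = 0) ?mulr0//.
      by rewrite /unit_dot /unit_i sum_ord4 !ord4K /=; ring.
    by rewrite -[Smom l l]/(Amom l) -[E _]/(Amom l) aE -[true%:R]/(1 : R); ring.
  rewrite -(eq_bigr _ (fun l _ => expectation_sum (cF l))) -(expectation_sum cS).
  by apply: expectation_ext => q /Mpol; exact: stiefel_dot_sum.
under eq_bigr do rewrite big_split /= -mulr_sumr.
rewrite big_split /= -mulr_sumr sum_delta_cst; have := sum_Smom; lra.
Qed.

Lemma moment_arm2 : (forall q, M q -> planar q) ->
  (forall q l, M q -> M (row_map (@unit_j R) l q)) ->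
  n%:R * (n%:R + 1) * a = 8.
Proof.
move=> Mpl Mj.
(* On the diagonal no multiplication by j is available, and [2 * Smom] exceeds [Bmom] by [a]. *)
have : \sum_l \sum_m 2 * Smom l m = \sum_l \sum_m (Bmom l m + (l == m)%:R * a).
  apply: eq_bigr => l _; apply: eq_bigr => m _.
  have [<-|lm] := eqVneq l m.
    by rewrite -[Smom l l]/(Amom l) -[Bmom l l]/(Amom l) aE -[true%:R]/(1 : R); ring.
  rewrite mul0r addr0 mulrDl mul1r -{2}(unit_moment unit_j_like _ lm)//; last first.
    by move=> q; exact: Mj.
  rewrite -expectationD; last 2 first.
  - exact: cdd.
  - exact: continuous_unit_sqr unit_j_like.
  by apply: expectation_ext => q /Mpl; exact: planar_dot_mul.
under eq_bigr do rewrite -mulr_sumr.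
under [RHS]eq_bigr do rewrite big_split /=.
rewrite -mulr_sumr big_split /= sum_Bmom sum_delta_cst; have := sum_Smom; lra.
Qed.

Lemma moment_arm3 :
  (forall u q l, unit_like u -> M q -> M (row_map u l q)) ->
  n%:R * (2 * n%:R + 1) * a = 12.
Proof.
move=> Mu.
(* The diagonal excess is [3 * a], since there [Smom] and [Bmom] are both [a]. *)
have : \sum_l \sum_m 4 * Smom l m = \sum_l \sum_m (Bmom l m + (l == m)%:R * (3 * a)).
  apply: eq_bigr => l _; apply: eq_bigr => m _.
  have [<-|lm] := eqVneq l m.
    by rewrite -[Smom l l]/(Amom l) -[Bmom l l]/(Amom l) aE -[true%:R]/(1 : R); ring.
  rewrite mul0r addr0.
  have ui := unit_moment unit_i_like (fun q => Mu _ q l unit_i_like) lm.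
  have uj := unit_moment unit_j_like (fun q => Mu _ q l unit_j_like) lm.
  have uk := unit_moment unit_k_like (fun q => Mu _ q l unit_k_like) lm.
  have ci := @continuous_unit_sqr _ l m unit_i_like.
  have cj := @continuous_unit_sqr _ l m unit_j_like.
  have ck := @continuous_unit_sqr _ l m unit_k_like.
  transitivity (Smom l m + (Smom l m + (Smom l m + Smom l m))); first by ring.
  rewrite -{2}ui -{2}uj -{2}uk -(expectationD cj ck).
  have cjk := continuous_funD cj ck; rewrite -(expectationD ci cjk).
  have cijk := continuous_funD ci cjk; rewrite -(expectationD (@cdd l m l m) cijk).
  by apply: expectation_eq => q; exact: quaternion_dot_mul.
under eq_bigr do rewrite -mulr_sumr.
under [RHS]eq_bigr do rewrite big_split /=.
rewrite -mulr_sumr big_split /= sum_Bmom sum_delta_cst; have := sum_Smom; lra.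
Qed.

Lemma hopf_moment_diag m : E (fun q => hopf_dot q m m) = a.
Proof. by rewrite -(aE m); apply: expectation_eq => q; exact: hopf_dot_diag. Qed.

Lemma hopf_moment_arm l m : (forall q l, M q -> M (row_map (@unit_j R) l q)) ->
  l != m -> E (fun q => hopf_dot q l m) = 0.
Proof.
move=> Mj lm; have [lin uu unorm _] := unit_j_like.
have := expectation_unit ME lin uu unorm satM (fun q => Mj q l) (@continuous_hopf_dot l m).
have -> : E ((fun q => hopf_dot q l m) \o row_map (@unit_j R) l) =
    -1 * E (fun q => hopf_dot q l m).
  rewrite -expectationZ; last exact: continuous_hopf_dot.
  by apply: expectation_eq => q; rewrite /= hopf_dot_unit_j// mulN1r.
lra.
Qed.

Lemma hopf_moment_pol l m : (forall q, M q -> stiefel q) ->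
  l != m -> E (fun q => hopf_dot q l m) = - a / (n%:R - 1).
Proof.
move=> Mst lm.
have sw m' : l != m' -> E (fun q => hopf_dot q l m') = E (fun q => hopf_dot q l m).
  move=> lm'; rewrite -(expectation_swap ME m' m satM (@continuous_hopf_dot l m)).
  apply: expectation_eq => q; rewrite /= !hopf_dotE.
  have El c : row_swap m' m q l c = q l c by rewrite mxE tpermD// eq_sym.
  have Em c : row_swap m' m q m c = q m' c by rewrite mxE tpermR.
  by rewrite /hopf_coord /= !El !Em.
have : \sum_m' E (fun q => hopf_dot q l m') = 0.
  rewrite -(expectation_sum (fun m' => @continuous_hopf_dot l m')) -[RHS]expectation0.
  by apply: expectation_ext => q /Mst; exact: stiefel_hopf_dot_sum.
rewrite (bigD1 l)//= hopf_moment_diag (eq_bigr (fun=> E (fun q => hopf_dot q l m))); last first.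
  by move=> m' m'l; rewrite sw// eq_sym.
rewrite sumr_const [#|_|](_ : _ = #|predC1 l|); last by apply: eq_card => i.
rewrite cardC1 card_ord -subn1 -[E _ *+ _]mulr_natl natrB; last first.
  by rewrite (leq_trans _ (ltn_ord l)).
move=> /eqP; rewrite addrC addr_eq0 => /eqP <-.
(* The division by [n - 1] is legitimate because [l] and [m] are two distinct indices. *)
rewrite mulrAC mulfV ?mul1r// subr_eq0 pnatr_eq1.
apply: contraNneq lm => n1; move: l m {sw}; rewrite n1 => l m.
by rewrite (ord1 l) (ord1 m).
Qed.

End moments.

(** * The expected gyradius *)

Section distance_sums.
Context {R : realType}.

Lemma sum_sym_rec (F : nat -> nat -> R) N : (forall i j, F i j = F j i) -> F N N = 0 ->
  \sum_(i < N.+1) \sum_(j < N.+1) F i j =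
  \sum_(i < N) \sum_(j < N) F i j + 2 * \sum_(i < N) F N i.
Proof.
move=> Fsym FN; rewrite big_ord_recr /= big_ord_recr /= FN addr0.
under eq_bigr do rewrite big_ord_recr /=.
rewrite big_split /= -addrA; congr (_ + _).
rewrite (eq_bigr (fun i : 'I_N => F N i)); last by move=> i _; exact: Fsym.
by ring.
Qed.

Lemma sum_nat_sub N : \sum_(i < N) (N%:R - (i : nat)%:R) = N%:R * (N%:R + 1) / 2 :> R.
Proof.
elim: N => [|N IH]; first by rewrite big_ord0; field.
rewrite big_ord_recr /= (eq_bigr (fun i : 'I_N => N%:R - (i : nat)%:R + 1)); last first.
  by move=> i _; rewrite -natr1; ring.
by rewrite big_split /= IH sumr_const card_ord -natr1; field.
Qed.

Lemma sum_sqr_sub N : \sum_(i < N) (N%:R - (i : nat)%:R) ^+ 2 =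
  N%:R * (N%:R + 1) * (2 * N%:R + 1) / 6 :> R.
Proof.
elim: N => [|N IH]; first by rewrite big_ord0; field.
rewrite big_ord_recr /= (eq_bigr (fun i : 'I_N => (N%:R - (i : nat)%:R) ^+ 2 +
  (2 * (N%:R - (i : nat)%:R) + 1))); last by move=> i _; rewrite -natr1; ring.
rewrite big_split /= IH big_split /= -mulr_sumr sum_nat_sub.
by rewrite sumr_const card_ord -natr1; field.
Qed.

Lemma sum_dist N : \sum_(i < N) \sum_(j < N) `|(i : nat)%:R - (j : nat)%:R| =
  N%:R * (N%:R ^+ 2 - 1) / 3 :> R.
Proof.
elim: N => [|N IH]; first by rewrite big_ord0; field.
rewrite (@sum_sym_rec (fun i j => `|i%:R - j%:R|)); last 2 first.
- by move=> i j; rewrite distrC.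
- by rewrite subrr normr0.
rewrite IH (eq_bigr (fun i : 'I_N => N%:R - (i : nat)%:R)); last first.
  by move=> i _; rewrite ger0_norm// subr_ge0 ler_nat ltnW.
by rewrite sum_nat_sub -natr1; field.
Qed.

Lemma sum_dist_sqr N : \sum_(i < N) \sum_(j < N) ((i : nat)%:R - (j : nat)%:R) ^+ 2 =
  N%:R ^+ 2 * (N%:R ^+ 2 - 1) / 6 :> R.
Proof.
elim: N => [|N IH]; first by rewrite big_ord0; field.
rewrite (@sum_sym_rec (fun i j => (i%:R - j%:R) ^+ 2)); last 2 first.
- by move=> i j; ring.
- by rewrite subrr expr0n.
by rewrite IH sum_sqr_sub -natr1; field.
Qed.

(** The coefficient of the edge [k] in v_i - v_j: the sign of i - j on the edges between the two
    vertices, and 0 elsewhere. The weights thus sum to i - j and their squares to |i - j|. *)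
Definition edge_weight (i j k : nat) : R := (k < i)%N%:R - (k < j)%N%:R.

Lemma sum_ltn n i : (i <= n)%N -> \sum_(k < n) (k < i)%N%:R = i%:R :> R.
Proof.
move=> ni; rewrite -natr_sum; congr (_%:R).
rewrite -[RHS](card_ord i) -[RHS]sum1_card (big_ord_widen n (fun=> 1%N) ni) [RHS]big_mkcond.
by apply: eq_bigr => k _; case: (k < i)%N.
Qed.

Lemma sum_edge_weight n i j : (i <= n)%N -> (j <= n)%N ->
  \sum_(k < n) edge_weight i j k = i%:R - j%:R.
Proof. by move=> ni nj; rewrite sumrB !sum_ltn. Qed.

Lemma sum_edge_weight_sqr n i j : (i <= n)%N -> (j <= n)%N ->
  \sum_(k < n) edge_weight i j k * edge_weight i j k = `|i%:R - j%:R|.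
Proof.
wlog ji : i j / (j <= i)%N.
  move=> h ni nj; case: (leqP j i) => [ji|/ltnW ij]; first exact: h.
  rewrite distrC -h//; apply: eq_bigr => k _; rewrite /edge_weight; ring.
move=> ni nj; rewrite ger0_norm ?subr_ge0 ?ler_nat// -(sum_edge_weight ni nj).
apply: eq_bigr => k _; rewrite /edge_weight.
case: (ltnP k j) => kj; first by rewrite (leq_trans kj ji) subrr mul0r.
by rewrite subr0 -natrM mulnb andbb.
Qed.

End distance_sums.

Section expected_gyradius.
Context {R : realType} {n : nat}.

Lemma gyradiusE N d (e : 'M[R]_(n, d)) : gyradius N e = (2 * N%:R ^+ 2)^-1 *
  \sum_(i < N) \sum_(j < N) \sum_(k < n) \sum_(l < n)
    edge_weight i j k * edge_weight i j l * \sum_c e k c * e l c.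
Proof.
congr (_ * _); apply: eq_bigr => i _; apply: eq_bigr => j _.
have -> : vertex 0 e i - vertex 0 e j = \sum_(k < n) edge_weight i j k *: row k e.
  rewrite /vertex !add0r [X in X - _]big_mkcond [X in _ - X]big_mkcond -sumrB.
  apply: eq_bigr => k _; rewrite /edge_weight scalerBl.
  by case: (k < i)%N; case: (k < j)%N; rewrite ?scale1r ?scale0r.
rewrite eucl_norm_sqr eucl_dot_suml; apply: eq_bigr => k _.
rewrite eucl_dotZl eucl_dotC eucl_dot_suml mulr_sumr; apply: eq_bigr => l _.
rewrite eucl_dotZl mulrA; congr (_ * _).
by rewrite /eucl_dot big_ord1; apply: eq_bigr => c _; rewrite !mxE mulrC.
Qed.

Lemma continuous_edge_dot d k l :
  continuous (fun e : 'M[R]_(n, d) => \sum_c e k c * e l c).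
Proof.
by apply: continuous_fun_sum => c; apply: continuous_funM; exact: coord_continuous.
Qed.

Lemma continuous_gyradius N d : continuous (@gyradius R N d n).
Proof.
have -> : @gyradius R N d n = (fun e => (2 * N%:R ^+ 2)^-1 *
    \sum_(i < N) \sum_(j < N) \sum_(k < n) \sum_(l < n)
    edge_weight i j k * edge_weight i j l * \sum_c e k c * e l c).
  by apply/funext => e; exact: gyradiusE.
apply: continuous_funZ; do 4!apply: continuous_fun_sum => ?.
by apply: continuous_funZ; exact: continuous_edge_dot.
Qed.

Lemma gyradius_ge0 N d (e : 'M[R]_(n, d)) : 0 <= gyradius N e.
Proof.
rewrite mulr_ge0 ?invr_ge0 ?mulr_ge0 ?sqr_ge0//.
by do 2!apply: sumr_ge0 => ? _; exact: sqr_ge0.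
Qed.

Variables (M : set 'M[R]_(n, 4)) (E : ('M[R]_(n, 4) -> R) -> R).
Hypothesis ME : is_expectation M E.

(** With weights w_k, the expected squared distance is a sum w_k^2 + b ((sum w_k)^2 - sum w_k^2),
    that is (a - b) |i - j| + b (i - j)^2. The bound [N <= n.+1] covers both ways of counting
    vertices. *)
Lemma expectation_gyradius N d (H : 'M[R]_(n, 4) -> 'M[R]_(n, d)) (a b : R) :
  (0 < N)%N -> (N <= n.+1)%N ->
  (forall q, M q -> forall k l, \sum_c H q k c * H q l c = hopf_dot q k l) ->
  (forall m, E (fun q => hopf_dot q m m) = a) ->
  (forall l m, l != m -> E (fun q => hopf_dot q l m) = b) ->
  E (@gyradius R N d n \o H) =
  (a - b) * (N%:R ^+ 2 - 1) / (6 * N%:R) + b * (N%:R ^+ 2 - 1) / 12.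
Proof.
move=> N0 Nn HE Ea Eb.
pose F (i j k l : nat) (k' l' : 'I_n) q :=
  edge_weight i j k * edge_weight i j l * hopf_dot q k' l' : R.
have cF i j k l k' l' : continuous (F i j k l k' l').
  by apply: continuous_funZ; exact: continuous_hopf_dot.
transitivity (E (fun q => (2 * N%:R ^+ 2)^-1 *
    \sum_(i < N) \sum_(j < N) \sum_(k < n) \sum_(l < n) F i j k l k l q)).
  apply: (expectation_ext ME) => q Mq; rewrite /= gyradiusE; congr (_ * _).
  do 4!apply: eq_bigr => ? _.
  by rewrite HE.
rewrite (expectationZ ME); last by do 4!apply: continuous_fun_sum => ?; exact: cF.
rewrite (expectation_sum ME); last by move=> ?; do 3!apply: continuous_fun_sum => ?; exact: cF.
rewrite (eq_bigr (fun i : 'I_N => \sum_(j < N)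
    ((a - b) * `|(i : nat)%:R - (j : nat)%:R| + b * ((i : nat)%:R - (j : nat)%:R) ^+ 2))); last first.
  move=> i _; rewrite (expectation_sum ME); last first.
    by move=> ?; do 2!apply: continuous_fun_sum => ?; exact: cF.
  apply: eq_bigr => j _; rewrite (expectation_sum ME); last first.
    by move=> ?; apply: continuous_fun_sum => ?; exact: cF.
  have i_n : (i <= n)%N by rewrite -ltnS (leq_trans (ltn_ord i)).
  have j_n : (j <= n)%N by rewrite -ltnS (leq_trans (ltn_ord j)).
  rewrite -(sum_edge_weight_sqr i_n j_n) -(sum_edge_weight i_n j_n) expr2.
  rewrite big_distrlr /= !mulr_sumr -big_split; apply: eq_bigr => k _ /=.
  rewrite (expectation_sum ME); last by move=> ?; exact: cF.
  rewrite mulr_sumr (bigD1 k)//= [in RHS](bigD1 k)//= addrA; congr (_ + _).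
    rewrite /F (expectationZ ME) ?Ea; last exact: continuous_hopf_dot.
    by ring.
  apply: eq_bigr => l lk; rewrite /F (expectationZ ME) ?Eb 1?eq_sym//.
    by rewrite mulrC.
  exact: continuous_hopf_dot.
under eq_bigr do rewrite big_split /= -!mulr_sumr.
rewrite big_split /= -!mulr_sumr sum_dist sum_dist_sqr.
by field; rewrite pnatr_eq0 -lt0n.
Qed.

End expected_gyradius.

(** * From the model spaces to the polygon spaces *)

Section polygon_spaces.
Context {R : realType} {n : nat}.
Implicit Types q : 'M[R]_(n, 4).

(** Multiplication by j keeps norms and preserves each of the planes R + jR and iR + kR, so the
    planar components survive as well. *)
Lemma arm_space_unit_j b q l : arm_space b q -> arm_space b (row_map (@unit_j R) l q).
Proof.
move=> [q2 pl]; have [_ _ unorm _] := @unit_j_like R n; split.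
  rewrite -q2; apply: eq_bigr => i _; have [->|il] := eqVneq i l.
    by rewrite -[RHS]unorm; apply: eq_bigr => c _; rewrite mxE eqxx.
  by apply: eq_bigr => c _; rewrite mxE (negbTE il).
move=> /pl[] h; [left|right] => m; rewrite !mxE; case: eqP => // _;
  by rewrite /unit_j !inordK//=; have [-> ->] := h l; rewrite ?oppr0.
Qed.

Lemma arm_space_unit u q l : @unit_like R n u ->
  arm_space false q -> arm_space false (row_map u l q).
Proof.
move=> [_ _ unorm _] [q2 _]; split => //.
rewrite -q2; apply: eq_bigr => i _; have [->|il] := eqVneq i l.
  by rewrite -[RHS]unorm; apply: eq_bigr => c _; rewrite mxE eqxx.
by apply: eq_bigr => c _; rewrite mxE (negbTE il).
Qed.

(** Both a_l and b_l are multiplied by the unit complex number i, which leaves every term of the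
    Hermitian products unchanged. *)
Lemma pol_space_unit_i q l : pol_space false q -> pol_space false (row_map (@unit_i R) l q).
Proof.
move=> [[q1 q2 q3 q4] _]; split => //.
pose q' := row_map (@unit_i R) l q.
have q'E m c : q' m c = if m == l then unit_i (q l) c else q m c by rewrite mxE.
have sumE (f g : 'I_n -> R) : (forall m, f m = g m) -> \sum_m f m = \sum_m g m.
  by move=> fg; apply: eq_bigr.
split.
- rewrite -[RHS]q1 /col_dot -!big_split; apply: sumE => m; rewrite -/q' !q'E /=.
  by case: eqP => [->|//]; rewrite /unit_i !inordK//=; ring.
- rewrite -[RHS]q2 /col_dot -!big_split; apply: sumE => m; rewrite -/q' !q'E /=.
  by case: eqP => [->|//]; rewrite /unit_i !inordK//=; ring.
- rewrite -[RHS]q3 /col_dot -!big_split; apply: sumE => m; rewrite -/q' !q'E /=.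
  by case: eqP => [->|//]; rewrite /unit_i !inordK//=; ring.
- apply/eqP; rewrite -subr_eq0 -sumrB.
  have -> : \sum_m (q' m (inord 1) * q' m (inord 2) - q' m (inord 0) * q' m (inord 3)) =
     \sum_m (q m (inord 1) * q m (inord 2) - q m (inord 0) * q m (inord 3)).
    apply: sumE => m; rewrite !q'E; case: eqP => [->|//].
    by rewrite /unit_i !inordK//=; ring.
  by rewrite sumrB subr_eq0; apply/eqP.
Qed.

Lemma row_dot_ge0 q m : 0 <= row_dot q m m.
Proof. by apply: sumr_ge0 => c _; rewrite -expr2 sqr_ge0. Qed.

Lemma hopf2_dot q k l : planar q -> \sum_c hopf2 q k c * hopf2 q l c = hopf_dot q k l.
Proof.
move=> pl; rewrite hopf_dotE.
have h2E m (c : 'I_2) : hopf2 q m c = hopf_coord (q m) (nth 0 [:: 0; 2] c)%N.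
  rewrite mxE hopfE /hopf_coord /qcoord !mxE.
  by case: c => [[|[|]]]//= _; rewrite inordK.
have h1 m : hopf_coord (q m) 1 = 0.
  by rewrite /hopf_coord /=; case: pl => pl; have [-> ->] := pl m; rewrite !(mulr0, mul0r) subrr mulr0.
by rewrite !big_ord_recl big_ord0 addr0 !h2E /= !h1 mulr0 addr0.
Qed.

Lemma eucl_norm_hopf d (e : 'M[R]_(n, d)) q m :
  \sum_c e m c * e m c = hopf_dot q m m -> eucl_norm (row m e) = row_dot q m m.
Proof.
move=> eq; rewrite /eucl_norm /eucl_dot big_ord1.
under eq_bigr do rewrite !mxE.
by rewrite eq hopf_dot_diag -expr2 sqrtr_sqr ger0_norm// row_dot_ge0.
Qed.

Lemma Arm_hopf d (e : 'M[R]_(n, d)) q :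
  (forall m, \sum_c e m c * e m c = hopf_dot q m m) -> eucl_dot q q = 2 -> Arm e.
Proof.
move=> eq q2; rewrite /Arm /= (eq_bigr (fun m => row_dot q m m))// => m _.
exact: eucl_norm_hopf.
Qed.

Lemma measurable_Arm d : measurable (@Arm R d n : set (borel_mx R n d)).
Proof.
apply: measurable_closed_mx.
have cnorm : continuous (fun e : 'M[R]_(n, d) => \sum_m eucl_norm (row m e)).
  apply: continuous_fun_sum => m.
  have -> : (fun e : 'M[R]_(n, d) => eucl_norm (row m e)) =
      (fun e => Num.sqrt (\sum_c e m c * e m c)).
    apply/funext => e; rewrite /eucl_norm /eucl_dot big_ord1; congr Num.sqrt.
    by apply: eq_bigr => c _; rewrite !mxE.
  move=> e; apply: (@continuous_comp _ _ _ (fun e : 'M[R]_(n, d) => \sum_c e m c * e m c)).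
    exact: continuous_edge_dot.
  exact: sqrt_continuous.
apply: (@closed_comp _ _ (fun e : 'M[R]_(n, d) => \sum_m eucl_norm (row m e)) [set 2]).
  by move=> e _; exact: cnorm.
exact: closed_eq.
Qed.

Lemma measurable_Pol d : measurable (@Pol R d n : set (borel_mx R n d)).
Proof.
have -> : @Pol R d n = @Arm R d n `&`
    \bigcap_(c in [set: 'I_d]) [set e : 'M[R]_(n, d) | \sum_m e m c = 0].
  apply/seteqP; split => e [Ae h]; split => //.
    move=> c _ /=; have := congr1 (fun v : 'rV[R]_d => v 0 c) h.
    by rewrite summxE [RHS]mxE => h0; rewrite -[RHS]h0; apply: eq_bigr => m _; rewrite mxE.
  apply/rowP => c; rewrite summxE [RHS]mxE -[RHS](h c I).
  by apply: eq_bigr => m _; rewrite mxE.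
apply: measurableI; first exact: measurable_Arm.
apply: fin_bigcap_measurable => // c _; apply: measurable_closed_mx.
apply: (@closed_comp _ _ (fun e : 'M[R]_(n, d) => \sum_m e m c) [set 0]); last exact: closed_eq.
move=> e _; apply: (@continuous_fun_sum R n d _ (fun m (e : 'M[R]_(n, d)) => e m c)) => m.
exact: coord_continuous.
Qed.

Lemma row_sum_hopf3 q : stiefel q -> \sum_m row m (hopf3 q) = 0.
Proof.
move=> st; apply/rowP => c; rewrite summxE [RHS]mxE -[RHS](stiefel_hopf_closed c st).
by apply: eq_bigr => m _; rewrite mxE.
Qed.

Lemma row_sum_hopf2 q : stiefel q -> \sum_m row m (hopf2 q) = 0.
Proof.
move=> st; apply/rowP => c; rewrite summxE [RHS]mxE.
pose c3 : 'I_3 := inord (nth 0 [:: 0; 2] c)%N.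
rewrite -[RHS](stiefel_hopf_closed c3 st); apply: eq_bigr => m _; rewrite !mxE.
by rewrite /c3; case: c {c3} => [[|[|]]]//= _; rewrite inordK.
Qed.

Lemma hopf3_Arm q : arm_space false q -> @Arm R 3 n (hopf3 q).
Proof. by move=> [q2 _]; apply: Arm_hopf q2. Qed.

Lemma hopf2_Arm q : arm_space true q -> @Arm R 2 n (hopf2 q).
Proof.
by move=> [q2 pl]; apply: (Arm_hopf _ q2) => m; apply: hopf2_dot; exact: pl.
Qed.

Lemma hopf3_Pol q : pol_space false q -> @Pol R 3 n (hopf3 q).
Proof.
move=> qM; split; first exact/hopf3_Arm/pol_arm_space.
by apply: row_sum_hopf3; case: qM.
Qed.

Lemma hopf2_Pol q : pol_space true q -> @Pol R 2 n (hopf2 q).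
Proof.
move=> qM; split; first exact/hopf2_Arm/pol_arm_space.
by apply: row_sum_hopf2; case: qM.
Qed.

Hypothesis n2 : (2 <= n)%N.

Let n0 : (0 < n)%N. Proof. exact: ltnW. Qed.
Let nR : 2 <= n%:R :> R. Proof. by rewrite ler_nat. Qed.

Lemma arm_gyradius (b : bool) (m0 : 'I_n) d (H : 'M[R]_(n, 4) -> 'M[R]_(n, d))
    (E : ('M[R]_(n, 4) -> R) -> R) :
  is_expectation (arm_space b) E ->
  (forall q, arm_space b q -> forall k l, \sum_c H q k c * H q l c = hopf_dot q k l) ->
  E (@gyradius_arm R d n \o H) =
  E (fun q => row_dot q m0 m0 * row_dot q m0 m0) * (n%:R * (n%:R + 2)) / (6 * (n%:R + 1)).
Proof.
move=> ME HE; set a := E (fun q => row_dot q m0 m0 * _).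
have sat := @saturated_arm_space R n b.
have aE m : E (fun q => row_dot q m m * row_dot q m m) = a.
  exact: (row_moment_exchange ME sat m m0).
rewrite (expectation_gyradius ME (ltn0Sn n) (leqnn _) HE (hopf_moment_diag ME aE)
  (b := 0)) => [|l m lm].
  by rewrite -natr1; field; apply: lt0r_neq0; have := nR; lra.
by apply: (hopf_moment_arm ME sat) => // *; exact: arm_space_unit_j.
Qed.

Lemma pol_gyradius (b : bool) (m0 : 'I_n) d (H : 'M[R]_(n, 4) -> 'M[R]_(n, d))
    (E : ('M[R]_(n, 4) -> R) -> R) :
  is_expectation (pol_space b) E ->
  (forall q, pol_space b q -> forall k l, \sum_c H q k c * H q l c = hopf_dot q k l) ->
  E (@gyradius_pol R d n \o H) =
  E (fun q => row_dot q m0 m0 * row_dot q m0 m0) * (n%:R + 1) / 12.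
Proof.
move=> ME HE; set a := E (fun q => row_dot q m0 m0 * _).
have sat := @saturated_pol_space R n b.
have aE m : E (fun q => row_dot q m m * row_dot q m m) = a.
  exact: (row_moment_exchange ME sat m m0).
rewrite (expectation_gyradius ME n0 (leqnSn _) HE (hopf_moment_diag ME aE)
  (b := - a / (n%:R - 1))) => [|l m lm].
  by field; apply/andP; split; apply: lt0r_neq0; have := nR; lra.
by apply: (hopf_moment_pol ME sat aE) => // q [].
Qed.

End polygon_spaces.

Ltac field_side := rewrite ?andbT; repeat (apply/andP; split); apply: lt0r_neq0; lra.

Unset Implicit Arguments.

Theorem proposition19 (R : realType) (n : nat) (hn : (2 <= n)%N) :
  [/\ forall vol : {measure set (borel_mx R n 4) -> \bar R},
        riemannian_volume (4 * n - 1) (@model_Arm3 R n) vol ->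
        (\int[symmetric_measure (@hopf3_mfun R n) vol]_(e in @Arm R 3 n)
           (gyradius_arm e)%:E)%E
        = ((n%:R + 2) / ((n%:R + 1) * (n%:R + 2^-1)))%:E,
      forall vol : {measure set (borel_mx R n 4) -> \bar R},
        riemannian_volume (4 * n - 4) (@model_Pol3 R n) vol ->
        (\int[symmetric_measure (@hopf3_mfun R n) vol]_(e in @Pol R 3 n)
           (gyradius_pol e)%:E)%E
        = (2^-1 * (1 / n%:R))%:E,
      forall vol : {measure set (borel_mx R n 4) -> \bar R},
        riemannian_volume (2 * n - 1) (@model_Arm2 R n) vol ->
        (\int[symmetric_measure (@hopf2_mfun R n) vol]_(e in @Arm R 2 n)
           (gyradius_arm e)%:E)%E
        = (4 / 3 * ((n%:R + 2) / (n%:R + 1) ^+ 2))%:E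
    & forall vol : {measure set (borel_mx R n 4) -> \bar R},
        riemannian_volume (2 * n - 3) (@model_Pol2 R n) vol ->
        (\int[symmetric_measure (@hopf2_mfun R n) vol]_(e in @Pol R 2 n)
           (gyradius_pol e)%:E)%E
        = (2 / 3 * ((n%:R + 1) / (n%:R * (n%:R + 2))))%:E].
Proof.
have n0 : (0 < n)%N by exact: ltnW.
have nR : 0 < n%:R :> R by rewrite ltr0n.
have arm2 b q : @arm_space R n b q -> eucl_dot q q = 2 by case.
have pol2 b q : @pol_space R n b q -> eucl_dot q q = 2.
  by move=> /pol_arm_space; exact: arm2.
have c_hopf3 : continuous (@hopf3_mfun R n : 'M[R]_(n, 4) -> 'M[R]_(n, 3)).
  exact: continuous_hopf3.
have c_hopf2 : continuous (@hopf2_mfun R n : 'M[R]_(n, 4) -> 'M[R]_(n, 2)).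
  exact: continuous_hopf2.
have c_gyr N d := @continuous_gyradius R n N d.
have gyr_ge0 N d := @gyradius_ge0 R n N d.

split=> vol.
- rewrite model_Arm3_space => volM.
  have [E ME intE] := mnormalize_expectation (@compact_arm_space R n false)
    (arm_space_nonempty false n0) volM (@arm_space_atlas R n false).
  have sat := @saturated_arm_space R n false.
  have aE := row_moment_exchange ME sat ^~ (Ordinal n0).
  have moment := moment_arm3 ME sat (@arm2 false) aE (fun u q l => @arm_space_unit R n u q l).
  apply: etrans (intE n 3 (@hopf3_mfun R n) (@Arm R 3 n) (@gyradius_arm R 3 n)
    (@measurable_Arm R n 3) (@hopf3_Arm R n) c_hopf3 (c_gyr _ 3) (gyr_ge0 _ 3)) _.
  (* In space the scalar product of edges is [hopf_dot] by definition; in the plane [hopf2_dot] is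
     needed, because [hopf2] drops the vanishing middle coordinate. *)
  congr EFin; apply: (etrans (arm_gyradius hn (Ordinal n0) ME (fun q _ k l => erefl (hopf_dot q k l)))).
  set a := E _ in moment *.
  have -> : a = 12 / (n%:R * (2 * n%:R + 1)) by rewrite -moment; field; field_side.
  by field; field_side.
- rewrite model_Pol3_space => volM.
  have [E ME intE] := mnormalize_expectation (@compact_pol_space R n false)
    (pol_space_nonempty false hn) volM (@pol_space_atlas R n false).
  have sat := @saturated_pol_space R n false.
  have aE := row_moment_exchange ME sat ^~ (Ordinal n0).
  have moment := moment_pol3 ME sat (@pol2 false) aE (fun q => @proj1 _ _)
    (@pol_space_unit_i R n).
  apply: etrans (intE n 3 (@hopf3_mfun R n) (@Pol R 3 n) (@gyradius_pol R 3 n)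
    (@measurable_Pol R n 3) (@hopf3_Pol R n) c_hopf3 (c_gyr _ 3) (gyr_ge0 _ 3)) _.
  congr EFin; apply: (etrans (pol_gyradius hn (Ordinal n0) ME (fun q _ k l => erefl (hopf_dot q k l)))).
  set a := E _ in moment *.
  have -> : a = 6 / (n%:R * (n%:R + 1)) by rewrite -moment; field; field_side.
  by field; field_side.
- rewrite model_Arm2_space => volM.
  have [E ME intE] := mnormalize_expectation (@compact_arm_space R n true)
    (arm_space_nonempty true n0) volM (@arm_space_atlas R n true).
  have sat := @saturated_arm_space R n true.
  have aE := row_moment_exchange ME sat ^~ (Ordinal n0).
  have moment := moment_arm2 ME sat (@arm2 true) aE (fun q qM => proj2 qM isT)
    (@arm_space_unit_j R n true).
  apply: etrans (intE n 2 (@hopf2_mfun R n) (@Arm R 2 n) (@gyradius_arm R 2 n)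
    (@measurable_Arm R n 2) (@hopf2_Arm R n) c_hopf2 (c_gyr _ 2) (gyr_ge0 _ 2)) _.
  congr EFin; apply: (etrans (arm_gyradius hn (Ordinal n0) ME (fun q qM k l => hopf2_dot k l (proj2 qM isT)))).
  set a := E _ in moment *.
  have -> : a = 8 / (n%:R * (n%:R + 1)) by rewrite -moment; field; field_side.
  by field; field_side.
- rewrite model_Pol2_space => volM.
  have [E ME intE] := mnormalize_expectation (@compact_pol_space R n true)
    (pol_space_nonempty true hn) volM (@pol_space_atlas R n true).
  have sat := @saturated_pol_space R n true.
  have aE := row_moment_exchange ME sat ^~ (Ordinal n0).
  have moment := moment_pol2 ME sat (@pol2 true) aE
    (fun q qM => conj (proj1 qM) (proj2 qM isT)).
  apply: etrans (intE n 2 (@hopf2_mfun R n) (@Pol R 2 n) (@gyradius_pol R 2 n)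
    (@measurable_Pol R n 2) (@hopf2_Pol R n) c_hopf2 (c_gyr _ 2) (gyr_ge0 _ 2)) _.
  congr EFin; apply: (etrans (pol_gyradius hn (Ordinal n0) ME (fun q qM k l => hopf2_dot k l (proj2 qM isT)))).
  set a := E _ in moment *.
  have -> : a = 8 / (n%:R * (n%:R + 2)) by rewrite -moment; field; field_side.
  by field; field_side.
Qed.
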